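(* Let $n\ge 3$, $2^*=\frac{2n}{n-2}$, and $\mathbb{R}^n_+=\{x\in\mathbb{R}^n: x_1>0\}$. Let $\alpha_1,\ldots,\alpha_n$ be arbitrary nonpositive real numbers and define \[ \beta_1=-\alpha_1^2+\tfrac14,\qquad \beta_m=-\alpha_m^2+\left(\alpha_{m-1}-\tfrac12\right)^2,\quad m=2,3,\ldots,n. \] If $\alpha_n<0$, then there exists a constant $C>0$ such that for every $u\in C_0^\infty(\mathbb{R}^n_+)$ \[ \int_{\mathbb{R}^n_+}|\nabla u|^2dx\ \ge\ \int_{\mathbb{R}^n_+}\left(\frac{\beta_1}{x_1^2}+\frac{\beta_2}{x_1^2+x_2^2}+\cdots+\frac{\beta_n}{x_1^2+\cdots+x_n^2}\right)u^2dx+C\left(\int_{\mathbb{R}^n_+}|u|^{2^*}dx\right)^{2/2^*}. \] If $\alpha_n=0$, then there is no constant $C>0$ for which this inequality holds for all $u\in C_0^\infty(\mathbb{R}^n_+)$. *)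

(* Defs.v *)
From HB Require Import structures.
From mathcomp Require Import all_boot all_order all_algebra.
From mathcomp Require Import all_classical all_reals all_analysis.
Set Implicit Arguments. Unset Strict Implicit. Unset Printing Implicit Defensive.
Import Order.TTheory GRing.Theory Num.Theory numFieldNormedType.Exports.
Local Open Scope classical_set_scope.
Local Open Scope ring_scope.

Section Defs.
Variables (R : realType) (n : nat).

Definition basis_vec (i : 'I_n) : 'rV[R]_n := delta_mx 0 i.

Definition partial (i : 'I_n) (f : 'rV[R]_n -> R) : 'rV[R]_n -> R :=
  'D_(basis_vec i) f.

Fixpoint iter_partial (l : seq 'I_n) (f : 'rV[R]_n -> R) : 'rV[R]_n -> R :=
  if l is i :: l' then partial i (iter_partial l' f) else f.

Definition smooth (f : 'rV[R]_n -> R) : Prop :=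
  (forall (l : seq 'I_n) (i : 'I_n) (x : 'rV[R]_n),
      derivable (iter_partial l f) x (basis_vec i)) /\
  (forall l : seq 'I_n, continuous (iter_partial l f)).

Definition support (f : 'rV[R]_n -> R) : set 'rV[R]_n :=
  closure [set x | f x != 0].

Definition grad_sq (f : 'rV[R]_n -> R) (x : 'rV[R]_n) : R :=
  \sum_(i < n) (partial i f x) ^+ 2.

End Defs.

Definition halfspace (R : realType) (n' : nat) : set 'rV[R]_n'.+1 :=
  [set x | 0 < x 0 ord0].

Definition Cc_infty_halfspace (R : realType) (n' : nat) (f : 'rV[R]_n'.+1 -> R) : Prop :=
  smooth f /\ compact (support f) /\ support f `<=` @halfspace R n'.


Section Integral.
Variable R : realType.

Definition upd (y : nat -> R) (k : nat) (t : R) : nat -> R :=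
  fun j => if j == k then t else y j.

Fixpoint iint (k : nat) (g : (nat -> R) -> R) (y : nat -> R) : R :=
  if k is k'.+1 then
    \int[lebesgue_measure]_(t in [set: R]) iint k' g (upd y k' t)
  else g y.

(* integral over R^n, computed as the iterated integral
   \int dx_n ... \int dx_1 F(x) *)
Definition integral_Rn (n : nat) (F : 'rV[R]_n -> R) : R :=
  iint n (fun y => F (\row_(i < n) y i)) (fun _ => 0).

Definition integral_halfspace (n' : nat) (F : 'rV[R]_n'.+1 -> R) : R :=
  integral_Rn (fun x => if 0 < x 0 ord0 then F x else 0).

End Integral.

(* beta_m, m = 0..n-1 (paper's beta_{m+1}), from alpha_0..alpha_{n-1} *)
Definition beta (R : realType) (alpha : nat -> R) (m : nat) : R :=
  if m is m'.+1 then - alpha m ^+ 2 + (alpha m' - 2^-1) ^+ 2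
  else - alpha 0%N ^+ 2 + 4^-1.

Definition hardy_weight (R : realType) (n : nat) (alpha : nat -> R)
    (x : 'rV[R]_n) : R :=
  \sum_(m < n) beta alpha m / (\sum_(j < n | (j <= m)%N) x 0 j ^+ 2).

Definition crit_exp (R : realType) (n : nat) : R := (2 * n%:R) / (n%:R - 2).

Definition HSM_ineq (R : realType) (n' : nat) (alpha : nat -> R) (C : R)
    (u : 'rV[R]_n'.+1 -> R) : Prop :=
  integral_halfspace (grad_sq u) >=
    integral_halfspace (fun x => hardy_weight alpha x * u x ^+ 2)
    + C * powR (integral_halfspace (fun x => powR `|u x| (crit_exp R n'.+1)))
               (2 / crit_exp R n'.+1).

(* Main.v *)
(** The weight is [- (div A + |A|^2)] for the drift [A = grad log phi] of the
ground state [phi], a product of powers of [rho_k = x_0^2 + ... + x_k^2].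
Completing the square, the difference of the gradient and Hardy terms is
[Q u = int |grad u - u A|^2].

If the last [alpha] is negative, the divergence theorem applied to
[|u|^b (x_0, ..., x_k, 0, ..., 0) / sqrt rho_k] with [b = 2 (n - 1) / (n - 2)]
bounds every [int |u|^b / sqrt rho_k], hence [int |grad |u|^b|], by a multiple of
[int |u|^(b - 1) |grad u - u A|]. The [L^1] Sobolev inequality for [|u|^b] and
Young's inequality then give the claim.

If it vanishes, the variables [V_k = ln (rho_k / rho_(k+1))] and [ln rho_(n-1)]
have orthogonal gradients, so for [u = phi prod_k chi_k (eps_k V_k)] the quantity
[Q u] splits into one term per variable. Letting first the last [eps] and then,
downwards, the others tend to [0] makes each of them as small as wanted, while
[u] stays above a fixed nonzero function. *)

Require Import Defs.
From HB Require Import structures.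
From mathcomp Require Import all_boot all_order all_algebra.
From mathcomp Require Import all_classical all_reals all_analysis.
From mathcomp Require Import measurable_realfun ring lra.
Set Implicit Arguments. Unset Strict Implicit. Unset Printing Implicit Defensive.
Import Order.TTheory GRing.Theory Num.Theory numFieldNormedType.Exports.
Local Open Scope classical_set_scope.
Local Open Scope ring_scope.

(** The sign of the last [alpha] acts through one number. With indices from [0], the divergence
    argument gives [int |u|^b / sqrt rho_k] the coefficient [- b alpha_k + (n - 1 - k) / (n - 2)].
    For [k < n - 1] the second term alone makes it positive; for [k = n - 1] only [- b alpha_k] is
    left. The error terms carry larger indices, so the bounds are obtained downwards from
    [k = n - 1]. If that coefficient vanishes, [phi^2 / rho_(n-1) dx] is invariant under dilations:
    it is uniform in [ln rho_(n-1)], and a cutoff at scale [eps] costs [eps^2] over a length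
    [1 / eps]. The obstacle in this second half is uniformity: the bound of one term may involve the
    scales fixed before it, but not those still to be chosen. The powers of [rho_k / rho_(k+1)] in
    [phi^2] may be singular; integration by parts along [grad V_k] replaces them by higher, bounded
    powers at the price of a constant factor that does not see the cutoffs. *)

(** * Integrals of continuous functions with bounded support on the line *)

Section OneVariable.
Variable R : realType.
Notation mu := (@lebesgue_measure R).
Implicit Types f g : R -> R.

Definition int1 f : R := \int[mu]_(t in [set: R]) f t.

Definition vanishes_off (M : R) f := forall t, M <= `|t| -> f t = 0.

Definition cbs f := continuous f /\ exists M : R, vanishes_off M f.

Lemma cbs_bounded f : cbs f ->
  exists B M : R, [/\ 0 <= B, 0 < M, vanishes_off M f & forall t, `|f t| <= B].
Proof.
case=> cf [M0 hM0].
pose M := Num.max M0 1.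
have M0lt : 0 < M by rewrite lt_max ltr01 orbT.
have hM : vanishes_off M f.
  by move=> t ht; apply: hM0; apply: le_trans ht; rewrite le_max lexx.
have cw : {within `[- M, M], continuous (fun t => `|f t|)}.
  apply: continuous_subspaceT => t.
  by apply: continuous_comp; [exact: cf|exact: norm_continuous].
have [] := @EVT_max R (fun t => `|f t|) (- M) M.
- by lra.
- exact: cw.
move=> c hc hmax.
exists `|f c|, M; split => //.
move=> t; case: (leP M `|t|) => ht; first by rewrite hM ?normr0.
apply: hmax; rewrite in_itv /=.
by move: ht; rewrite ltr_norml => /andP[a b]; rewrite !ltW.
Qed.

Lemma cbs_integrable f : cbs f -> mu.-integrable setT (EFin \o f).
Proof.
move=> hf; have [B [M [B0 M0 hM hB]]] := cbs_bounded hf.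
have cf := hf.1.
have -> : f = f \_ `[- M, M].
  apply/funext => t; rewrite patchE; case: ifPn => // /negP ht.
  apply: hM; rewrite leNgt; apply/negP => h; apply: ht.
  rewrite inE /= in_itv /=.
  by move: h; rewrite ltr_norml => /andP[a b]; rewrite !ltW.
have -> : EFin \o f \_ `[- M, M] = (EFin \o f) \_ `[- M, M].
  by apply/funext => t /=; rewrite !patchE; case: ifP.
apply/(integrable_mkcond _ _).1 => //.
apply: continuous_compact_integrable; first exact: segment_compact.
exact: continuous_subspaceT.
Qed.

Lemma int1_le f g : cbs f -> cbs g -> (forall t, f t <= g t) -> int1 f <= int1 g.
Proof.
move=> hf hg fg; apply: le_Rintegral => //; exact: cbs_integrable.
Qed.

Lemma int1_ge0 f : (forall t, 0 <= f t) -> 0 <= int1 f.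
Proof. by move=> h; apply: Rintegral_ge0 => x _. Qed.

Lemma int1D f g : cbs f -> cbs g -> int1 (fun t => f t + g t) = int1 f + int1 g.
Proof. by move=> hf hg; apply: RintegralD => //; exact: cbs_integrable. Qed.

Lemma int1B f g : cbs f -> cbs g -> int1 (fun t => f t - g t) = int1 f - int1 g.
Proof. by move=> hf hg; apply: RintegralB => //; exact: cbs_integrable. Qed.

Lemma int1Z c f : cbs f -> int1 (fun t => c * f t) = c * int1 f.
Proof. by move=> hf; apply: RintegralZl => //; exact: cbs_integrable. Qed.

Lemma int1_itv M f : vanishes_off M f -> int1 f = \int[mu]_(t in `[- M, M]) f t.
Proof.
move=> hM; rewrite Rintegral_mkcond; apply: eq_Rintegral => t _.
rewrite patchE; case: ifPn => // /negP ht.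
apply: hM; rewrite leNgt; apply/negP => h; apply: ht.
rewrite inE /= in_itv /=.
by move: h; rewrite ltr_norml => /andP[a b]; rewrite !ltW.
Qed.

Lemma cbs_norm f : cbs f -> cbs (fun t => `|f t|).
Proof.
case=> cf [M hM]; split.
  by move=> t; apply: continuous_comp; [exact: cf|exact: norm_continuous].
by exists M => t ht; rewrite hM ?normr0.
Qed.

Lemma int1_norm f : cbs f -> `|int1 f| <= int1 (fun t => `|f t|).
Proof. by move=> hf; apply: le_normr_Rintegral => //; exact: cbs_integrable. Qed.

Lemma mu_itv (a b : R) : a <= b -> fine (mu `[a, b]) = b - a.
Proof.
move=> ab; have -> := lebesgue_measure_itv `[a, b].
rewrite /= lte_fin; case: ltP => // ba /=.
by apply/eqP; rewrite eq_sym subr_eq0 eq_le ba ab.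
Qed.

Lemma int1_bound (M B : R) f : cbs f -> 0 <= M -> vanishes_off M f ->
  (forall t, `|f t| <= B) -> `|int1 f| <= B * (2 * M).
Proof.
move=> hf M0 hM hB; apply: (le_trans (int1_norm hf)).
have hM' : vanishes_off M (fun t => `|f t|) by move=> t ht; rewrite hM ?normr0.
rewrite (int1_itv hM').
have mI : measurable (`[- M, M]%classic : set R) by exact: measurable_itv.
apply: (@le_trans _ _ (\int[mu]_(t in `[- M, M]) B)).
  apply: le_Rintegral => //.
  - apply: integrableS (cbs_integrable (cbs_norm hf)) => //.
  - apply: continuous_compact_integrable; first exact: segment_compact.
    by apply: continuous_subspaceT => ?; exact: cvg_cst.
by rewrite Rintegral_cst // mu_itv //; [lra|lra].
Qed.

Lemma FTC_segment a b f f' : a <= b -> continuous f' ->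
  (forall t, is_derive t (1:R) f (f' t)) ->
  \int[mu]_(t in `[a, b]) f' t = f b - f a.
Proof.
rewrite le_eqVlt => /orP[/eqP ->|ab] cf' df.
  by rewrite set_itv1 Rintegral_set1 subrr.
have cf : continuous f.
  by move=> t; apply: differentiable_continuous; apply/derivable1_diffP; case: (df t).
rewrite /Rintegral (@continuous_FTC2 _ f' f) //.
- exact: continuous_subspaceT.
- split.
  + by move=> t _; case: (df t).
  + exact: (cvg_at_right_filter (cf a)).
  + exact: (cvg_at_left_filter (cf b)).
- by move=> t _; rewrite derive1E; apply: derive_val.
Qed.

Lemma int1_derive f f' : cbs f -> cbs f' ->
  (forall t, is_derive t (1:R) f (f' t)) -> int1 f' = 0.
Proof.
move=> hf hf' df.
have [B [M [_ M0 hM _]]] := cbs_bounded hf.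
have [B' [M' [_ M0' hM' _]]] := cbs_bounded hf'.
pose N := Num.max M M'.
have MN : M <= N by rewrite le_max lexx.
have MN' : M' <= N by rewrite le_max lexx orbT.
have hN : vanishes_off N f' by move=> t ht; apply: hM'; exact: le_trans ht.
rewrite (int1_itv hN) (@FTC_segment _ _ f) //; [|lra|exact: hf'.1].
rewrite !hM ?subrr //; rewrite ?normrN ger0_norm; lra.
Qed.

(** One-dimensional Sobolev bound: [f x] is the integral of [f'] up to [x], started left of the
    support. The Gagliardo-Nirenberg argument uses it in every coordinate. *)
Lemma le_int1_derive f f' x : cbs f -> cbs f' ->
  (forall t, is_derive t (1:R) f (f' t)) -> `|f x| <= int1 (fun t => `|f' t|).
Proof.
move=> hf hf' df.
have [B [M [_ M0 hM _]]] := cbs_bounded hf.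
have [hx|hx] := leP M `|x|.
  by rewrite hM // normr0 int1_ge0.
have Mx : - M <= x by move: hx; rewrite ltr_norml => /andP[/ltW].
have -> : f x = \int[mu]_(t in `[- M, x]) f' t.
  rewrite (@FTC_segment _ _ f) //; last exact: hf'.1.
  by rewrite (hM (- M)) ?subr0 // normrN ger0_norm // ltW.
have ii := cbs_integrable hf'.
apply: (le_trans (le_normr_Rintegral _ _)) => //.
  exact: integrableS ii.
rewrite Rintegral_mkcond; apply: le_Rintegral => //.
- have -> : EFin \o (fun t => `|f' t|) \_ `[- M, x] = (EFin \o (fun t => `|f' t|)) \_ `[- M, x].
    by apply/funext => t /=; rewrite !patchE; case: ifP.
  apply/(integrable_mkcond _ _).1 => //.
  by apply: integrableS (cbs_integrable (cbs_norm hf')).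
- by apply: cbs_integrable; exact: (cbs_norm hf').
- by move=> t _; rewrite patchE; case: ifP => // _; rewrite normr_ge0.
Qed.

Lemma int1_gt0 f x : cbs f -> (forall t, 0 <= f t) -> 0 < f x -> 0 < int1 f.
Proof.
move=> hf f0 fx.
have : \forall t \near x, f x / 2 < f t.
  have /cvgr_gt := hf.1 x; apply; lra.
move=> [e /= e0 he].
have e4 : 0 < e / 2 by lra.
have sub t : t \in `[x - e / 2, x + e / 2] -> f x / 2 < f t.
  rewrite in_itv /= => /andP[a b]; apply: he => /=.
  rewrite ltr_norml; apply/andP; split; lra.
have : \int[mu]_(t in `[x - e / 2, x + e / 2]) (f x / 2) <= int1 f.
  rewrite Rintegral_mkcond; apply: le_Rintegral => //.
  - have -> : EFin \o (fun=> f x / 2) \_ `[x - e / 2, x + e / 2]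
      = (EFin \o (fun=> f x / 2)) \_ `[x - e / 2, x + e / 2].
      by apply/funext => t /=; rewrite !patchE; case: ifP.
    apply/(integrable_mkcond _ _).1 => //.
    apply: continuous_compact_integrable; first exact: segment_compact.
    by apply: continuous_subspaceT => ?; exact: cvg_cst.
  - exact: cbs_integrable.
  - move=> t _; rewrite patchE; case: ifPn => // h; apply/ltW/sub.
    by rewrite inE in h.
apply: lt_le_trans.
rewrite Rintegral_cst // mu_itv; [nra|lra].
Qed.

End OneVariable.

(** * Fubini's theorem in two variables *)

Section TwoVariables.
Variable R : realType.
Notation mu := (@lebesgue_measure R).
Implicit Types g : R -> R -> R.

(** Uniform continuity controls the variation in [s] for all [t] at once, so that integrating out
    one variable again gives a continuous function. *)
Definition uc2 g :=
  (forall e : R, 0 < e -> exists2 d : R, 0 < d & forall s t s' t',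
     `|s - s'| < d -> `|t - t'| < d -> `|g s t - g s' t'| < e) /\
  exists M : R, 0 < M /\ forall s t, M <= `|s| \/ M <= `|t| -> g s t = 0.

Lemma uc2_flip g : uc2 g -> uc2 (fun s t => g t s).
Proof.
case=> h [M [M0 hM]]; split.
  by move=> e /h[d d0 hd]; exists d => // s t s' t' a b; exact: hd.
by exists M; split => // s t [a|b]; apply: hM; [right|left].
Qed.

Lemma uc2_norm g : uc2 g -> uc2 (fun s t => `|g s t|).
Proof.
case=> h [M [M0 hM]]; split.
  move=> e /h[d d0 hd]; exists d => // s t s' t' a b.
  by apply: le_lt_trans (hd _ _ _ _ a b); exact: ler_dist_dist.
by exists M; split => // s t /hM ->; rewrite normr0.
Qed.

Lemma uc2_slice g s : uc2 g -> cbs (g s).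
Proof.
case=> h [M [M0 hM]]; split; last by exists M => t ht; apply: hM; right.
move=> t; apply/cvgrPdist_lt => e /h[d d0 hd].
exists d => //= t' ht'; apply: hd => //; by rewrite subrr normr0.
Qed.

Lemma uc2_int1 g : uc2 g -> cbs (fun s => int1 (g s)).
Proof.
move=> hg; have [h [M [M0 hM]]] := hg; split; last first.
  exists M => s hs; rewrite /int1 (_ : g s = fun=> 0); last first.
    by apply/funext => t; apply: hM; left.
  by rewrite Rintegral_cst // mul0r.
move=> s; apply/cvgrPdist_lt => e e0.
(* The integrand lives on an interval of length [2 * M], so this tolerance integrates to [e / 2]. *)
have e'0 : 0 < e / (4 * M) by rewrite divr_gt0 // mulr_gt0.
have [d d0 hd] := h _ e'0.
exists d => //= s' ss'.
have cs := uc2_slice s hg; have cs' := uc2_slice s' hg.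
rewrite -int1B //.
apply: (@le_lt_trans _ _ (e / (4 * M) * (2 * M))).
  apply: int1_bound; last 1 first.
  - by move=> t; apply/ltW/hd => //; rewrite subrr normr0.
  - split; last by exists M => t ht; rewrite !hM ?subrr //; right.
    by move=> t; apply: cvgB; [exact: cs.1|exact: cs'.1].
  - exact: ltW.
  - by move=> t ht; rewrite !hM ?subrr //; right.
have -> : e / (4 * M) * (2 * M) = e / 2 by field; rewrite gt_eqF.
by lra.
Qed.

(* Approximating [g] by functions constant in [s] on intervals of length
   [1 / N.+1] gives measurability for the product sigma-algebra. *)
Lemma uc2_measurable g : uc2 g ->
  measurable_fun [set: R * R] (fun z => g z.1 z.2).
Proof.
move=> hg; have [h _] := hg.
pose c (N : nat) (s : R) : R := (Num.floor (s * N.+1%:R))%:~R / N.+1%:R.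
apply: (measurable_fun_cvg (h := fun N z => g (c N z.1) z.2)) => [N|].
  move=> _ B mB; rewrite setTI.
  have -> : (fun z : R * R => g (c N z.1) z.2) @^-1` B =
     \bigcup_(k : int) ([set s | Num.floor (s * N.+1%:R) = k] `*`
                       (g (k%:~R / N.+1%:R) @^-1` B)).
    apply/seteqP; split => [[s t] /= Bst|[s t] [k _ [/= <-]] //].
    by exists (Num.floor (s * N.+1%:R)).
  apply: countable_bigcupT_measurable => [|k]; first exact: countableP.
  apply: measurableX.
    rewrite (_ : [set _ | _] = `[k%:~R / N.+1%:R, (k + 1)%:~R / N.+1%:R[%classic).
      exact: measurable_itv.
    apply/seteqP; split => s /=; rewrite in_itv /= ler_pdivrMr ?ltr_pdivlMr //.
      by move=> <-; exact: floor_itv.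
    by move=> ?; exact: floor_def.
  rewrite -[X in measurable X]setTI.
  by apply: (continuous_measurable_fun (uc2_slice _ hg).1).
move=> [s t] _ /=; apply/cvgrPdist_lt => e /h[d d0 hd].
near=> N; apply: hd; last by rewrite subrr normr0.
have N0 : 0 < N.+1%:R :> R by [].
have : `|s - c N s| <= N.+1%:R^-1.
  have := floor_itv (s * N.+1%:R); rewrite -ler_pdivrMr // -ltr_pdivlMr //.
  rewrite -/(c N s) intrD mulrDl mul1r -/(c N s) => /andP[a b].
  by rewrite ger0_norm ?subr_ge0 // lerBlDl ltW.
move/le_lt_trans; apply.
by near: N; apply: near_infty_natSinv_lt (PosNum d0).
Unshelve. all: by end_near. Qed.

Lemma EFin_int1 (f : R -> R) : cbs f -> (\int[mu]_t (f t)%:E)%E = (int1 f)%:E.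
Proof.
move=> hf; rewrite /int1 /Rintegral fineK //.
exact: (integrable_fin_num _ (cbs_integrable hf)).
Qed.

Lemma int1_swap g : uc2 g ->
  int1 (fun s => int1 (g s)) = int1 (fun t => int1 (fun s => g s t)).
Proof.
move=> hg.
have mg : measurable_fun [set: R * R] (fun z => (g z.1 z.2)%:E).
  by apply/measurable_EFinP; exact: uc2_measurable.
have ig : (\int[mu]_x \int[mu]_y `|(g x y)%:E| < +oo)%E.
  under eq_integral => s _.
    rewrite (EFin_int1 (uc2_slice s (uc2_norm hg))); over.
  by rewrite EFin_int1 ?ltry //; apply: uc2_int1; exact: uc2_norm.
have := Fubini ((@integrable12ltyP _ _ _ _ _ mu mu _ mg).2 ig) => /=.
under eq_integral do rewrite (EFin_int1 (uc2_slice _ hg)).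
under [in RHS]eq_integral do rewrite (EFin_int1 (uc2_slice _ (uc2_flip hg))).
rewrite !EFin_int1; [by move=> [->]|exact: uc2_int1 (uc2_flip hg)|exact: uc2_int1].
Qed.

End TwoVariables.

(** * Limits of finite products and Hölder's inequality for several functions *)

Section Holder.
Variable R : realType.

Lemma continuous_powR_norm (p : R) : 0 < p -> continuous (fun t : R => powR `|t| p).
Proof.
move=> p0 t; have [->|t0] := eqVneq t 0; last first.
  have nt : 0 < `|t| by rewrite normr_gt0.
  have h : (fun s : R => powR s p) @ `|t| --> powR `|t| p.
    have [+ _] := is_derive1_powR p nt.
    by move=> /derivable1_diffP/differentiable_continuous.
  exact: (cvg_comp _ _ (@norm_continuous _ R^o t) h).
apply/cvgrPdist_lt => e e0.
rewrite normr0 powR0 ?gt_eqF //.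
exists (powR e p^-1) => /=; first by rewrite powR_gt0.
move=> s /=; rewrite !sub0r !normrN => hs.
rewrite ger0_norm ?powR_ge0 //.
have : powR `|s| p < powR (powR e p^-1) p.
  by apply: gt0_ltr_powR => //; rewrite nnegrE ?powR_ge0.
by rewrite -powRrM mulVf ?gt_eqF // powRr1 // ltW.
Qed.

Lemma cvg_prodr (T I : Type) (F : set_system T) {FF : Filter F} (s : seq I)
    (P : pred I) (f : I -> T -> R) (a : I -> R) :
  (forall i, P i -> f i x @[x --> F] --> a i) ->
  \prod_(i <- s | P i) f i x @[x --> F] --> \prod_(i <- s | P i) a i.
Proof.
move=> h; elim: s => [|i s IH].
  by rewrite big_nil; under eq_fun do rewrite big_nil; exact: cvg_cst.
rewrite big_cons; under eq_fun do rewrite big_cons.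
by case: ifP => // Pi; apply: cvgM => //; exact: h.
Qed.

Lemma cvg_sumr (T I : Type) (F : set_system T) {FF : Filter F} (s : seq I)
    (P : pred I) (f : I -> T -> R) (a : I -> R) :
  (forall i, P i -> f i x @[x --> F] --> a i) ->
  \sum_(i <- s | P i) f i x @[x --> F] --> \sum_(i <- s | P i) a i.
Proof.
move=> h; elim: s => [|i s IH].
  by rewrite big_nil; under eq_fun do rewrite big_nil; exact: cvg_cst.
rewrite big_cons; under eq_fun do rewrite big_cons.
by case: ifP => // Pi; apply: cvgD => //; exact: h.
Qed.

Lemma cbs_cst0 : cbs (fun _ : R => 0 : R).
Proof. by split; [move=> t; exact: cvg_cst|exists 0]. Qed.

Lemma cbsZ (c : R) (f : R -> R) : cbs f -> cbs (fun t => c * f t).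
Proof.
case=> cf [M hM]; split; last by exists M => t /hM ->; rewrite mulr0.
by move=> t; apply: cvgM; [exact: cvg_cst|exact: cf].
Qed.

Lemma cbsD (f g : R -> R) : cbs f -> cbs g -> cbs (fun t => f t + g t).
Proof.
case=> cf [M hM] [cg [N hN]]; split.
  by move=> t; apply: cvgD; [exact: cf|exact: cg].
exists (Num.max M N) => t; rewrite ge_max => /andP[/hM -> /hN ->].
by rewrite addr0.
Qed.

Lemma cbs_sum (I : Type) (s : seq I) (P : pred I) (F : I -> R -> R) :
  (forall i, P i -> cbs (F i)) -> cbs (fun t => \sum_(i <- s | P i) F i t).
Proof.
move=> hF; elim: s => [|i s IH].
  by rewrite (_ : (fun t => _) = fun=> 0) ?funeqE => [|t]; [exact: cbs_cst0|rewrite big_nil].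
case Pi : (P i).
  rewrite (_ : (fun t => _) = fun t => F i t + \sum_(j <- s | P j) F j t).
    by apply: cbsD => //; exact: hF.
  by apply/funext => t; rewrite big_cons Pi.
by rewrite (_ : (fun t => _) = fun t => \sum_(j <- s | P j) F j t) // funeqE => t;
  rewrite big_cons Pi.
Qed.

Lemma int1_cst0 : int1 (fun _ : R => 0 : R) = 0.
Proof. by rewrite /int1 Rintegral_cst // mul0r. Qed.

Lemma int1_sum (I : Type) (s : seq I) (P : pred I) (F : I -> R -> R) :
  (forall i, P i -> cbs (F i)) ->
  int1 (fun t => \sum_(i <- s | P i) F i t) = \sum_(i <- s | P i) int1 (F i).
Proof.
move=> hF; elim: s => [|i s IH].
  rewrite big_nil -[RHS]int1_cst0; congr int1.
  by apply/funext => t; rewrite big_nil.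
rewrite big_cons; case: ifPn => Pi.
  rewrite -IH -int1D //; [|exact: hF|exact: cbs_sum].
  by congr int1; apply/funext => t; rewrite big_cons Pi.
by rewrite -IH; congr int1; apply/funext => t; rewrite big_cons (negbTE Pi).
Qed.

Lemma int1_eq0 (f : R -> R) : cbs f -> (forall t, 0 <= f t) -> int1 f = 0 ->
  forall t, f t = 0.
Proof.
move=> hf f0 h t; apply/eqP; rewrite eq_le f0 andbT leNgt; apply/negP => ft.
by have := int1_gt0 hf f0 ft; rewrite h ltxx.
Qed.

Lemma prod_powR (I : Type) (s : seq I) (P : pred I) (x : I -> R) (p : R) :
  (forall i, P i -> 0 <= x i) ->
  powR (\prod_(i <- s | P i) x i) p = \prod_(i <- s | P i) powR (x i) p.
Proof.
move=> hx; elim: s => [|i s IH]; first by rewrite !big_nil powR1.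
rewrite !big_cons; case: ifP => // Pi.
by rewrite powRM ?IH //; [exact: hx|exact: prodr_ge0].
Qed.

Lemma le_prod_root_mean (I : finType) (A : {pred I}) (x : I -> R) :
  (0 < #|A|)%N -> (forall i, i \in A -> 0 <= x i) ->
  \prod_(i in A) powR (x i) #|A|%:R^-1 <= (\sum_(i in A) x i) / #|A|%:R.
Proof.
move=> A0 hx; rewrite -prod_powR //.
have S0 : 0 <= (\sum_(i in A) x i) / #|A|%:R by rewrite divr_ge0 // sumr_ge0.
have := (@leif_AGM R I A x hx).1.
have hp : 0 <= (#|A|%:R : R)^-1 by rewrite invr_ge0.
move/(ge0_ler_powR hp) => h.
apply: (le_trans (h _ _)); rewrite ?nnegrE ?exprn_ge0 ?prodr_ge0 //.
by rewrite -powR_mulrn // -powRrM mulfV ?powRr1 // pnatr_eq0 -lt0n.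
Qed.

Lemma cbs_prod_powR (I : finType) (A : {pred I}) (f : I -> R -> R) (p : R) :
  0 < p -> (0 < #|A|)%N -> (forall i, i \in A -> cbs (f i)) ->
  (forall i t, i \in A -> 0 <= f i t) ->
  cbs (fun t => \prod_(i in A) powR (f i t) p).
Proof.
move=> p0 A0 hf f0.
split.
  move=> t; apply: cvg_prodr => i iA.
  have -> : (fun s => powR (f i s) p) = (fun s : R => powR `|s| p) \o f i.
    by apply/funext => s /=; rewrite ger0_norm ?f0.
  rewrite -[X in powR X p]ger0_norm ?f0 //.
  exact: cvg_comp ((hf i iA).1 t) (@continuous_powR_norm p p0 (f i t)).
have [i iA] : exists i, i \in A by apply/card_gt0P.
have [_ [M hM]] := hf i iA.
by exists M => t /hM fi0; rewrite (bigD1 i) //= fi0 powR0 ?mul0r // gt_eqF.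
Qed.

(** Divide each function by its integral and apply the inequality of arithmetic and geometric means
    pointwise: the mean of the normalised functions has integral one. *)
Lemma int1_holder (I : finType) (A : {pred I}) (f : I -> R -> R) :
  (0 < #|A|)%N -> (forall i, i \in A -> cbs (f i)) ->
  (forall i t, i \in A -> 0 <= f i t) ->
  int1 (fun t => \prod_(i in A) powR (f i t) #|A|%:R^-1) <=
  \prod_(i in A) powR (int1 (f i)) #|A|%:R^-1.
Proof.
move=> A0 hf f0; set p : R := #|A|%:R^-1.
have p0 : 0 < p by rewrite invr_gt0 ltr0n.
(* A factor of integral zero is continuous and nonnegative, hence zero, and the product vanishes.
   Otherwise the normalisation may divide. *)
have [[i [iA hi]]|hN] := pselect (exists i, i \in A /\ int1 (f i) = 0).
  have fi0 := int1_eq0 (hf i iA) (fun t => f0 i t iA) hi.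
  rewrite (_ : (fun t => _) = fun=> 0) ?int1_cst0.
    by apply: prodr_ge0 => j _; exact: powR_ge0.
  by apply/funext => t; rewrite (bigD1 i) //= fi0 powR0 ?mul0r // gt_eqF.
have c0 i : i \in A -> 0 < int1 (f i).
  move=> iA; rewrite lt_neqAle int1_ge0 ?andbT; last by move=> t; exact: f0.
  by rewrite eq_sym; apply/eqP => h; apply: hN; exists i.
set c := \prod_(i in A) powR (int1 (f i)) p.
have cge0 : 0 <= c by apply: prodr_ge0 => i _; exact: powR_ge0.
pose g t := \sum_(i in A) (c * p / int1 (f i)) * f i t.
have cg : cbs g by apply: cbs_sum => i iA; exact/cbsZ/hf.
have fE t : \prod_(i in A) powR (f i t) p
          = c * \prod_(i in A) powR (f i t / int1 (f i)) p.
  rewrite /c -big_split /=; apply: eq_bigr => i iA.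
  rewrite -powRM ?f0 //; last by rewrite divr_ge0 ?f0 // ltW // c0.
    by rewrite mulrCA mulfV ?mulr1 // gt_eqF // c0.
  by rewrite ltW // c0.
have le_g t : \prod_(i in A) powR (f i t) p <= g t.
  rewrite fE; apply: (@le_trans _ _ (c * ((\sum_(i in A) f i t / int1 (f i)) * p))).
    apply: ler_wpM2l => //; apply: le_prod_root_mean => // i iA.
    by rewrite divr_ge0 ?f0 // ltW // c0.
  rewrite /g mulr_suml mulr_sumr; apply: ler_sum => i iA.
  by rewrite le_eqVlt; apply/orP; left; apply/eqP; ring.
have cF := cbs_prod_powR p0 A0 hf f0.
apply: (le_trans (int1_le cF cg le_g)).
rewrite int1_sum; last by move=> i iA; exact/cbsZ/hf.
rewrite (eq_bigr (fun=> c * p)) => [|i iA].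
  rewrite sumr_const -mulrnAr -mulr_natr mulVf ?mulr1 //.
  by rewrite pnatr_eq0 -lt0n.
rewrite int1Z; last exact: hf.
by rewrite divfK // gt_eqF // c0.
Qed.

End Holder.

(** * Iterated integrals, partial derivatives and the Loomis-Whitney inequality *)

Section IteratedIntegral.
Variable R : realType.
Implicit Types (P Q : pred nat) (g h : (nat -> R) -> R) (y z : nat -> R).

Lemma upd_eq y k t : upd y k t k = t.
Proof. by rewrite /upd eqxx. Qed.

Lemma upd_neq y k t j : j != k -> upd y k t j = y j.
Proof. by rewrite /upd => /negbTE ->. Qed.

Lemma upd_upd y k s t : upd (upd y k s) k t = upd y k t.
Proof. by apply/funext => j; rewrite /upd; case: eqP. Qed.

Lemma upd_id y k : upd y k (y k) = y.
Proof. by apply/funext => j; rewrite /upd; case: eqP => [->|]. Qed.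

Lemma updC y i j s t : i != j -> upd (upd y i s) j t = upd (upd y j t) i s.
Proof.
move=> ij; apply/funext => k; rewrite /upd.
by case: (eqVneq k j) => // ->; case: (eqVneq j i) ij => // ->; rewrite eqxx.
Qed.

(* [cc P g]: [g] is a uniformly continuous, compactly supported function of the
   coordinates in [P] alone. *)
Definition cc P g :=
  (forall e : R, 0 < e -> exists2 d : R, 0 < d & forall y z,
     (forall j, P j -> `|y j - z j| < d) -> `|g y - g z| < e) /\
  exists M : R, 0 < M /\ forall y j, P j -> M <= `|y j| -> g y = 0.

Definition int_coord k g : (nat -> R) -> R := fun y => int1 (fun t => g (upd y k t)).

Lemma eq_cc P Q g : P =1 Q -> cc P g -> cc Q g.
Proof. by move=> /funext ->. Qed.

(** If the two values differed, uniform continuity with [e] equal to their distance would make that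
    distance smaller than itself. *)
Lemma cc_indep P g y z : cc P g -> (forall j, P j -> y j = z j) -> g y = g z.
Proof.
case=> h _ yz; apply/eqP; rewrite -subr_eq0 -normr_le0 leNgt; apply/negP => /h [d d0 hd].
have := hd y z; rewrite ltxx => /(_ _)/negP; apply => //.
by move=> j /yz ->; rewrite subrr normr0.
Qed.

Lemma cc_upd P g y k t : cc P g -> ~~ P k -> g (upd y k t) = g y.
Proof.
move=> hg Pk; apply: (cc_indep hg) => j Pj; rewrite upd_neq //.
by apply: contraNneq Pk => <-.
Qed.

Lemma cc_norm P g : cc P g -> cc P (fun y => `|g y|).
Proof.
case=> h [M [M0 hM]]; split.
  move=> e /h[d d0 hd]; exists d => // y z yz.
  by apply: le_lt_trans (hd y z yz); exact: ler_dist_dist.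
by exists M; split => // y j Pj /(hM y j Pj) ->; rewrite normr0.
Qed.

Lemma cc_uc2 P g y i j : P i -> P j -> i != j -> cc P g ->
  uc2 (fun s t => g (upd (upd y i s) j t)).
Proof.
move=> Pi Pj ij [h [M [M0 hM]]]; split.
  move=> e /h[d d0 hd]; exists d => // s t s' t' hs ht; apply: hd => k _.
  rewrite /upd; case: eqP => // _; case: eqP => // _.
  by rewrite subrr normr0.
exists M; split => // s t [hs|ht].
  by apply: (hM _ i Pi); rewrite upd_neq // upd_eq.
by apply: (hM _ j Pj); rewrite upd_eq.
Qed.

Lemma cc_slice P g y k : P k -> cc P g -> cbs (fun t => g (upd y k t)).
Proof.
move=> Pk [h [M [M0 hM]]]; split; last first.
  by exists M => t ht; apply: (hM _ k Pk); rewrite upd_eq.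
move=> t; apply/cvgrPdist_lt => e /h[d d0 hd].
exists d => //= s hs; apply: hd => j _.
by rewrite /upd; case: eqP => // _; rewrite subrr normr0.
Qed.

Lemma cc_int_coord P g k : P k -> cc P g ->
  cc (fun j => P j && (j != k)) (int_coord k g).
Proof.
move=> Pk hg; have [h [M [M0 hM]]] := hg; split; last first.
  exists M; split => // y j /andP[Pj jk] hj.
  rewrite -[RHS](@int1_cst0 R); congr int1; apply/funext => t.
  by apply: (hM _ j Pj); rewrite upd_neq.
move=> e e0.
have e'0 : 0 < e / (4 * M) by rewrite divr_gt0 // mulr_gt0.
have [d d0 hd] := h _ e'0; exists d => // y z yz.
have cy := cc_slice y Pk hg; have cz := cc_slice z Pk hg.
rewrite -int1B //.
apply: (@le_lt_trans _ _ (e / (4 * M) * (2 * M))).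
  apply: int1_bound; last 1 first.
  - move=> t; apply/ltW/hd => j Pj; have [->|jk] := eqVneq j k.
      by rewrite !upd_eq subrr normr0.
    by rewrite !upd_neq //; apply: yz; rewrite Pj.
  - split; last by exists M => t ht; rewrite !(hM _ k Pk) ?upd_eq // subrr.
    by move=> t; apply: cvgB; [exact: cy.1|exact: cz.1].
  - exact: ltW.
  - by move=> t ht; rewrite !(hM _ k Pk) ?upd_eq // subrr.
have -> : e / (4 * M) * (2 * M) = e / 2 by field; rewrite gt_eqF.
by lra.
Qed.

Lemma int_coord_swap P g i j : P i -> P j -> i != j -> cc P g ->
  int_coord i (int_coord j g) = int_coord j (int_coord i g).
Proof.
move=> Pi Pj ij hg; apply/funext => y.
rewrite /int_coord (int1_swap (cc_uc2 y Pi Pj ij hg)).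
by congr int1; apply/funext => t; congr int1; apply/funext => s; rewrite updC.
Qed.

Lemma iintS k g : iint k.+1 g = int_coord k (iint k g).
Proof. by []. Qed.

Variable n : nat.
Local Notation ccn := (cc (fun j => (j < n)%N)).

Lemma cc_iint k g : (k <= n)%N -> ccn g -> cc (fun j => (k <= j < n)%N) (iint k g).
Proof.
elim: k => [|k IH] kn hg; first by apply: eq_cc hg => j.
apply: eq_cc (cc_int_coord _ (IH (ltnW kn) hg)) => [j|]; last by rewrite leqnn.
by rewrite (ltn_neqAle k) (eq_sym k); case: (j != k); case: (k <= j)%N; case: (j < n)%N.
Qed.

Lemma cc_iint_slice k g y : (k < n)%N -> ccn g -> cbs (fun t => iint k g (upd y k t)).
Proof. by move=> kn /(cc_iint (ltnW kn)); apply: cc_slice; rewrite leqnn. Qed.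

Lemma iint_le k g h y : (k <= n)%N -> ccn g -> ccn h ->
  (forall y, g y <= h y) -> iint k g y <= iint k h y.
Proof.
move=> + hg hh gh; elim: k y => [|k IH] y kn; first exact: gh.
apply: int1_le; [exact: cc_iint_slice|exact: cc_iint_slice|].
by move=> t; apply: IH; exact: ltnW.
Qed.

Lemma iint_ge0 k g y : (forall y, 0 <= g y) -> 0 <= iint k g y.
Proof.
move=> g0; elim: k y => [|k IH] y; first exact: g0.
by apply: int1_ge0 => t; exact: IH.
Qed.

Lemma iintD k g h y : (k <= n)%N -> ccn g -> ccn h ->
  iint k (fun y => g y + h y) y = iint k g y + iint k h y.
Proof.
move=> + hg hh; elim: k y => [|k IH] y kn //=.
rewrite -!/(int1 _) -int1D; [|exact: cc_iint_slice|exact: cc_iint_slice].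
by congr int1; apply/funext => t; rewrite IH // ltnW.
Qed.

Lemma iintZ k c g y : (k <= n)%N -> ccn g ->
  iint k (fun y => c * g y) y = c * iint k g y.
Proof.
move=> + hg; elim: k y => [|k IH] y kn //=.
rewrite -!/(int1 _) -int1Z; last exact: cc_iint_slice.
by congr int1; apply/funext => t; rewrite IH // ltnW.
Qed.

Lemma iint_cst0 k y : iint k (fun _ => 0 : R) y = 0.
Proof.
elim: k y => [|k IH] y //=; rewrite -!/(int1 _) -[RHS](@int1_cst0 R).
by congr int1; apply/funext => t; exact: IH.
Qed.

Lemma iint_bound k g y (M B : R) : (k <= n)%N -> ccn g -> 0 <= M ->
  (forall y j, (j < n)%N -> M <= `|y j| -> g y = 0) -> (forall y, `|g y| <= B) ->
  `|iint k g y| <= B * (2 * M) ^+ k.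
Proof.
move=> + hg M0 hM hB; elim: k y => [|k IH] y kn; first by rewrite expr0 mulr1.
rewrite exprSr mulrA iintS; apply: int1_bound => //.
- exact: cc_iint_slice.
- move=> t ht.
  (* The integrations over coordinates below [l <= k] leave coordinate [k] untouched, so vanishing
     for large [z k] passes through them. *)
  have : forall z l, (l <= k)%N -> M <= `|z k| -> iint l g z = 0.
    move=> z l; elim: l z => [|l IHl] z; first by move=> _; exact: hM.
    move=> lk hz; rewrite /= -/(int1 _) -[RHS](@int1_cst0 R); congr int1.
    apply/funext => s; apply: IHl; first exact: ltnW.
    by rewrite upd_neq // gtn_eqF.
  by apply; rewrite ?upd_eq.
- by move=> t; apply: IH; exact: ltnW.
Qed.

Lemma iint_gt0 k g y : (k <= n)%N -> ccn g -> (forall y, 0 <= g y) ->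
  0 < g y -> 0 < iint k g y.
Proof.
move=> + hg g0; elim: k y => [|k IH] y kn gy //.
apply: (@int1_gt0 _ _ (y k)); first exact: cc_iint_slice.
  by move=> t; exact: iint_ge0.
by rewrite upd_id; apply: IH => //; exact: ltnW.
Qed.

(** The iterated integral over the coordinates below [k] except [i]. Applied to [int_coord i g], it
    integrates coordinate [i] first and then the others in their usual order. *)
Fixpoint iint_skip (i k : nat) g : (nat -> R) -> R :=
  if k is k'.+1 then
    if k' == i then iint_skip i k' g else int_coord k' (iint_skip i k' g)
  else g.

Lemma iint_skip_le i k g : (k <= i < n)%N -> ccn g ->
  iint_skip i k (int_coord i g) = int_coord i (iint k g).
Proof.
move=> + hg; elim: k => [|k IH] // /andP[ki in_]; rewrite /iint_skip -/iint_skip.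
have hk : (k <= i < n)%N by rewrite (ltnW ki).
rewrite (ltn_eqF ki).
rewrite (IH hk).
rewrite iintS.
apply: (@int_coord_swap (fun j => (k <= j < n)%N)).
- by rewrite leqnn (ltn_trans ki).
- by rewrite (ltnW ki).
- by rewrite ltn_eqF.
- by apply: cc_iint => //; exact: ltnW (ltn_trans ki in_).
Qed.

(** While [k <= i], the integral over coordinate [i] commutes outwards; at [k = i] it reaches the
    place where [iint] performs it. *)
Lemma iint_skip_gt i k g : (i < k)%N -> (i < n)%N -> ccn g ->
  iint_skip i k (int_coord i g) = iint k g.
Proof.
move=> + in_ hg; elim: k => [|k IH] // ik; rewrite /iint_skip -/iint_skip.
case: eqVneq => [->|ki]; first by rewrite iint_skip_le // leqnn.
by rewrite IH // ltn_neqAle eq_sym ki.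
Qed.

Lemma cc_iint_skip i k g : (i < n)%N -> (k <= n)%N -> ccn g ->
  cc (fun j => (k <= j < n)%N && (j != i)) (iint_skip i k (int_coord i g)).
Proof.
move=> in_ kn hg; case: (leqP k i) => ki.
  rewrite iint_skip_le ?ki //; apply: cc_int_coord; rewrite ?ki //.
  exact: cc_iint.
rewrite iint_skip_gt //; apply: eq_cc (cc_iint kn hg) => j.
by case: (leqP k j) => //= kj; rewrite (gtn_eqF (leq_trans ki kj)) andbT.
Qed.

(** In relational form, existence and value of a partial derivative travel together through the
    rules of calculus. *)
Definition pd i g y d := is_derive (y i) (1 : R) (fun t => g (upd y i t)) d.

Lemma pd_is_derive i g g' y t : (forall y, pd i g y (g' y)) ->
  is_derive t (1 : R) (fun s => g (upd y i s)) (g' (upd y i t)).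
Proof.
move=> h; have := h (upd y i t); rewrite /pd upd_eq.
by under [X in is_derive _ _ X]eq_fun do rewrite upd_upd.
Qed.

(** By [iint_skip_gt] coordinate [i] may be integrated first, and that inner integral of a
    derivative is already zero. *)
Lemma iint_pd i g g' y : (i < n)%N -> ccn g -> ccn g' ->
  (forall y, pd i g y (g' y)) -> iint n g' y = 0.
Proof.
move=> in_ hg hg' D; rewrite -(iint_skip_gt in_ in_ hg').
have -> : int_coord i g' = fun=> 0.
  apply/funext => z; apply: (@int1_derive _ (fun t => g (upd z i t))).
  - exact: cc_slice hg.
  - exact: cc_slice hg'.
  - by move=> t; exact: pd_is_derive.
elim: {1}n y => //= k IH y; case: eqP => // _.
by rewrite /int_coord -[RHS](@int1_cst0 R); congr int1; apply/funext => t; exact: IH.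
Qed.

Lemma le_int_coord_pd i g g' y : (i < n)%N -> ccn g -> ccn g' ->
  (forall y, pd i g y (g' y)) -> `|g y| <= int_coord i (fun z => `|g' z|) y.
Proof.
move=> in_ hg hg' D; rewrite -{1}(upd_id y i).
apply: (@le_int1_derive _ (fun t => g (upd y i t)) (fun t => g' (upd y i t))).
- exact: cc_slice hg.
- exact: cc_slice hg'.
- by move=> t; exact: pd_is_derive.
Qed.

(* The Loomis-Whitney inequality: each step integrates one coordinate [k], in
   which the factor [k] is constant, and applies Hölder to the others. *)
Lemma iint_loomis_whitney m (G : (nat -> R) -> R) (h : nat -> (nat -> R) -> R) y :
  n = m.+1 -> (0 < m)%N -> ccn G -> (forall i, (i < n)%N -> ccn (h i)) ->
  (forall i y, 0 <= h i y) ->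
  (forall y, G y <= \prod_(i < n) powR (int_coord i (h i) y) m%:R^-1) ->
  iint n G y <= \prod_(i < n) powR (iint n (h i) y) m%:R^-1.
Proof.
move=> nm m0 hG hh h0 hle.
pose W k i := iint_skip i k (int_coord i (h i)).
have W0 k i z : 0 <= W k i z.
  rewrite /W; elim: k z => [|k IH] z /=; first by apply: int1_ge0 => t; exact: h0.
  by case: ifP => // _; apply: int1_ge0 => t; exact: IH.
suff main k z : (k <= n)%N ->
    iint k G z <= \prod_(i < n) powR (W k i z) m%:R^-1.
  apply: le_trans (main n y (leqnn n)) _; rewrite le_eqVlt; apply/orP; left.
  apply/eqP; apply: eq_bigr => i _; congr powR.
  by rewrite /W iint_skip_gt //; exact: hh.
elim: k z => [|k IH] z kn; first exact: hle.
pose k0 := Ordinal kn.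
have card : #|[pred i | i != k0]| = m.
  have <- : #|predC1 k0| = m by rewrite cardC1 card_ord nm.
  by apply: eq_card => i; rewrite !inE.
have cW i : i != k0 -> cbs (fun t => W k i (upd z k t)).
  move=> ik; have := cc_iint_skip (ltn_ord i) (ltnW kn) (hh i (ltn_ord i)).
  apply: cc_slice; rewrite leqnn kn /=.
  by apply: contraNneq ik => ki; apply/eqP/val_inj.
have kE t : W k k0 (upd z k t) = W k k0 z.
  by rewrite /W (cc_upd _ _ (cc_iint_skip kn (ltnW kn) (hh k kn))) // eqxx andbF.
rewrite iintS (bigD1 k0) //=; rewrite {1}/W /= eqxx -/(W k k0).
have cP : cbs (fun t => \prod_(i in [pred i | i != k0]) powR (W k i (upd z k t)) m%:R^-1).
  apply: cbs_prod_powR => //; first by rewrite invr_gt0 ltr0n.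
  by rewrite card.
apply: (@le_trans _ _ (int1 (fun t => powR (W k k0 z) m%:R^-1 *
    \prod_(i in [pred i | i != k0]) powR (W k i (upd z k t)) m%:R^-1))); last first.
  rewrite int1Z //; apply: ler_wpM2l; first exact: powR_ge0.
  rewrite -card; apply: (le_trans (int1_holder _ _ _)) => //.
  - by rewrite card.
  - rewrite card le_eqVlt; apply/orP; left; apply/eqP/eq_bigr => i ik.
    congr powR; rewrite /W /= ifN //.
    by apply: contraNneq ik => ki; apply/eqP/val_inj.
apply: int1_le; [exact: cc_iint_slice|exact: cbsZ|].
move=> t; apply: (le_trans (IH _ (ltnW kn))).
by rewrite (bigD1 k0) //= kE.
Qed.

End IteratedIntegral.

(** * Continuity in the first [n] coordinates of a sequence *)

Section CoordinateFilter.
Variables (R : realType) (n : nat).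
Implicit Types (F G : (nat -> R) -> R) (y z : nat -> R).

Definition close (d : R) y z := forall j, (j < n)%N -> `|y j - z j| < d.

(** Limits are defined along arbitrary filters, so continuity in the first [n] coordinates,
    expressed by this filter, inherits the rules for sums, products and compositions. *)
Definition nb y : set_system (nat -> R) :=
  [set A | exists2 d : R, 0 < d & forall z, close d y z -> A z].

Global Instance nb_filter y : ProperFilter (nb y).
Proof.
split; first by move=> [d d0 /(_ y)]; apply => j _; rewrite subrr normr0.
split.
- by exists 1.
- move=> A B [d d0 hA] [e e0 hB]; exists (Num.min d e); first by rewrite lt_min d0.
  by move=> z yz; split; [apply: hA|apply: hB] => j /yz; rewrite lt_min => /andP[].
- by move=> A B AB [d d0 hA]; exists d => // z /hA /AB.
Qed.

Definition contn F y := F z @[z --> nb y] --> F y.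

Lemma contnP F y : contn F y <-> forall e : R, 0 < e ->
  exists2 d : R, 0 < d & forall z, close d y z -> `|F y - F z| < e.
Proof.
by split=> [/cvgrPdist_lt h e /h|h]; [|apply/cvgrPdist_lt => e /h].
Qed.

Lemma contn_coord i y : (i < n)%N -> contn (fun z => z i) y.
Proof. by move=> in_; apply/contnP => e e0; exists e => // z; apply. Qed.

Lemma contn_cst (c : R) y : contn (fun=> c) y.
Proof. exact: cvg_cst. Qed.

Lemma contnD F G y : contn F y -> contn G y -> contn (fun z => F z + G z) y.
Proof. by move=> hF hG; apply: cvgD. Qed.

Lemma contnB F G y : contn F y -> contn G y -> contn (fun z => F z - G z) y.
Proof. by move=> hF hG; apply: cvgB. Qed.

Lemma contnM F G y : contn F y -> contn G y -> contn (fun z => F z * G z) y.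
Proof. by move=> hF hG; apply: cvgM. Qed.

Lemma contn_sum (I : Type) (s : seq I) (P : pred I) (F : I -> (nat -> R) -> R) y :
  (forall i, P i -> contn (F i) y) -> contn (fun z => \sum_(i <- s | P i) F i z) y.
Proof. by move=> h; exact: cvg_sumr. Qed.

Lemma contn_prod (I : Type) (s : seq I) (P : pred I) (F : I -> (nat -> R) -> R) y :
  (forall i, P i -> contn (F i) y) -> contn (fun z => \prod_(i <- s | P i) F i z) y.
Proof. by move=> h; exact: cvg_prodr. Qed.

Lemma contn_comp (f : R -> R) F y : contn F y -> {for F y, continuous f} ->
  contn (fun z => f (F z)) y.
Proof. by move=> hF hf; exact: (cvg_comp _ _ hF hf). Qed.

Lemma contnX F y k : contn F y -> contn (fun z => F z ^+ k) y.
Proof. by move=> hF; apply: (@contn_comp (fun t => t ^+ k)) => //; exact: exprn_continuous. Qed.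

Lemma contnV F y : contn F y -> F y != 0 -> contn (fun z => (F z)^-1) y.
Proof. by move=> hF F0; apply: (@contn_comp (fun t => t^-1)) => //; exact: inv_continuous. Qed.

Lemma contn_norm F y : contn F y -> contn (fun z => `|F z|) y.
Proof. by move=> hF; apply: (@contn_comp (fun t => `|t|)) => //; exact: norm_continuous. Qed.

Lemma contn_near F G y : (\forall z \near nb y, F z = G z) -> contn F y -> contn G y.
Proof.
move=> h hF; have Fy : F y = G y by have [d d0] := h; apply => j _; rewrite subrr normr0.
apply/contnP => e e0; have /contnP/(_ e e0) [d d0 hd] := hF.
have [d' d'0 hd'] := h; exists (Num.min d d'); first by rewrite lt_min d0.
move=> z yz; rewrite -Fy -hd'; first apply: hd; move=> j /yz;
  by rewrite lt_min => /andP[].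
Qed.

Definition vec (y : nat -> R) : 'rV[R]_n := \row_(i < n) y i.
Definition unvec (x : 'rV[R]_n) : nat -> R :=
  fun j => if insub j is Some i then x 0 i else 0.

Lemma unvecE (x : 'rV[R]_n) (i : 'I_n) : unvec x i = x 0 i.
Proof. by rewrite /unvec valK. Qed.

Lemma unvecK x : vec (unvec x) = x.
Proof. by apply/rowP => i; rewrite mxE unvecE. Qed.

Lemma vecK y j : (j < n)%N -> unvec (vec y) j = y j.
Proof. by move=> jn; rewrite (unvecE _ (Ordinal jn)) mxE. Qed.

Lemma cvg_vec y : vec z @[z --> nb y] --> vec y.
Proof.
apply/cvg_ballP => e e0; exists e => // z yz; split => // i j.
by rewrite !mxE; apply: yz.
Qed.

Lemma cvg_unvec (x : 'rV[R]_n) : unvec x' @[x' --> x] --> nb (unvec x).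
Proof.
move=> A [d d0 hA]; apply/nbhs_ballP; exists d => //= x' [_ xx']; apply: hA => j jn.
by rewrite !(unvecE _ (Ordinal jn)); exact: xx'.
Qed.

Lemma contn_vec (f : 'rV[R]_n -> R) y : {for vec y, continuous f} ->
  contn (fun z => f (vec z)) y.
Proof. by move=> hf; exact: (cvg_comp _ _ (@cvg_vec y) hf). Qed.

Lemma continuous_unvec F (x : 'rV[R]_n) : contn F (unvec x) ->
  {for x, continuous (fun x' => F (unvec x'))}.
Proof. by move=> hF; exact: (cvg_comp _ _ (@cvg_unvec x) hF). Qed.

(** Heine-Cantor, by covering a compact box of row vectors. Continuity for [nb] forces [F] to ignore
    the coordinates from [n] on, which allows the passage to row vectors. *)
Lemma contn_cc F : (forall y, contn F y) ->
  (exists2 M : R, 0 < M & forall y j, (j < n)%N -> M <= `|y j| -> F y = 0) ->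
  cc (fun j => (j < n)%N) F.
Proof.
move=> cF [M M0 hM]; split; last by exists M.
move=> e e0.
have indep y z : (forall j, (j < n)%N -> y j = z j) -> F y = F z.
  move=> yz; apply/eqP; rewrite -subr_eq0 -normr_le0 leNgt; apply/negP => h.
  have /contnP/(_ _ h) [d d0 /(_ z)] := cF y; rewrite ltxx => /(_ _)/negP; apply => //.
  by move=> j /yz ->; rewrite subrr normr0.
(* The box is one unit larger than the support and [d < 1] below, so a point outside the box and all
   points close to it lie where [F] is zero. *)
pose K := [set x : 'rV[R]_n | forall i, `[- (M + 1), M + 1]%classic (x ord0 i)].
have cK : compact K.
  apply: (@rV_compact R n (fun=> `[- (M + 1), M + 1]%classic)) => i.
  exact: segment_compact.
pose P (d : R) (x : 'rV[R]_n) := forall y, close d (unvec x) y -> `|F (unvec x) - F y| < e.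
have : \forall d \near (0 : R)^'+, K `<=` P d.
  have /compact_near_coveringP cov := cK.
  apply: cov => x Kx.
  have e2 : 0 < e / 2 by rewrite divr_gt0.
  have /contnP/(_ _ e2) [d d0 hd] := cF (unvec x).
  have d2 : 0 < d / 2 by rewrite divr_gt0.
  exists ([set x' | ball x (d / 2) x'], [set d' | d' < d / 2]) => /=.
    split; first exact: nbhsx_ballx.
    exact: nbhs_right_lt.
  move=> [x' d'] /= [[_ xx'] dd'] y x'y.
  have xx'j j : (j < n)%N -> `|unvec x j - unvec x' j| < d / 2.
    by move=> jn; rewrite !(unvecE _ (Ordinal jn)); exact: xx'.
  have h1 : `|F (unvec x) - F (unvec x')| < e / 2.
    by apply: hd => j jn; apply: lt_trans (xx'j j jn) _; lra.
  have h2 : `|F (unvec x) - F y| < e / 2.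
    apply: hd => j jn; have := xx'j j jn; have := x'y j jn.
    rewrite !ltr_norml => /andP[? ?] /andP[? ?]; apply/andP; split; lra.
  by move: h1 h2; rewrite !ltr_norml => /andP[? ?] /andP[? ?]; apply/andP; split; lra.
move=> /= H.
have [d [d0 d1 Hd]] : exists d : R, [/\ 0 < d, d < 1 & K `<=` P d].
  have : \forall d \near (0 : R)^'+, [/\ 0 < d, d < 1 & K `<=` P d].
    near=> d; split.
    - by near: d; exact: nbhs_right_gt.
    - by near: d; apply: nbhs_right_lt.
    - by near: d; exact: H.
  by move/filter_ex.
exists d => // y z yz.
have [[j [jn hj]]|hN] := pselect (exists j, (j < n)%N /\ M + 1 < `|y j|).
  rewrite (hM y j jn) ?(hM z j jn) ?subrr ?normr0 //; last by lra.
  by have := yz j jn; have := ler_normD (y j - z j) (z j); rewrite subrK; lra.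
rewrite (indep y (unvec (vec y))); last by move=> j jn; rewrite vecK.
apply: Hd.
  move=> i /=; rewrite mxE in_itv /= -ler_norml leNgt; apply/negP => h.
  by apply: hN; exists i.
by move=> j jn; rewrite vecK //; exact: yz.
Unshelve. all: by end_near. Qed.

End CoordinateFilter.

(** * Integration over the half-space, divergence theorem and Gagliardo-Nirenberg inequality *)

Section HalfSpace.
Variables (R : realType) (m : nat).
Local Notation n := m.+1.
Implicit Types (F G : (nat -> R) -> R) (y z : nat -> R).

Definition in_box (d M : R) y := d <= y 0%N /\ forall j, (j < n)%N -> `|y j| <= M.

(* Continuous on the open half-space with compact support inside it;
   values off the half-space are irrelevant. *)
Definition cch F :=
  (forall y, 0 < y 0%N -> contn n F y) /\
  exists d M : R, [/\ 0 < d, 0 < M &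
    forall y, 0 < y 0%N -> F y <> 0 -> in_box d M y].

Definition ext0 F y : R := if 0 < y 0%N then F y else 0.

Definition inth F : R := iint n (ext0 F) (fun=> 0).

Local Notation ccn := (cc (fun j => (j < n)%N)).

Lemma ext0T F y : 0 < y 0%N -> ext0 F y = F y.
Proof. by rewrite /ext0 => ->. Qed.

Lemma near_pos y : 0 < y 0%N -> \forall z \near nb n y, 0 < z 0%N.
Proof.
move=> y0; exists (y 0%N) => // z yz.
by have := yz 0%N isT; rewrite ltr_norml => /andP[]; lra.
Qed.

(** The support stays at distance [d] from the boundary, so within [d] of a point with [y 0 <= 0]
    the extension is identically zero; it is therefore continuous everywhere. *)
Lemma cch_cc F : cch F -> ccn (ext0 F).
Proof.
move=> [cF [d [M [d0 M0 hM]]]]; apply: contn_cc; last first.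
  exists (M + 1) => [|y j jn hj]; first by rewrite addr_gt0.
  rewrite /ext0; case: ifP => // y0; apply: contrapT => /(hM y y0) [_ /(_ j jn)].
  by move: hj; lra.
move=> y; case: (ltP 0 (y 0%N)) => y0.
  apply: contn_near (cF y y0).
  by have [e e0 he] := near_pos y0; exists e => // z /he z0; rewrite ext0T.
apply: (@contn_near _ _ (fun=> 0)); last exact: contn_cst.
exists d => // z yz; rewrite /ext0; case: ifP => // z0.
apply/esym; apply: contrapT => /(hM z z0) [dz _].
by have := yz 0%N isT; rewrite ltr_norml => /andP[]; lra.
Qed.

(** The box of [F] serves for [G] as well. Membership in [cch] is mostly obtained in this way from a
    single compactly supported function. *)
Lemma cch_sub F G : cch F -> (forall y, 0 < y 0%N -> contn n G y) ->
  (forall y, 0 < y 0%N -> F y = 0 -> G y = 0) -> cch G.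
Proof.
move=> [_ [d [M [d0 M0 hM]]]] cG FG; split=> //; exists d, M; split=> // y y0 Gy.
by apply: hM => // /(FG y y0).
Qed.

Lemma cchZ (c : R) F : cch F -> cch (fun y => c * F y).
Proof.
move=> hF; apply: (cch_sub hF) => [y y0|y y0 ->]; last by rewrite mulr0.
by apply: contnM; [exact: contn_cst|exact: hF.1].
Qed.

Lemma cchM G F : cch F -> (forall y, 0 < y 0%N -> contn n G y) ->
  cch (fun y => G y * F y).
Proof.
move=> hF hG; apply: (cch_sub hF) => [y y0|y y0 ->]; last by rewrite mulr0.
by apply: contnM; [exact: hG|exact: hF.1].
Qed.

Lemma cchD F G : cch F -> cch G -> cch (fun y => F y + G y).
Proof.
move=> [cF [d [M [d0 M0 hM]]]] [cG [d' [M' [d'0 M'0 hM']]]]; split.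
  by move=> y y0; apply: contnD; [exact: cF|exact: cG].
exists (Num.min d d'), (Num.max M M'); split.
- by rewrite lt_min d0.
- by rewrite lt_max M0.
move=> y y0 FG; have [Fy|Fy] := pselect (F y = 0); last first.
  have [a b] := hM y y0 Fy; split; first by rewrite ge_min a.
  by move=> j /b h; rewrite le_max h.
have [a b] : in_box d' M' y by apply: hM' => // Gy; apply: FG; rewrite Fy Gy addr0.
split; first by rewrite ge_min a orbT.
by move=> j /b h; rewrite le_max h orbT.
Qed.

Lemma cchB F G : cch F -> cch G -> cch (fun y => F y - G y).
Proof.
move=> hF hG; have := cchD hF (cchZ (-1) hG).
by under eq_fun do rewrite mulN1r.
Qed.

Lemma cch0 : cch (fun=> 0).
Proof. by split; [move=> y _; exact: contn_cst|exists 1, 1; split]. Qed.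

Lemma cch_sum (I : Type) (s : seq I) (P : pred I) (F : I -> (nat -> R) -> R) :
  (forall i, P i -> cch (F i)) -> cch (fun y => \sum_(i <- s | P i) F i y).
Proof.
move=> hF; elim: s => [|i s IH].
  rewrite (_ : (fun y => _) = fun=> 0); first exact: cch0.
  by apply/funext => y; rewrite big_nil.
case Pi : (P i).
  rewrite (_ : (fun y => _) = fun y => F i y + \sum_(j <- s | P j) F j y).
    by apply: cchD => //; exact: hF.
  by apply/funext => y; rewrite big_cons Pi.
rewrite (_ : (fun y => _) = fun y => \sum_(j <- s | P j) F j y) //.
by apply/funext => y; rewrite big_cons Pi.
Qed.

Lemma eq_inth F G : (forall y, 0 < y 0%N -> F y = G y) -> inth F = inth G.
Proof.
move=> FG; rewrite /inth; congr iint; apply/funext => y.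
by rewrite /ext0; case: ifP => // /FG.
Qed.

Lemma le_inth F G : cch F -> cch G -> (forall y, 0 < y 0%N -> F y <= G y) ->
  inth F <= inth G.
Proof.
move=> hF hG FG; apply: (@iint_le _ n) => //; [exact: cch_cc|exact: cch_cc|].
by move=> y; rewrite /ext0; case: ifP => // /FG.
Qed.

Lemma inth_ge0 F : (forall y, 0 < y 0%N -> 0 <= F y) -> 0 <= inth F.
Proof. by move=> h; apply: iint_ge0 => y; rewrite /ext0; case: ifP => // /h. Qed.

Lemma inthD F G : cch F -> cch G -> inth (fun y => F y + G y) = inth F + inth G.
Proof.
move=> hF hG; rewrite /inth -(@iintD _ n) //; [|exact: cch_cc|exact: cch_cc].
by congr iint; apply/funext => y; rewrite /ext0; case: ifP => //; rewrite addr0.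
Qed.

Lemma inthZ (c : R) F : cch F -> inth (fun y => c * F y) = c * inth F.
Proof.
move=> hF; rewrite /inth -(@iintZ _ n) //; last exact: cch_cc.
by congr iint; apply/funext => y; rewrite /ext0; case: ifP => //; rewrite mulr0.
Qed.

Lemma inthB F G : cch F -> cch G -> inth (fun y => F y - G y) = inth F - inth G.
Proof.
move=> hF hG; rewrite -mulN1r -inthZ // -inthD //; last exact: cchZ.
by apply: eq_inth => y _; rewrite mulN1r.
Qed.

Lemma inth0 : inth (fun=> 0) = 0.
Proof.
rewrite /inth -[RHS](@iint_cst0 R n (fun=> 0)); congr iint.
by apply/funext => y; rewrite /ext0; case: ifP.
Qed.

Lemma inth_sum (I : Type) (s : seq I) (P : pred I) (F : I -> (nat -> R) -> R) :
  (forall i, P i -> cch (F i)) ->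
  inth (fun y => \sum_(i <- s | P i) F i y) = \sum_(i <- s | P i) inth (F i).
Proof.
move=> hF; elim: s => [|i s IH].
  by rewrite big_nil -[RHS]inth0; apply: eq_inth => y _; rewrite big_nil.
rewrite big_cons; case: ifPn => Pi.
  rewrite -IH -inthD; [|exact: hF|exact: cch_sum].
  by apply: eq_inth => y _; rewrite big_cons Pi.
by rewrite -IH; apply: eq_inth => y _; rewrite big_cons (negbTE Pi).
Qed.

Lemma pd_ext0 i F F' : (i < n)%N -> cch F ->
  (forall y, 0 < y 0%N -> pd i F y (F' y)) ->
  forall y, pd i (ext0 F) y (ext0 F' y).
Proof.
move=> in_ [_ [d [M [d0 M0 hM]]]] D y; rewrite /pd.
have near_upd (e : R) : 0 < e -> \forall t \near y i, `|y 0%N - upd y i t 0%N| < e.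
  move=> e0; have : \forall t \near y i, `|y i - t| < e.
    by exists e.
  apply: filterS => t ht; rewrite /upd; case: eqP => [->//|_].
  by rewrite subrr normr0.
case: (ltP 0 (y 0%N)) => y0.
  rewrite ext0T //; apply: near_eq_is_derive (D y y0).
  apply: filterS (near_upd _ y0) => t ht.
  by rewrite ext0T //; move: ht; rewrite ltr_norml => /andP[]; lra.
rewrite {2}/ext0 ltNge y0 /=.
apply: (@near_eq_is_derive _ _ _ (fun=> 0)).
apply: filterS (near_upd _ d0) => t ht.
rewrite /ext0; case: ifP => // z0; apply/esym; apply: contrapT => Fz.
have [dz _] := hM _ z0 Fz.
by move: ht; rewrite ltr_norml => /andP[]; lra.
Qed.

Lemma inth_pd i F F' : (i < n)%N -> cch F -> cch F' ->
  (forall y, 0 < y 0%N -> pd i F y (F' y)) -> inth F' = 0.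
Proof.
move=> in_ hF hF' D; apply: (iint_pd _ in_ (cch_cc hF) (cch_cc hF')).
exact: pd_ext0.
Qed.

(** The bound has [M + 1] since [iint_bound] wants the function to vanish on the faces of its box,
    while [F] may be nonzero at [|y j| = M]. *)
Lemma inth_bound F (M B : R) : cch F -> 0 < M ->
  (forall y, 0 < y 0%N -> F y <> 0 -> forall j, (j < n)%N -> `|y j| <= M) ->
  (forall y, 0 < y 0%N -> `|F y| <= B) -> 0 <= B ->
  inth F <= B * (2 * (M + 1)) ^+ n.
Proof.
move=> hF M0 hM hB B0; apply: le_trans (ler_norm _) _.
apply: (@iint_bound _ n) => //; first exact: cch_cc.
- by lra.
- move=> y j jn hj; rewrite /ext0; case: ifP => // y0.
  by apply: contrapT => /(hM y y0) /(_ j jn); move: hj; lra.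
- by move=> y; rewrite /ext0; case: ifP => // [/hB //|_]; rewrite normr0.
Qed.

Lemma inth_gt0 F y : cch F -> (forall y, 0 < y 0%N -> 0 <= F y) ->
  0 < y 0%N -> 0 < F y -> 0 < inth F.
Proof.
move=> hF F0 y0 Fy; have cF := cch_cc hF.
(* After all [n] integrations no coordinate is left, as [n <= j < n] is empty; hence the base point
   can be moved to [y]. *)
rewrite /inth (@cc_indep _ _ _ _ y (cc_iint (leqnn n) cF)).
  apply: (@iint_gt0 _ n) => //; last by rewrite ext0T.
  by move=> z; rewrite /ext0; case: ifP => // /F0.
by move=> j; rewrite leqNgt => /andP[/negbTE ->].
Qed.

(** Gagliardo-Nirenberg: [|F|] is at most the integral of [|F' i|] along coordinate [i], for each
    [i]. The product of the [m]-th roots of these [n] bounds has the shape required by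
    Loomis-Whitney. *)
Lemma inth_sobolev F (F' : nat -> (nat -> R) -> R) (G : (nat -> R) -> R) :
  (0 < m)%N -> cch F -> cch G -> (forall i, (i < n)%N -> cch (F' i)) ->
  (forall i y, (i < n)%N -> 0 < y 0%N -> pd i F y (F' i y)) ->
  (forall y, 0 < y 0%N -> G y = powR `|F y| (n%:R / m%:R)) ->
  inth G <= \prod_(i < n) powR (inth (fun y => `|F' i y|)) m%:R^-1.
Proof.
move=> m0 hF hG hF' D GE.
pose h i y := if (i < n)%N then `|ext0 (F' i) y| else 0.
have ch i : (i < n)%N -> ccn (h i).
  by move=> in_; rewrite /h in_; apply: cc_norm; exact: cch_cc (hF' i in_).
have h0 i y : 0 <= h i y by rewrite /h; case: ifP.
rewrite (eq_bigr (fun i : 'I_n => powR (iint n (h i) (fun=> 0)) m%:R^-1)).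
  apply: iint_loomis_whitney ch h0 _ => //; first exact: cch_cc.
  move=> y; have le1 i : (i < n)%N -> `|ext0 F y| <= int_coord i (h i) y.
    move=> in_; rewrite /h in_; apply: (@le_int_coord_pd _ n) => //.
    - exact: cch_cc.
    - exact: cch_cc (hF' i in_).
    - by apply: pd_ext0 => // z z0; exact: D.
  have -> : ext0 G y = \prod_(i < n) powR `|ext0 F y| m%:R^-1.
    rewrite prodr_const card_ord -powR_mulrn ?powR_ge0 // -powRrM mulrC.
    rewrite /ext0; case: ifP => [/GE //|_]; rewrite normr0 powR0 //.
    by rewrite mulf_neq0 ?invr_neq0 ?pnatr_eq0 // -lt0n.
  apply: ler_prod => i _; rewrite powR_ge0 /=; apply: ge0_ler_powR.
  - by rewrite invr_ge0.
  - by rewrite nnegrE.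
  - by rewrite nnegrE (le_trans _ (le1 i _)).
  - exact: le1.
move=> i _; congr powR; rewrite /inth /h ltn_ord; congr iint.
by apply/funext => y; rewrite /ext0; case: ifP => //; rewrite normr0.
Qed.

End HalfSpace.

(** * Calculus of the partial squared norms [rho k] *)

Section Calculus.
Variable R : realType.
Implicit Types (F G : (nat -> R) -> R) (y z : nat -> R).

Lemma pd_eq i F y d d' : pd i F y d -> d = d' -> pd i F y d'.
Proof. by move=> h <-. Qed.

Lemma pd_cst i (c : R) y : pd i (fun=> c) y 0.
Proof. exact: is_derive_cst. Qed.

Lemma pd_coord i j y : pd i (fun z => z j) y (i == j)%:R.
Proof.
rewrite /pd /upd; case: (eqVneq i j) => [->|ij]; first exact: is_derive_id.
exact: is_derive_cst.
Qed.

Lemma pdD i F G y dF dG : pd i F y dF -> pd i G y dG ->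
  pd i (fun z => F z + G z) y (dF + dG).
Proof. by move=> hF hG; exact: is_deriveD. Qed.

Lemma pdM i F G y dF dG : pd i F y dF -> pd i G y dG ->
  pd i (fun z => F z * G z) y (dF * G y + F y * dG).
Proof.
move=> hF hG; have := is_deriveM hF hG; rewrite upd_id => h.
by apply: (is_derive_eq h); rewrite /GRing.scale /= addrC; congr (_ + _); rewrite mulrC.
Qed.

Lemma pdZ i (c : R) F y dF : pd i F y dF -> pd i (fun z => c * F z) y (c * dF).
Proof. by move=> hF; apply: pd_eq (pdM (pd_cst i c y) hF) _; rewrite mul0r add0r. Qed.

Lemma pd_comp i (f : R -> R) F y df dF : pd i F y dF -> is_derive (F y) (1 : R) f df ->
  pd i (fun z => f (F z)) y (df * dF).
Proof.
move=> hF; rewrite -{1}(upd_id y i) => hf.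
exact: (is_derive1_comp hf hF).
Qed.

Lemma pd_sum i (I : Type) (s : seq I) (P : pred I) (F : I -> (nat -> R) -> R)
    (dF : I -> R) y : (forall j, P j -> pd i (F j) y (dF j)) ->
  pd i (fun z => \sum_(j <- s | P j) F j z) y (\sum_(j <- s | P j) dF j).
Proof.
move=> h; elim: s => [|j s IH].
  rewrite big_nil (_ : (fun z => _) = fun=> 0); first exact: pd_cst.
  by apply/funext => z; rewrite big_nil.
rewrite big_cons; case: ifPn => Pj.
  rewrite (_ : (fun z => _) = fun z => F j z + \sum_(j <- s | P j) F j z).
    by apply: pdD => //; exact: h.
  by apply/funext => z; rewrite big_cons Pj.
rewrite (_ : (fun z => _) = fun z => \sum_(j <- s | P j) F j z) //.
by apply/funext => z; rewrite big_cons (negbTE Pj).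
Qed.

Definition rho k y : R := \sum_(0 <= j < k.+1) y j ^+ 2.

Lemma rhoS k y : rho k.+1 y = rho k y + y k.+1 ^+ 2.
Proof. by rewrite /rho big_nat_recr. Qed.

Lemma rho_gt0 k y : 0 < y 0%N -> 0 < rho k y.
Proof.
move=> y0; elim: k => [|k IH]; first by rewrite /rho big_nat1 exprn_gt0.
by rewrite rhoS ltr_wpDr // sqr_ge0.
Qed.

Lemma rho_le k l y : (k <= l)%N -> rho k y <= rho l y.
Proof.
elim: l => [|l IH]; first by rewrite leqn0 => /eqP ->.
rewrite leq_eqVlt => /predU1P[-> //|/IH h].
by rewrite rhoS (le_trans h) // lerDl sqr_ge0.
Qed.

Lemma sqr_le_rho k j y : (j <= k)%N -> y j ^+ 2 <= rho k y.
Proof.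
move=> jk; apply: le_trans (rho_le y jk); rewrite /rho big_nat_recr //= lerDr.
by apply: sumr_ge0 => i _; exact: sqr_ge0.
Qed.

Definition ri k y : R := (rho k y)^-1.

Lemma ri_gt0 k y : 0 < y 0%N -> 0 < ri k y.
Proof. by move=> y0; rewrite invr_gt0 rho_gt0. Qed.

Lemma pd_sqr i j y : pd i (fun z => z j ^+ 2) y (if i == j then 2 * y i else 0).
Proof.
have := pdM (pd_coord i j y) (pd_coord i j y).
by move/pd_eq; apply; case: eqP => [->|_] /=; ring.
Qed.

Lemma pd_rho i k y : pd i (rho k) y ((i <= k)%:R * (2 * y i)).
Proof.
elim: k => [|k IH].
  rewrite (_ : rho 0 = fun z => z 0%N ^+ 2); last first.
    by apply/funext => z; rewrite /rho big_nat1.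
  by apply: pd_eq (pd_sqr i 0 y) _; case: i => [|i] /=; ring.
rewrite (_ : rho k.+1 = fun z => rho k z + z k.+1 ^+ 2); last first.
  by apply/funext => z; rewrite rhoS.
apply: pd_eq (pdD IH (pd_sqr i k.+1 y)) _.
case: eqVneq => [->|ik]; first by rewrite ltnn leqnn /=; ring.
by rewrite [(i <= k.+1)%N]leq_eqVlt (negbTE ik) /= ltnS addr0.
Qed.

Lemma is_derive_inv (x : R) : x != 0 -> is_derive x (1 : R) (fun t => t^-1) (- (x^-1) ^+ 2).
Proof.
move=> x0; have := is_deriveV x0 (is_derive_id x (1 : R)).
by move/is_derive_eq; apply; rewrite /GRing.scale /= mulr1 exprVn.
Qed.

Lemma pd_ri i k y : 0 < y 0%N ->
  pd i (ri k) y (- (i <= k)%:R * (2 * y i * ri k y ^+ 2)).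
Proof.
move=> y0; have := pd_comp (pd_rho i k y) (is_derive_inv (lt0r_neq0 (rho_gt0 k y0))).
by move/pd_eq; apply; rewrite -/(ri k y); ring.
Qed.

Variable n : nat.

Lemma contn_rho k y : (k < n)%N -> contn n (rho k) y.
Proof.
move=> kn; rewrite (_ : rho k = fun z => \sum_(j < k.+1) z j ^+ 2).
  apply: (@contn_sum _ _ _ _ _ (fun (j : 'I_k.+1) z => z j ^+ 2)) => j _.
  by apply: contnX; apply: contn_coord; exact: leq_trans (ltn_ord j) kn.
by apply/funext => z; rewrite /rho big_mkord.
Qed.

Lemma contn_ri k y : (k < n)%N -> 0 < y 0%N -> contn n (ri k) y.
Proof.
move=> kn y0; apply: contnV; first exact: contn_rho.
by rewrite gt_eqF // rho_gt0.
Qed.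

End Calculus.

(** * The drift and the ground state identity *)

Section GroundState.
Variables (R : realType) (m : nat) (alpha : nat -> R).
Local Notation n := m.+1.
Implicit Types (F G : (nat -> R) -> R) (y z : nat -> R).

(* Shifted by one against the exponents of the ground state
   [\prod_(k < n) (rho k / rho k.+1) ^ (spow k.+1 / 2)], so that
   [apow k = spow k.+1 - spow k] is the exponent of [rho k] itself. *)
Definition spow (k : nat) : R :=
  if k is k'.+1 then - alpha k' - (k'%:R - 1) / 2 else 0.
Definition apow k := spow k.+1 - spow k.

(** [y i * tpow N i y] is the partial derivative in coordinate [i] of the logarithm of the product
    of the [rho k ^ (apow k / 2)] with [k < N]. *)
Definition tpow (N i : nat) y : R := \sum_(0 <= k < N) (i <= k)%:R * (apow k * ri k y).

Lemma tpowS N i y : tpow N.+1 i y = tpow N i y + (i <= N)%:R * (apow N * ri N y).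
Proof. by rewrite /tpow big_nat_recr. Qed.

Lemma tpow_ge N i y : (N <= i)%N -> tpow N i y = 0.
Proof.
move=> Ni; rewrite /tpow big_nat big1 // => k /andP[_ kN].
by rewrite leqNgt (leq_trans kN Ni) mul0r.
Qed.

(** Euler's identity: the product of the first [N] powers is homogeneous, and the sum of the
    [apow k] telescopes to its degree [spow N]. *)
Lemma sum_tpow N y : 0 < y 0%N ->
  \sum_(0 <= i < N) y i ^+ 2 * tpow N i y = spow N.
Proof.
move=> y0; elim: N => [|N IH]; first by rewrite big_geq.
rewrite (eq_big_nat _ _ (F2 := fun i => y i ^+ 2 * tpow N i y +
    y i ^+ 2 * (apow N * ri N y))); last first.
  by move=> i /andP[_ iN]; rewrite tpowS -ltnS iN mul1r mulrDr.
rewrite big_split /= -mulr_suml big_nat_recr //= IH tpow_ge // mulr0 addr0.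
by rewrite -/(rho N y) mulrCA /ri mulfV ?mulr1 ?gt_eqF ?rho_gt0 // /apow addrC subrK.
Qed.

(** Induction on the number of powers. A new factor [rho N ^ (apow N / 2)] adds a cross term,
    evaluated by Euler's identity, a square and a divergence, all three multiples of [ri N]. *)
Lemma ground_state_equation N y : 0 < y 0%N ->
  \sum_(0 <= i < N) (y i * tpow N i y) ^+ 2 +
  \sum_(0 <= i < N) \sum_(0 <= k < N) (i <= k)%:R *
     (apow k * (ri k y - 2 * y i ^+ 2 * ri k y ^+ 2))
  = - \sum_(0 <= k < N) beta alpha k * ri k y.
Proof.
move=> y0; elim: N => [|N IH]; first by rewrite !big_geq // oppr0 addr0.
have rN : rho N y * ri N y = 1 by rewrite mulfV // gt_eqF // rho_gt0.
rewrite [in RHS]big_nat_recr //= opprD -IH.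
rewrite (eq_big_nat _ _ (F2 := fun i => (y i * tpow N i y) ^+ 2 +
    (2 * (apow N * ri N y) * (y i ^+ 2 * tpow N i y) +
     (apow N * ri N y) ^+ 2 * y i ^+ 2))); last first.
  by move=> i /andP[_ iN]; rewrite tpowS -ltnS iN mul1r; ring.
rewrite !big_split /= -!mulr_sumr -/(rho N y).
rewrite (big_nat_recr N) //= (big_nat_recr N) //= tpow_ge // !mulr0 expr0n addr0 addr0.
rewrite sum_tpow //.
rewrite [X in _ + X = _](eq_big_nat _ _ (F2 := fun i =>
   \sum_(0 <= k < N) (i <= k)%:R * (apow k * (ri k y - 2 * y i ^+ 2 * ri k y ^+ 2)) +
   (apow N * ri N y - 2 * apow N * ri N y ^+ 2 * y i ^+ 2))); last first.
  move=> i /andP[_ iN]; rewrite big_nat_recr //= -ltnS iN mul1r; congr (_ + _).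
  by ring.
have Z : \sum_(0 <= k < N) (N <= k)%:R *
    (apow k * (ri k y - 2 * y N ^+ 2 * ri k y ^+ 2)) = 0.
  by rewrite big_nat big1 // => k /andP[_ kN]; rewrite leqNgt kN mul0r.
rewrite big_split /= (big_nat_recr N) //= Z addr0.
have S1 : \sum_(0 <= i < N.+1) apow N * ri N y = apow N * ri N y * N.+1%:R.
  by rewrite sumr_const_nat subn0 mulr_natr.
have S2 : \sum_(0 <= i < N.+1) 2 * apow N * ri N y ^+ 2 * y i ^+ 2 =
    2 * apow N * ri N y ^+ 2 * rho N y by rewrite mulr_sumr.
rewrite sumrB S1 S2.
have -> : (apow N * ri N y) ^+ 2 * rho N y = apow N ^+ 2 * ri N y.
  by rewrite -[RHS]mulr1 -rN; ring.
have -> : 2 * apow N * ri N y ^+ 2 * rho N y = 2 * apow N * ri N y.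
  by rewrite -[RHS]mulr1 -rN; ring.
rewrite !addrA; set A := \sum_(0 <= i < N) _; set B := \sum_(0 <= i < N) _.
(* The bracket is the square of [spow N.+1 + (N - 1) / 2 = - alpha N] minus that of
   [spow N + (N - 1) / 2], which is [1 / 2 - alpha (N - 1)], or [- 1 / 2] for [N = 0]. This is the
   origin of [spow]. *)
have -> : beta alpha N = - (2 * apow N * spow N + apow N ^+ 2 + apow N * (N%:R - 1)).
  rewrite /apow; case: N {IH A B rN Z S1 S2} => [|N] /=; first by field.
  by rewrite -!natr1; field.
by rewrite -(natr1 N); ring.
Qed.

Definition weight y : R := \sum_(0 <= k < n) beta alpha k * ri k y.
Definition adrift i y := y i * tpow n i y.
Definition dadrift i y :=
  \sum_(0 <= k < n) (i <= k)%:R * (apow k * (ri k y - 2 * y i ^+ 2 * ri k y ^+ 2)).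

Lemma pd_adrift i y : 0 < y 0%N -> pd i (adrift i) y (dadrift i y).
Proof.
move=> y0.
have h : pd i (fun z => tpow n i z) y
    (\sum_(0 <= k < n) (i <= k)%:R * (apow k * (- (i <= k)%:R * (2 * y i * ri k y ^+ 2)))).
  apply: (@pd_sum _ _ _ _ _ (fun k z => (i <= k)%:R * (apow k * ri k z))) => k _.
  by do 2!apply: pdZ; exact: pd_ri.
apply: pd_eq (pdM (pd_coord i i y) h) _; rewrite eqxx mul1r /tpow mulr_sumr -big_split /=.
by apply: eq_bigr => k _; case: (i <= k)%N => /=; ring.
Qed.

Lemma contn_adrift i y : (i < n)%N -> 0 < y 0%N -> contn n (adrift i) y.
Proof.
move=> in_ y0; apply: contnM; first exact: contn_coord.
rewrite (_ : tpow n i = fun z => \sum_(k < n) (i <= k)%:R * (apow k * ri k z)).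
  apply: (@contn_sum _ _ _ _ _ (fun (k : 'I_n) z => (i <= k)%:R * (apow k * ri k z))) => k _.
  by apply/contnM/contnM/contn_ri => //; exact: contn_cst.
by apply/funext => z; rewrite /tpow big_mkord.
Qed.

Lemma contn_dadrift i y : (i < n)%N -> 0 < y 0%N -> contn n (dadrift i) y.
Proof.
move=> in_ y0.
rewrite (_ : dadrift i = fun z => \sum_(k < n) (i <= k)%:R *
    (apow k * (ri k z - 2 * z i ^+ 2 * ri k z ^+ 2))).
  apply: (@contn_sum _ _ _ _ _ (fun (k : 'I_n) z => (i <= k)%:R *
    (apow k * (ri k z - 2 * z i ^+ 2 * ri k z ^+ 2)))) => k _.
  apply: contnM; first exact: contn_cst.
  apply: contnM; first exact: contn_cst.
  apply: contnB; first exact: contn_ri.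
  apply: contnM; last by apply: contnX; exact: contn_ri.
  apply: contnM; first exact: contn_cst.
  by apply: contnX; exact: contn_coord.
by apply/funext => z; rewrite /dadrift big_mkord.
Qed.

Lemma contn_weight y : 0 < y 0%N -> contn n weight y.
Proof.
move=> y0; rewrite (_ : weight = fun z => \sum_(k < n) beta alpha k * ri k z).
  apply: (@contn_sum _ _ _ _ _ (fun (k : 'I_n) z => beta alpha k * ri k z)) => k _.
  by apply/contnM/contn_ri => //; exact: contn_cst.
by apply/funext => z; rewrite /weight big_mkord.
Qed.

Record c1h (v : (nat -> R) -> R) (Dv : nat -> (nat -> R) -> R) : Prop := C1h {
  c1h_cch : cch m v;
  c1h_dcch : forall i, (i < n)%N -> cch m (Dv i);
  c1h_pd : forall i y, (i < n)%N -> 0 < y 0%N -> pd i v y (Dv i y) }.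

(** For the ground state [phi] this is [phi] times the derivative of [v / phi], written without
    [phi]. *)
Definition defect v (Dv : nat -> (nat -> R) -> R) i y : R := Dv i y - v y * adrift i y.

Lemma cch_defect v Dv i : c1h v Dv -> (i < n)%N -> cch m (defect v Dv i).
Proof.
move=> [cv cDv _] in_; apply: cchB; first exact: cDv.
rewrite (_ : (fun y => _) = fun y => adrift i y * v y); last first.
  by apply/funext => y; rewrite mulrC.
by apply: (cchM cv) => y y0; exact: contn_adrift.
Qed.

Lemma cch_sqr F : cch m F -> cch m (fun y => F y ^+ 2).
Proof.
move=> hF; apply: (cch_sub hF) => [y y0|y y0 ->]; last by rewrite expr0n.
by apply: contnX; exact: hF.1.
Qed.

(* Integrating the divergence of [v^2] times the drift completes the square. *)
Lemma ground_state_identity v Dv : c1h v Dv ->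
  inth m (fun y => \sum_(i < n) Dv i y ^+ 2) =
  inth m (fun y => weight y * v y ^+ 2) +
  inth m (fun y => \sum_(i < n) defect v Dv i y ^+ 2).
Proof.
move=> hv; have [cv cDv pv] := hv.
pose D i y := 2 * v y * Dv i y * adrift i y + v y ^+ 2 * dadrift i y.
have cF i : (i < n)%N -> cch m (fun y => v y ^+ 2 * adrift i y).
  move=> in_; apply: (cch_sub cv) => [y y0|y y0 ->]; last by rewrite expr0n mul0r.
  by apply: contnM; [apply: contnX; exact: cv.1|exact: contn_adrift].
have cD i : (i < n)%N -> cch m (D i).
  move=> in_; apply: (cch_sub cv) => [y y0|y y0]; last first.
    by rewrite /D => ->; rewrite expr0n /=; ring.
  apply: contnD; apply: contnM.
  - apply: contnM; last exact: (cDv i in_).1.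
    by apply: contnM; [exact: contn_cst|exact: cv.1].
  - exact: contn_adrift.
  - by apply: contnX; exact: cv.1.
  - exact: contn_dadrift.
have D0 i : (i < n)%N -> inth m (D i) = 0.
  move=> in_; apply: (inth_pd in_ (cF i in_) (cD i in_)) => y y0.
  have h := pv i y in_ y0.
  rewrite (_ : (fun z => _) = fun z => (v z * v z) * adrift i z).
    by apply: pd_eq (pdM (pdM h h) (pd_adrift i y0)) _; rewrite /D; ring.
  by apply/funext => z; rewrite expr2.
have cw : cch m (fun y => weight y * v y ^+ 2).
  by apply: (cchM (cch_sqr cv)) => y y0; exact: contn_weight.
have cd : cch m (fun y => \sum_(i < n) defect v Dv i y ^+ 2).
  apply: (@cch_sum _ _ _ _ _ (fun (i : 'I_n) y => defect v Dv i y ^+ 2)) => i _.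
  by apply/cch_sqr/cch_defect.
rewrite -inthD //.
have -> : inth m (fun y => weight y * v y ^+ 2 + \sum_(i < n) defect v Dv i y ^+ 2) =
  inth m (fun y => weight y * v y ^+ 2 + \sum_(i < n) defect v Dv i y ^+ 2) +
  inth m (fun y => \sum_(i < n) D i y).
  rewrite (@inth_sum _ _ _ _ _ (fun (i : 'I_n) => D i)); last by move=> i _; exact: cD.
  by rewrite [X in _ + X]big1 ?addr0 // => i _; exact: D0.
rewrite -inthD; [|exact: cchD|]; last first.
  by apply: (@cch_sum _ _ _ _ _ (fun (i : 'I_n) => D i)) => i _; exact: cD.
apply: eq_inth => y y0.
have := ground_state_equation n y0; rewrite -/(weight y) => /(congr1 -%R); rewrite opprK => <-.
rewrite !big_mkord mulNr mulrDl !mulr_suml opprD -!sumrN -!big_split /=.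
apply: eq_bigr => i _; rewrite /defect /D -/(dadrift i y) -/(adrift i y); ring.
Qed.

End GroundState.

(** * Powers of the absolute value *)

Section PowerCalculus.
Variable R : realType.

Definition npow (p t : R) : R := powR `|t| p.

Lemma npow_ge0 p t : 0 <= npow p t.
Proof. exact: powR_ge0. Qed.

Lemma npow0 p : 0 < p -> npow p 0 = 0.
Proof. by move=> p0; rewrite /npow normr0 powR0 // gt_eqF. Qed.

Lemma npowB1 p t : 0 < p -> `|t| * npow (p - 1) t = npow p t.
Proof. by move=> p0; rewrite /npow mulr_powRB1. Qed.

Lemma continuous_npow p : 0 < p -> continuous (npow p).
Proof. exact: continuous_powR_norm. Qed.

Lemma npow_sqr (p t : R) : npow p t ^+ 2 = npow (2 * p) t.
Proof. by rewrite /npow -powR_mulrn ?powR_ge0 // -powRrM mulrC. Qed.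

Definition dnpow (p t : R) : R := p * (t * npow (p - 2) t).

Lemma mul_dnpow p t : 2 < p -> t * (t * npow (p - 2) t) = npow p t.
Proof.
move=> p2; rewrite mulrA -expr2 -real_normK ?num_real // expr2 -mulrA.
have -> : p - 2 = p - 1 - 1 by ring.
by rewrite !npowB1 //; lra.
Qed.

Lemma norm_dnpow p t : 2 < p -> `|t * npow (p - 2) t| = npow (p - 1) t.
Proof.
move=> p2; rewrite normrM (ger0_norm (npow_ge0 _ _)).
have -> : p - 2 = p - 1 - 1 by ring.
by rewrite npowB1 //; lra.
Qed.

Lemma is_derive_npow p t : 2 < p -> is_derive t (1 : R) (npow p) (dnpow p t).
Proof.
move=> p2; have [t0|t0|->] := ltgtP t 0.
- apply: (@near_eq_is_derive _ _ _ (fun s => powR (- s) p)).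
    have : \forall s \near t, s < 0 by exact: lt_nbhsl.
    by apply: filterS => s s0; rewrite /npow ltr0_norm.
  have nt : 0 < - t by rewrite oppr_gt0.
  have h := is_derive1_comp (is_derive1_powR p nt) (is_deriveNid t 1).
  apply: is_derive_eq h _; rewrite /dnpow /npow ltr0_norm //.
  rewrite (_ : p - 2 = (p - 1) - 1); last by ring.
  rewrite -[in LHS](@mulr_powRB1 _ (- t) (p - 1)); [|exact: ltW|by lra].
  by rewrite /GRing.scale /=; ring.
- apply: (@near_eq_is_derive _ _ _ (fun s => powR s p)).
    have : \forall s \near t, 0 < s by exact: lt_nbhsr.
    by apply: filterS => s s0; rewrite /npow gtr0_norm.
  apply: is_derive_eq (is_derive1_powR p t0) _; rewrite /dnpow /npow gtr0_norm //.
  rewrite (_ : p - 2 = (p - 1) - 1); last by ring.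
  by rewrite mulr_powRB1 //; [exact: ltW|by lra].
(* At [0] the slope is [s * |s| ^ (p - 2)], continuous with value [0] there because [p > 2]. *)
- apply/is_derive1_caratheodory; exists (fun s => s * npow (p - 2) s).
  split => [s||].
  + rewrite subr0 npow0 ?subr0; last by lra.
    by rewrite /GRing.scale /= -mul_dnpow // mulrC.
  + apply: cvgM; first exact: cvg_id.
    by apply: continuous_npow; lra.
  + by rewrite /dnpow mul0r mulr0.
Qed.

Lemma continuous_dnpow p : 2 < p -> continuous (dnpow p).
Proof.
move=> p2 t; apply: cvgM; first exact: cvg_cst.
apply: cvgM; first exact: cvg_id.
by apply: continuous_npow; lra.
Qed.

End PowerCalculus.

(** * The reciprocals [kap k] of the partial norms *)

Section Kappa.
Variable R : realType.
Implicit Types (y : nat -> R).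

Definition kap k y : R := Num.sqrt (ri k y).

Lemma kap_gt0 k y : 0 < y 0%N -> 0 < kap k y.
Proof. by move=> y0; rewrite sqrtr_gt0 ri_gt0. Qed.

Lemma kap_sqr k y : 0 < y 0%N -> kap k y ^+ 2 = ri k y.
Proof. by move=> y0; rewrite sqr_sqrtr // ltW // ri_gt0. Qed.

Lemma rho_ri k y : 0 < y 0%N -> rho k y * ri k y = 1.
Proof. by move=> y0; rewrite /ri mulfV // gt_eqF // rho_gt0. Qed.

Lemma ri_le k l y : 0 < y 0%N -> (k <= l)%N -> ri l y <= ri k y.
Proof. by move=> y0 kl; rewrite lef_pV2 ?posrE ?rho_gt0 // rho_le. Qed.

Lemma kap_le k l y : 0 < y 0%N -> (k <= l)%N -> kap l y <= kap k y.
Proof. by move=> y0 kl; rewrite ler_wsqrtr // ri_le. Qed.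

Lemma norm_coord_kap i k y : 0 < y 0%N -> (i <= k)%N -> `|y i| * kap k y <= 1.
Proof.
move=> y0 ik; rewrite -[kap k y]gtr0_norm ?kap_gt0 // -normrM.
rewrite -(@ler_pXn2r _ 2) ?nnegrE ?normr_ge0 // real_normK ?num_real // expr1n.
rewrite exprMn kap_sqr // -(rho_ri k y0).
by apply: ler_wpM2r; [exact/ltW/ri_gt0|exact: sqr_le_rho].
Qed.

Lemma norm_coord_ri i k y : 0 < y 0%N -> (i <= k)%N -> `|y i| * ri k y <= kap k y.
Proof.
move=> y0 ik; rewrite -kap_sqr // expr2 mulrA.
by rewrite ler_piMl ?norm_coord_kap // ltW // kap_gt0.
Qed.

(** That is, [sqrt (rho k) / rho l <= 1 / sqrt (rho l)]. It bounds the share of the powers of index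
    [l > k] in the divergence of [hardy_step]. *)
Lemma kap_rho_ri k l y : 0 < y 0%N -> (k <= l)%N ->
  kap k y * (rho k y * ri l y) <= kap l y.
Proof.
move=> y0 kl; have k0 := kap_gt0 k y0; have l0 := kap_gt0 l y0.
have h := kap_le y0 kl.
have rk := rho_ri k y0; rewrite -(kap_sqr k y0) in rk.
have e : kap k y * (rho k y * ri l y) * kap k y = ri l y.
  by rewrite -[RHS]mul1r -rk; ring.
by rewrite -(ler_pM2r k0) e -kap_sqr // expr2 ler_pM2l.
Qed.

Lemma pd_kap i k y : 0 < y 0%N ->
  pd i (kap k) y (- ((i <= k)%:R * (y i * ri k y * kap k y))).
Proof.
move=> y0; have k0 := kap_gt0 k y0.
have := pd_comp (pd_ri i k y0) (is_derive1_sqrt (ri_gt0 k y0)).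
move/pd_eq; apply; rewrite -/(kap k y) -(kap_sqr k y0).
by field; rewrite gt_eqF.
Qed.

Lemma contn_kap n k y : (k < n)%N -> 0 < y 0%N -> contn n (kap k) y.
Proof.
move=> kn y0; apply: (@contn_comp _ _ Num.sqrt); first exact: contn_ri.
exact: sqrt_continuous.
Qed.

End Kappa.

(** * The Sobolev bound for the defect when the last [alpha] is negative *)

Section Sobolev.
Variables (R : realType) (m : nat) (alpha : nat -> R).
Hypothesis m2 : (2 <= m)%N.
Hypothesis alpha_le0 : forall i, (i < m.+1)%N -> alpha i <= 0.
Hypothesis alpha_lt0 : alpha m < 0.
Local Notation n := m.+1.
Local Notation inth := (inth m).
Local Notation cch := (cch m).
Local Notation spow := (spow alpha).
Local Notation apow := (apow alpha).
Implicit Types (v : (nat -> R) -> R) (Dv : nat -> (nat -> R) -> R) (y : nat -> R).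

(* Sobolev's inequality is applied to [|v| ^ b]. *)
Definition bexp : R := 2 * m%:R / (m%:R - 1).

Let M2 : 2 <= m%:R :> R.
Proof. by rewrite (ler_nat R 2). Qed.

Lemma bexp_gt2 : 2 < bexp.
Proof. by have h := M2; rewrite /bexp ltr_pdivlMr; lra. Qed.

Definition hardy_int v k := inth (fun y => npow bexp (v y) * kap k y).
Definition cross_int v Dv := inth (fun y =>
  npow (bexp - 1) (v y) * \sum_(i < n) `|defect m alpha v Dv i y|).

Lemma cch_npow v p : 0 < p -> cch v -> cch (fun y => npow p (v y)).
Proof.
move=> p0 hv; apply: (cch_sub hv) => [y y0|y y0 ->]; last by rewrite npow0.
apply: (@contn_comp _ _ (npow p)); first exact: hv.1.
exact: continuous_npow.
Qed.

Lemma cch_hardy v k : (k < n)%N -> cch v -> cch (fun y => npow bexp (v y) * kap k y).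
Proof.
move=> kn hv; have b0 : 0 < bexp by have := bexp_gt2; lra.
rewrite (_ : (fun y => _) = fun y => kap k y * npow bexp (v y)); last first.
  by apply/funext => y; rewrite mulrC.
by apply: (cchM (cch_npow b0 hv)) => y y0; exact: contn_kap.
Qed.

Lemma cch_cross1 v Dv i : (i < n)%N -> c1h m v Dv ->
  cch (fun y => npow (bexp - 1) (v y) * `|defect m alpha v Dv i y|).
Proof.
move=> in_ hv; have b1 : 0 < bexp - 1 by have := bexp_gt2; lra.
have hd := cch_defect alpha hv in_.
apply: (cch_sub hd) => [y y0|y y0 ->]; last by rewrite normr0 mulr0.
apply: contnM; first exact: (cch_npow b1 (c1h_cch hv)).1.
by apply: contn_norm; exact: hd.1.
Qed.

Lemma cch_cross v Dv : c1h m v Dv -> cch (fun y =>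
  npow (bexp - 1) (v y) * \sum_(i < n) `|defect m alpha v Dv i y|).
Proof.
move=> hv; under eq_fun do rewrite mulr_sumr.
apply: (@cch_sum _ _ _ _ _ (fun (i : 'I_n) y =>
   npow (bexp - 1) (v y) * `|defect m alpha v Dv i y|)) => i _.
exact: cch_cross1.
Qed.

Lemma cross_int_ge0 v Dv : 0 <= cross_int v Dv.
Proof.
apply: inth_ge0 => y y0; apply: mulr_ge0; first exact: npow_ge0.
exact: sumr_ge0.
Qed.

(** At [k = m] the coefficient reduces to [- bexp * alpha m]; here [alpha m < 0] enters. *)
Lemma hardy_coef_gt0 k : (k < n)%N -> 0 < bexp * spow k.+1 + k%:R.
Proof.
move=> kn; have b2 := bexp_gt2.
have mp : 0 < m%:R - 1 :> R by have := M2; lra.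
have -> : bexp * spow k.+1 + k%:R = - bexp * alpha k + (m%:R - k%:R) / (m%:R - 1).
  by rewrite /bexp /=; field; rewrite gt_eqF.
have := alpha_le0 kn; move: kn; rewrite ltnS leq_eqVlt => /predU1P[->|km] ak.
  have := alpha_lt0; rewrite subrr mul0r; nra.
have h : 0 < (m%:R - k%:R) / (m%:R - 1) :> R.
  by rewrite divr_gt0 // subr_gt0 ltr_nat.
have : 0 <= - bexp * alpha k by nra.
by lra.
Qed.

(** The powers of index up to [k] contribute their degree. In a power of index [l > k] all
    coordinates up to [k] occur, and their squares sum to [rho k]. *)
Lemma sum_sqr_tpow k y : (k < n)%N -> 0 < y 0%N ->
  \sum_(0 <= i < k.+1) y i ^+ 2 * tpow alpha n i y =
  spow k.+1 + \sum_(k.+1 <= l < n) apow l * (rho k y * ri l y).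
Proof.
move=> kn y0; rewrite -(sum_tpow alpha k.+1 y0) /rho.
rewrite [X in _ = _ + X](eq_bigr (fun l =>
    \sum_(0 <= i < k.+1) y i ^+ 2 * (apow l * ri l y))); last first.
  by move=> l _; rewrite mulr_suml mulr_sumr; apply: eq_bigr => i _; ring.
rewrite exchange_big /= -big_split /=; apply: eq_big_nat => i /andP[_ ik].
rewrite /tpow (big_cat_nat _ (n := k.+1)) //= mulrDr mulr_sumr; congr (_ + _).
rewrite mulr_sumr; apply: eq_big_nat => l /andP[kl _].
by rewrite (leq_trans _ (ltnW kl)) // mul1r.
Qed.

Lemma cch_hardy_sum v k : cch v ->
  cch (fun y => \sum_(l < n | (k < l)%N) `|apow l| * (npow bexp (v y) * kap l y)).
Proof.
move=> hv; apply: (@cch_sum _ _ _ _ _ (fun (l : 'I_n) y =>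
  `|apow l| * (npow bexp (v y) * kap l y))) => l _.
by apply: cchZ; exact: cch_hardy.
Qed.

(* Integrating the divergence of [|v| ^ b] times the unit radial field of the
   first [k.+1] coordinates. *)
Lemma hardy_step v Dv k : c1h m v Dv -> (k < n)%N ->
  (bexp * spow k.+1 + k%:R) * hardy_int v k <=
  bexp * \sum_(l < n | (k < l)%N) `|apow l| * hardy_int v l + bexp * cross_int v Dv.
Proof.
move=> hv kn; have [cv cDv pv] := hv.
have b2 := bexp_gt2; have b0 : 0 < bexp by lra.
pose D i y := dnpow bexp (v y) * Dv i y * (y i * kap k y) +
  npow bexp (v y) * (kap k y - y i ^+ 2 * ri k y * kap k y).
have lt_n i : (i < k.+1)%N -> (i < n)%N by move=> ik; exact: leq_trans ik kn.
have cF i : (i < k.+1)%N -> cch (fun y => npow bexp (v y) * (y i * kap k y)).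
  move=> /lt_n in_; apply: (cch_sub cv) => [y y0|y y0 ->]; last by rewrite npow0 ?mul0r.
  apply: contnM; first exact: (cch_npow b0 cv).1.
  by apply: contnM; [exact: contn_coord|exact: contn_kap].
have cD i : (i < k.+1)%N -> cch (D i).
  move=> /lt_n in_; apply: (cch_sub cv) => [y y0|y y0 vy]; last first.
    by rewrite /D vy /dnpow mul0r mulr0 !mul0r npow0 // mul0r addr0.
  have ck := contn_kap kn y0.
  apply: contnD; apply: contnM.
  - apply: contnM; last exact: (cDv i in_).1.
    by apply: (@contn_comp _ _ (dnpow bexp)); [exact: cv.1|exact: continuous_dnpow].
  - by apply: contnM ck; exact: contn_coord.
  - exact: (cch_npow b0 cv).1.
  - apply: contnB => //; apply: contnM ck; apply: contnM; last exact: contn_ri.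
    by apply: contnX; exact: contn_coord.
have D0 i : (i < k.+1)%N -> inth (D i) = 0.
  move=> ik; have in_ := lt_n i ik.
  apply: (inth_pd in_ (cF i ik) (cD i ik)) => y y0.
  have h1 := pd_comp (pv i y in_ y0) (is_derive_npow (v y) b2).
  have h2 := pdM (pd_coord i i y) (pd_kap i k y0).
  by apply: pd_eq (pdM h1 h2) _; rewrite eqxx -ltnS ik /D /=; ring.
have cDs : cch (fun y => \sum_(i < k.+1) D i y).
  by apply: (@cch_sum _ _ _ _ _ (fun (i : 'I_k.+1) => D i)) => i _; exact: cD.
have Ds0 : inth (fun y => \sum_(i < k.+1) D i y) = 0.
  rewrite (@inth_sum _ _ _ _ _ (fun (i : 'I_k.+1) => D i)); last by move=> i _; exact: cD.
  by rewrite big1 // => i _; exact: D0.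
have hs : \sum_(l < n | (k < l)%N) `|apow l| * hardy_int v l =
    inth (fun y => \sum_(l < n | (k < l)%N) `|apow l| * (npow bexp (v y) * kap l y)).
  rewrite (@inth_sum _ _ _ _ _ (fun (l : 'I_n) y =>
    `|apow l| * (npow bexp (v y) * kap l y))).
    by apply: eq_bigr => l _; rewrite inthZ //; exact: cch_hardy.
  by move=> l _; apply: cchZ; exact: cch_hardy.
have c1 := cch_hardy_sum k cv; have c2 := cch_cross hv.
rewrite hs /cross_int /hardy_int -!inthZ //; last exact: cch_hardy.
have c3 := cchZ bexp c1; have c4 := cchZ bexp c2.
have c34 := cchD c3 c4.
rewrite -inthD // -[leRHS]add0r -[X in _ <= X + _]Ds0 -inthD //.
apply: le_inth.
- by apply: cchZ; exact: cch_hardy.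
- by apply: cchD => //; exact: cchD.
move=> y y0; set P := npow bexp (v y); set ka := kap k y.
have ka0 : 0 < ka := kap_gt0 k y0.
have P0 : 0 <= P := npow_ge0 _ _.
pose w := v y * npow (bexp - 2) (v y).
have wv : w * v y = P by rewrite /w mulrC mul_dnpow.
have nw : `|w| = npow (bexp - 1) (v y) := norm_dnpow _ b2.
set S := spow k.+1.
(* With [Dv i] rewritten as the defect plus [v] times the drift, the divergence splits into the
   leading term, the powers of index above [k] and the cross term. The factor [k] is [k.+1]
   coordinates minus one from differentiating [kap k]. *)
have DE : \sum_(i < k.+1) D i y =
   (bexp * S + k%:R) * (P * ka) +
   bexp * (P * \sum_(k.+1 <= l < n) apow l * (ka * (rho k y * ri l y))) +
   bexp * (w * \sum_(i < k.+1) y i * ka * defect m alpha v Dv i y).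
  have -> : \sum_(i < k.+1) D i y = \sum_(i < k.+1)
      (bexp * P * ka * (y i ^+ 2 * tpow alpha n i y) +
       (bexp * w * (y i * ka * defect m alpha v Dv i y) +
       (P * ka + - (P * ka * ri k y) * y i ^+ 2))).
    apply: eq_bigr => i _; rewrite /D -/P -/ka /dnpow -/w /defect /adrift -wv; ring.
  rewrite !big_split /= -!mulr_sumr sumr_const card_ord -[_ *+ k.+1]mulr_natr.
  have := sum_sqr_tpow kn y0; rewrite big_mkord -/S => ->.
  have -> : \sum_(i < k.+1) y i ^+ 2 = rho k y by rewrite /rho big_mkord.
  have -> : \sum_(k.+1 <= l < n) apow l * (ka * (rho k y * ri l y)) =
     ka * \sum_(k.+1 <= l < n) apow l * (rho k y * ri l y).
    by rewrite mulr_sumr; apply: eq_bigr => l _; ring.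
  have -> : - (P * ka * ri k y) * rho k y = - (P * ka).
    by rewrite -[P * ka in RHS]mulr1 -(rho_ri k y0); ring.
  by rewrite -natr1; ring.
rewrite DE -!addrA lerDl.
have h1 : 0 <= P * \sum_(k.+1 <= l < n) apow l * (ka * (rho k y * ri l y)) +
    \sum_(l < n | (k < l)%N) `|apow l| * (P * kap l y).
  have -> : \sum_(k.+1 <= l < n) apow l * (ka * (rho k y * ri l y)) =
     \sum_(l < n | (k < l)%N) apow l * (ka * (rho k y * ri l y)).
    by rewrite (big_nat_widenl _ 0) // big_mkord.
  rewrite mulr_sumr -big_split /=; apply: sumr_ge0 => l kl.
  have h := kap_rho_ri y0 (ltnW kl).
  have g0 : 0 <= ka * (rho k y * ri l y).
    by rewrite mulr_ge0 ?(ltW ka0) // mulr_ge0 // ltW ?rho_gt0 ?ri_gt0.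
  move: h g0; set X := ka * _; set Y := kap l y => h g0.
  rewrite [`|_| * _]mulrCA -mulrDr mulr_ge0 //.
  have -> : apow l * X + `|apow l| * Y =
      `|apow l| * (Y - X) + (`|apow l| + apow l) * X by ring.
  have := ler_norm (- apow l); rewrite normrN => a0.
  by rewrite addr_ge0 // mulr_ge0 // ?subr_ge0 //; lra.
have h2 : 0 <= w * \sum_(i < k.+1) y i * ka * defect m alpha v Dv i y +
    npow (bexp - 1) (v y) * \sum_(i < n) `|defect m alpha v Dv i y|.
  rewrite -nw addrC -lerBlDr sub0r; apply: le_trans (ler_norm _) _.
  rewrite normrN normrM ler_wpM2l //.
  apply: (le_trans (ler_norm_sum _ _ _)).
  rewrite -(big_mkord predT (fun i => `|y i * ka * defect m alpha v Dv i y|)).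
  rewrite -(big_mkord predT (fun i => `|defect m alpha v Dv i y|)).
  rewrite [leRHS](big_cat_nat _ (n := k.+1)) //= -[leLHS]addr0 lerD ?sumr_ge0 //.
  rewrite big_nat [leRHS]big_nat; apply: ler_sum => i /andP[_ ik].
  rewrite normrM ler_piMl // normrM (gtr0_norm ka0).
  exact: norm_coord_kap.
have -> : bexp * (P * \sum_(k.+1 <= l < n) apow l * (ka * (rho k y * ri l y))) +
   (bexp * (w * \sum_(i < k.+1) y i * ka * defect m alpha v Dv i y) +
   (bexp * \sum_(l < n | (k < l)%N) `|apow l| * (P * kap l y) +
    bexp * (npow (bexp - 1) (v y) * \sum_(i < n) `|defect m alpha v Dv i y|))) =
  bexp * ((P * \sum_(k.+1 <= l < n) apow l * (ka * (rho k y * ri l y)) +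
    \sum_(l < n | (k < l)%N) `|apow l| * (P * kap l y)) +
   (w * \sum_(i < k.+1) y i * ka * defect m alpha v Dv i y +
    npow (bexp - 1) (v y) * \sum_(i < n) `|defect m alpha v Dv i y|)) by ring.
by rewrite mulr_ge0 ?(ltW b0) // addr_ge0.
Qed.

(** [hardy_step] bounds index [k] by larger ones and the cross integral, and index [m] by the cross
    integral alone. So the induction descends; [j] counts the indices already treated. *)
Lemma hardy_le_cross : exists2 C : R, 0 <= C & forall v Dv k, c1h m v Dv ->
  (k < n)%N -> hardy_int v k <= C * cross_int v Dv.
Proof.
have b0 : 0 < bexp by have := bexp_gt2; lra.
suff main j : (j <= n)%N -> exists2 C : R, 0 <= C & forall v Dv k, c1h m v Dv ->
    (n - j <= k < n)%N -> hardy_int v k <= C * cross_int v Dv.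
  have [C C0 hC] := main n (leqnn n); exists C => // v Dv k hv kn.
  by apply: hC => //; rewrite subnn.
elim: j => [|j IH] jn.
  exists 0 => // v Dv k _; rewrite subn0 => /andP[nk kn].
  by have := leq_trans kn nk; rewrite ltnn.
have [C C0 hC] := IH (ltnW jn).
pose k0 := (n - j.+1)%N.
have k0n : (k0 < n)%N by rewrite /k0 ltn_subrL.
pose c := bexp * spow k0.+1 + k0%:R.
have c0 : 0 < c := hardy_coef_gt0 k0n.
pose A : R := \sum_(l < n | (k0 < l)%N) `|apow l|.
have A0 : 0 <= A by apply: sumr_ge0.
exists (Num.max C ((bexp * A * C + bexp) / c)); first by rewrite le_max C0.
move=> v Dv k hv; rewrite leq_eqVlt => /andP[/predU1P[kE|k0k] kn]; last first.
  apply: (@le_trans _ _ (C * cross_int v Dv)).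
    by apply: hC => //; rewrite kn andbT -subSS subSn.
  by rewrite ler_wpM2r ?cross_int_ge0 // le_max lexx.
apply: (@le_trans _ _ ((bexp * A * C + bexp) / c * cross_int v Dv)); last first.
  by rewrite ler_wpM2r ?cross_int_ge0 // le_max lexx orbT.
rewrite -kE -/k0 mulrAC ler_pdivlMr // mulrC.
apply: (le_trans (hardy_step hv k0n)).
have -> : (bexp * A * C + bexp) * cross_int v Dv =
   bexp * (A * (C * cross_int v Dv)) + bexp * cross_int v Dv by ring.
rewrite lerD2r ler_wpM2l ?(ltW b0) // mulr_suml; apply: ler_sum => l k0l.
rewrite ler_wpM2l //; apply: hC => //; rewrite ltn_ord andbT.
by move: k0l; rewrite /k0 -subSn // subSS.
Qed.

Lemma norm_adrift_le i y : 0 < y 0%N ->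
  `|adrift m alpha i y| <= \sum_(k < n) `|apow k| * kap k y.
Proof.
move=> y0; rewrite /adrift /tpow big_mkord mulr_sumr.
apply: (le_trans (ler_norm_sum _ _ _)); apply: ler_sum => k _.
case ik : (i <= k)%N; last first.
  by rewrite mul0r mulr0 normr0 mulr_ge0 // ltW // kap_gt0.
rewrite mul1r mulrCA normrM ler_wpM2l // normrM (gtr0_norm (ri_gt0 _ y0)).
exact: norm_coord_ri.
Qed.

(** [Dv i] is the defect plus [v] times the drift. The first part gives the cross integral; the
    drift is at most a combination of the [kap k], so the second gives the integrals of
    [hardy_le_cross]. *)
Lemma gradient_le_cross : exists2 C : R, 0 < C & forall v Dv i, c1h m v Dv ->
  (i < n)%N -> inth (fun y => `|dnpow bexp (v y) * Dv i y|) <= C * cross_int v Dv.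
Proof.
have b2 := bexp_gt2; have b0 : 0 < bexp by lra.
have [C C0 hC] := hardy_le_cross.
pose A : R := \sum_(k < n) `|apow k|.
have A0 : 0 <= A by apply: sumr_ge0.
exists (bexp + bexp * (A * C)); first by rewrite ltr_wpDr // mulr_ge0 ?(ltW b0) // mulr_ge0.
move=> v Dv i hv in_; have [cv cDv pv] := hv.
have cH : cch (fun y => \sum_(k < n) `|apow k| * (npow bexp (v y) * kap k y)).
  apply: (@cch_sum _ _ _ _ _ (fun (k : 'I_n) y =>
    `|apow k| * (npow bexp (v y) * kap k y))) => k _.
  by apply: cchZ; exact: cch_hardy.
have cC := cch_cross hv.
apply: (@le_trans _ _ (inth (fun y => bexp * (npow (bexp - 1) (v y) *
   \sum_(i < n) `|defect m alpha v Dv i y|) +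
   bexp * \sum_(k < n) `|apow k| * (npow bexp (v y) * kap k y)))).
  apply: le_inth.
  - apply: (cch_sub cv) => [y y0|y y0 ->]; last first.
      by rewrite /dnpow mul0r mulr0 mul0r normr0.
    apply/contn_norm/contnM; last exact: (cDv i in_).1.
    by apply: (@contn_comp _ _ (dnpow bexp)); [exact: cv.1|exact: continuous_dnpow].
  - by apply: cchD; exact: cchZ.
  move=> y y0; rewrite -mulrDr /dnpow -mulrA normrM (gtr0_norm b0) ler_wpM2l ?(ltW b0) //.
  have -> : Dv i y = defect m alpha v Dv i y + v y * adrift m alpha i y.
    by rewrite /defect subrK.
  rewrite mulrDr; apply: (le_trans (ler_normD _ _)); apply: lerD.
    rewrite normrM norm_dnpow // ler_wpM2l ?npow_ge0 //.
    by rewrite (bigD1 (Ordinal in_)) //= lerDl sumr_ge0.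
  rewrite mulrA [_ * v y]mulrC mul_dnpow // normrM (ger0_norm (npow_ge0 _ _)).
  apply: (le_trans (ler_wpM2l (npow_ge0 _ _) (norm_adrift_le i y0))).
  rewrite mulr_sumr le_eqVlt; apply/orP; left; apply/eqP/eq_bigr => k _; ring.
rewrite inthD; [|exact: cchZ|exact: cchZ].
rewrite !inthZ // mulrDl lerD2l -mulrA ler_wpM2l ?(ltW b0) //.
rewrite (@inth_sum _ _ _ _ _ (fun (k : 'I_n) y =>
    `|apow k| * (npow bexp (v y) * kap k y))); last first.
  by move=> k _; apply: cchZ; exact: cch_hardy.
rewrite -mulrA mulr_suml; apply: ler_sum => k _.
rewrite inthZ; last exact: cch_hardy.
by rewrite ler_wpM2l // hC.
Qed.

(** This equation and the next determine [bexp]: the Sobolev power of [|v| ^ b] and the square of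
    [|v| ^ (b - 1)] in Young's inequality must both be [|v|] to the critical exponent. *)
Lemma crit_bexp : crit_exp R n = bexp * (n%:R / m%:R).
Proof.
have h := M2; rewrite /crit_exp /bexp -natr1; field.
by rewrite !gt_eqF //; lra.
Qed.

Lemma crit_bexp1 : crit_exp R n = 2 * (bexp - 1).
Proof.
have h := M2; rewrite /crit_exp /bexp -natr1; field.
by rewrite !gt_eqF //; lra.
Qed.

Lemma crit_gt0 : 0 < crit_exp R n.
Proof. by rewrite crit_bexp1; have := bexp_gt2; lra. Qed.

Definition crit_int v := inth (fun y => npow (crit_exp R n) (v y)).

Lemma crit_int_ge0 v : 0 <= crit_int v.
Proof. by apply: inth_ge0 => y _; exact: npow_ge0. Qed.

Lemma sobolev_cross : exists2 C : R, 0 < C & forall v Dv, c1h m v Dv ->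
  powR (crit_int v) (m%:R / n%:R) <= C * cross_int v Dv.
Proof.
have b2 := bexp_gt2; have b0 : 0 < bexp by lra.
have [C C0 hC] := gradient_le_cross; exists C => // v Dv hv.
have [cv cDv pv] := hv.
have m0 : (0 < m)%N by exact: ltnW.
have mR : 0 < m%:R :> R by rewrite ltr0n.
have CJ0 : 0 <= C * cross_int v Dv by rewrite mulr_ge0 ?cross_int_ge0 // ltW.
have h : crit_int v <= powR (C * cross_int v Dv) (n%:R / m%:R).
  apply: (le_trans (inth_sobolev (F := fun y => npow bexp (v y))
    (F' := fun i y => dnpow bexp (v y) * Dv i y) m0 _ _ _ _ _)).
  - exact: cch_npow.
  - by apply: cch_npow => //; exact: crit_gt0.
  - move=> i in_; apply: (cch_sub cv) => [y y0|y y0 ->]; last first.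
      by rewrite /dnpow mul0r mulr0 mul0r.
    apply/contnM; last exact: (cDv i in_).1.
    by apply: (@contn_comp _ _ (dnpow bexp)); [exact: cv.1|exact: continuous_dnpow].
  - by move=> i y in_ y0; apply: pd_comp; [exact: pv|exact: is_derive_npow].
  - move=> y y0; rewrite (ger0_norm (npow_ge0 _ _)) /npow -powRrM -crit_bexp //.
  - have -> : powR (C * cross_int v Dv) (n%:R / m%:R) =
        \prod_(i < n) powR (C * cross_int v Dv) m%:R^-1.
      by rewrite prodr_const card_ord -powR_mulrn ?powR_ge0 // -powRrM (mulrC m%:R^-1).
    apply: ler_prod => i _; rewrite powR_ge0 /=; apply: ge0_ler_powR.
    + by rewrite invr_ge0.
    + by rewrite nnegrE; apply: inth_ge0.
    + by rewrite nnegrE.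
    + exact: hC.
have r0 : 0 <= m%:R / n%:R :> R by rewrite divr_ge0.
have nn (x : R) : 0 <= x -> x \in Num.nneg by rewrite nnegrE.
have := ge0_ler_powR r0 (nn _ (crit_int_ge0 v)) (nn _ (powR_ge0 _ _)) h.
by rewrite -powRrM mulrA divfK ?mulfV ?powRr1 ?gt_eqF.
Qed.

Definition defect_int v Dv := inth (fun y => \sum_(i < n) defect m alpha v Dv i y ^+ 2).

Lemma cross_young v Dv (l : R) : c1h m v Dv -> 0 < l ->
  cross_int v Dv <= n%:R * l / 2 * crit_int v + (2 * l)^-1 * defect_int v Dv.
Proof.
move=> hv l0; have [cv cDv pv] := hv.
have cd : cch (fun y => \sum_(i < n) defect m alpha v Dv i y ^+ 2).
  apply: (@cch_sum _ _ _ _ _ (fun (i : 'I_n) y => defect m alpha v Dv i y ^+ 2)) => i _.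
  by apply/cch_sqr/cch_defect.
have cc := cch_npow crit_gt0 cv.
rewrite /crit_int /defect_int -!inthZ // -inthD; [|exact: cchZ|exact: cchZ].
apply: le_inth.
- exact: cch_cross.
- by apply: cchD; exact: cchZ.
move=> y y0; rewrite crit_bexp1 -npow_sqr; set a := npow _ _.
have -> : n%:R * l / 2 * a ^+ 2 = \sum_(i < n) l / 2 * a ^+ 2.
  by rewrite sumr_const card_ord -[RHS]mulr_natr; ring.
rewrite !mulr_sumr -big_split /=; apply: ler_sum => i _.
set d := defect _ _ _ _ _ _.
rewrite -(real_normK (num_real d)) -subr_ge0.
have -> : l / 2 * a ^+ 2 + (2 * l)^-1 * `|d| ^+ 2 - a * `|d| =
   (2 * l)^-1 * (l * a - `|d|) ^+ 2 by field; rewrite gt_eqF.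
by rewrite mulr_ge0 ?sqr_ge0 // invr_ge0 mulr_ge0 // ltW.
Qed.

Theorem sobolev_defect : exists2 C : R, 0 < C & forall v Dv, c1h m v Dv ->
  C * powR (crit_int v) (2 / crit_exp R n) <= defect_int v Dv.
Proof.
have [K K0 hK] := sobolev_cross.
have h2 := M2.
have nR : 0 < n%:R :> R by rewrite ltr0n.
exists (n%:R * K ^+ 2)^-1; first by rewrite invr_gt0 mulr_gt0 // exprn_gt0.
move=> v Dv hv; have Q0 : 0 <= defect_int v Dv.
  by apply: inth_ge0 => y _; apply: sumr_ge0 => i _; exact: sqr_ge0.
have e2 : 2 / crit_exp R n = (m%:R - 1) / n%:R.
  rewrite /crit_exp -natr1; field.
  by rewrite !gt_eqF //; lra.
have [P0|P0] := eqVneq (crit_int v) 0.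
  rewrite P0 powR0 ?mulr0 // e2 gt_eqF // divr_gt0 //; lra.
have {}P0 : 0 < crit_int v by rewrite lt_neqAle eq_sym P0 crit_int_ge0.
set P := crit_int v in P0 *; set Q := defect_int v Dv in Q0 *.
pose q := powR P n%:R^-1.
have q0 : 0 < q by rewrite powR_gt0.
(* With this parameter in Young's inequality the critical integral contributes exactly half of
   [P ^ (m / n) = p * q], which is then absorbed on the left. *)
have l0 : 0 < (n%:R * K * q)^-1 by rewrite invr_gt0 !mulr_gt0.
have h := hK v Dv hv; have hy := cross_young hv l0.
rewrite -/P -/Q in h hy.
pose p := powR P ((m%:R - 1) / n%:R).
have pq : powR P (m%:R / n%:R) = p * q.
  rewrite /p /q -powRD; first by congr powR; field; rewrite gt_eqF.
  by apply/implyP => _; rewrite gt_eqF.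
have pqq : P = p * q * q.
  rewrite -pq /q -powRD; last by apply/implyP => _; rewrite gt_eqF.
  rewrite -[LHS]powRr1 ?(ltW P0) //; congr powR.
  by rewrite -natr1; field; rewrite natr1 gt_eqF.
rewrite e2 -/p mulrC ler_pdivrMr ?mulr_gt0 ?exprn_gt0 //.
have : p * q <= K * (n%:R * (n%:R * K * q)^-1 / 2 * P + (2 * (n%:R * K * q)^-1)^-1 * Q).
  by rewrite -pq (le_trans h) // ler_wpM2l // ltW.
rewrite {1}pqq.
have -> : K * (n%:R * (n%:R * K * q)^-1 / 2 * (p * q * q) + (2 * (n%:R * K * q)^-1)^-1 * Q)
   = (p * q) / 2 + (Q * (n%:R * K ^+ 2)) * q / 2.
  by field; rewrite !gt_eqF // ?mulr_gt0.
move=> hh; rewrite -(ler_pM2r q0); lra.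
Qed.

End Sobolev.

(** * From row vectors to functions of sequences *)

Section Bridge.
Variables (R : realType) (m : nat).
Local Notation n := m.+1.
Implicit Types (u : 'rV[R]_n -> R) (y : nat -> R).

Lemma vec_upd y (i : 'I_n) (t : R) :
  vec n (upd y i t) = (t - y i) *: basis_vec R i + vec n y.
Proof.
apply/rowP => j; rewrite !mxE /upd eqxx /=.
have [->|ji] := eqVneq j i; first by rewrite eqxx mulr1 subrK.
by rewrite (inj_eq val_inj j i) (negbTE ji) mulr0 add0r.
Qed.

Lemma is_derive_vec u (i : 'I_n) y (d : R) :
  is_derive (vec n y) (basis_vec R i) u d <-> pd i (fun z => u (vec n z)) y d.
Proof.
have E : (fun h : R => h^-1 *: (((fun t => u (vec n (upd y i t))) \o shift (y i)) (h *: 1)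
      - u (vec n (upd y i (y i)))))
  = (fun h => h^-1 *: ((u \o shift (vec n y)) (h *: basis_vec R i) - u (vec n y))).
  apply/funext => h /=; congr (_ *: (_ - _)); last by rewrite upd_id.
  by rewrite vec_upd addrK [h *: 1]mulr1.
split=> -[D V]; split.
- by rewrite /derivable E.
- by rewrite /derive E.
- by rewrite /derivable -E.
- by rewrite /derive -E.
Qed.

Lemma integral_halfspaceE (F : 'rV[R]_n -> R) :
  integral_halfspace F = inth m (fun y => F (vec n y)).
Proof.
rewrite /integral_halfspace /integral_Rn /inth; congr iint; apply/funext => y.
by rewrite /ext0 mxE.
Qed.

Lemma eq_rho (k : nat) y : (k < n)%N ->
  \sum_(j < n | (j <= k)%N) vec n y 0 j ^+ 2 = rho k y.
Proof.
move=> kn; under eq_bigr do rewrite mxE.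
rewrite /rho (big_nat_widen _ _ n) // big_mkord.
by apply: eq_bigl => j; rewrite ltnS.
Qed.

Lemma hardy_weightE (alpha : nat -> R) y :
  hardy_weight alpha (vec n y) = weight m alpha y.
Proof.
rewrite /hardy_weight /weight big_mkord; apply: eq_bigr => k _.
by rewrite eq_rho.
Qed.

Lemma not_support u x : ~ Defs.support u x -> \forall x' \near x, u x' = 0.
Proof.
move=> nx; have : open (~` Defs.support u) by apply: closed_openC; exact: closed_closure.
rewrite openE => /(_ x nx); apply: filterS => x' nx'.
by apply/eqP; apply: contrapT => /negP ux; apply: nx'; exact: subset_closure.
Qed.

(** Each point of the support has a neighbourhood inside [P d] for all small [d > 0], and
    compactness makes [d] uniform. The single parameter gives both the distance to the boundary and
    the size [1 / d] of the box. *)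
Lemma support_box u : compact (Defs.support u) -> Defs.support u `<=` @halfspace R m ->
  exists d M : R, [/\ 0 < d, 0 < M & forall y, Defs.support u (vec n y) -> in_box m d M y].
Proof.
move=> /compact_near_coveringP cov sub.
pose P (d : R) (x : 'rV[R]_n) := d <= x 0 ord0 /\ forall i, `|x 0 i| <= d^-1.
have H : \forall d \near (0 : R)^'+, Defs.support u `<=` P d.
  apply: cov => x /sub x0; rewrite /halfspace /= in x0.
  have x02 : 0 < x 0 ord0 / 2 by rewrite divr_gt0.
  pose B := 1 + x 0 ord0 / 2 + \sum_i `|x 0 i|.
  have B0 : 0 < B by rewrite ltr_pwDl ?sumr_ge0 // addr_gt0.
  exists ([set x' | ball x (x 0 ord0 / 2) x'],
    [set d : R | 0 < d /\ d < Num.min (x 0 ord0 / 2) B^-1]) => /=.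
    split; first exact: nbhsx_ballx.
    near=> d; split; first by near: d; exact: nbhs_right_gt.
    by near: d; apply: nbhs_right_lt; rewrite lt_min x02 invr_gt0.
  move=> [x' d] /= [[_ xx'] [d0]]; rewrite lt_min => /andP[d1 d2]; split.
    by have := xx' 0 ord0; rewrite /ball /= ltr_norml => /andP[]; lra.
  move=> i; have := xx' 0 i; rewrite /ball /= => xi.
  apply: (@le_trans _ _ B); last first.
    by rewrite -[B]invrK lef_pV2 ?posrE ?invr_gt0 // ltW.
  have : `|x' 0 i| <= `|x 0 i - x' 0 i| + `|x 0 i|.
    by rewrite distrC -{1}(subrK (x 0 i) (x' 0 i)) ler_normD.
  have : `|x 0 i| <= \sum_j `|x 0 j| by rewrite (bigD1 i) //= lerDl sumr_ge0.
  by rewrite /B; lra.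
have [d [d0 Hd]] : exists d : R, 0 < d /\ Defs.support u `<=` P d.
  have : \forall d \near (0 : R)^'+, 0 < d /\ Defs.support u `<=` P d.
    near=> d; split; first by near: d; exact: nbhs_right_gt.
    by near: d; exact: H.
  by move/filter_ex.
exists d, d^-1; split => //; first by rewrite invr_gt0.
move=> y /Hd [h1 h2]; split; first by move: h1; rewrite mxE.
by move=> j jn; have := h2 (Ordinal jn); rewrite mxE.
Unshelve. all: by end_near. Qed.

Definition vpartial u (i : nat) y : R := partial (inord i) u (vec n y).

Lemma c1h_vec u : Cc_infty_halfspace u -> c1h m (fun y => u (vec n y)) (vpartial u).
Proof.
move=> [[du cu] [ku su]]; have [d [M [d0 M0 box]]] := support_box ku su.
split.
- split; first by move=> y _; apply: contn_vec; exact: (cu [::]).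
  exists d, M; split => // y _ uy; apply: box; apply: subset_closure => /=.
  exact/eqP.
- move=> i in_; split.
    by move=> y _; apply: contn_vec; exact: (cu [:: inord i]).
  exists d, M; split => // y _ uy; apply: box; apply: contrapT => /not_support nx.
  apply: uy; rewrite /vpartial /partial.
  by rewrite (@near_eq_derive _ _ _ _ (fun=> 0)) ?derive_cst.
- move=> i y in_ y0; have := du [::] (inord i) (vec n y).
  move=> /derivableP /is_derive_vec; rewrite inordK //.
Qed.

(** The ground state identity cancels the Hardy term, so both halves of the theorem become
    statements on [defect_int]. *)
Lemma HSM_ineqP (alpha : nat -> R) (C : R) u : Cc_infty_halfspace u ->
  HSM_ineq alpha C u <->
  C * powR (crit_int m (fun y => u (vec n y))) (2 / crit_exp R n) <=
  defect_int m alpha (fun y => u (vec n y)) (vpartial u).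
Proof.
move=> hu; rewrite /HSM_ineq !integral_halfspaceE.
have := ground_state_identity alpha (c1h_vec hu).
have -> : inth m (fun y => grad_sq u (vec n y)) =
   inth m (fun y => \sum_(i < n) vpartial u i y ^+ 2).
  apply: eq_inth => y _; apply: eq_bigr => i _.
  by rewrite /vpartial inord_val.
have -> : inth m (fun y => hardy_weight alpha (vec n y) * u (vec n y) ^+ 2) =
   inth m (fun y => weight m alpha y * u (vec n y) ^+ 2).
  by apply: eq_inth => y _; rewrite hardy_weightE.
by move=> ->; rewrite lerD2l.
Qed.

End Bridge.

(** * The smooth function [expR (- 1 / t)] on the positive axis *)

Section Bump.
Variable R : realType.
Implicit Types (q : {poly R}) (t x : R).

Lemma is_derive1M (f g : R -> R) t df dg : is_derive t (1 : R) f df ->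
  is_derive t (1 : R) g dg ->
  is_derive t (1 : R) (fun s => f s * g s) (df * g t + f t * dg).
Proof.
move=> hf hg; apply: (is_derive_eq (is_deriveM hf hg)).
by rewrite /GRing.scale /= addrC; congr (_ + _); rewrite mulrC.
Qed.

(** The polynomial in [1 / t] makes the family stable under differentiation, so one lemma provides
    derivatives of all orders. *)
Definition bump q t : R := if 0 < t then q.[t^-1] * expR (- t^-1) else 0.

(** Coefficient by coefficient, from [x ^ i <= i! * expR x]. *)
Lemma poly_le_expR q : exists2 C : R, 0 <= C & forall x, 0 <= x -> `|q.[x]| <= C * expR x.
Proof.
exists (\sum_(i < size q) `|q`_i| * (i`!)%:R).
  by apply: sumr_ge0 => i _; rewrite mulr_ge0.
move=> x x0; rewrite horner_coef mulr_suml.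
apply: (le_trans (ler_norm_sum _ _ _)); apply: ler_sum => i _.
rewrite normrM -mulrA ler_wpM2l // normrX (ger0_norm x0).
case: (nat_of_ord i) => [|k]; first by rewrite expr0 fact0 mul1r -[leLHS]expR0 ler_expR.
rewrite -ler_pdivrMl ?ltr0n ?fact_gt0 // mulrC.
by have := expR_ge1Dxn k x0; lra.
Qed.

(** The bound for ['X * q] at [1 / t] is the bound for [q] with an additional factor [|t|]. *)
Lemma bump_le q : exists2 C : R, 0 <= C & forall t, `|bump q t| <= C * `|t|.
Proof.
have [C C0 hC] := poly_le_expR ('X * q); exists C => // t; rewrite /bump.
case: ifP => t0; last by rewrite normr0 mulr_ge0.
have it : 0 < t^-1 by rewrite invr_gt0.
have := hC t^-1 (ltW it); rewrite hornerM hornerX normrM (gtr0_norm it) => h.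
rewrite normrM (gtr0_norm (expR_gt0 _)) (gtr0_norm t0) expRN ler_pdivrMr ?expR_gt0 //.
by rewrite mulrAC -ler_pdivrMr // mulrC.
Qed.

Lemma bump_cont0 q : {for 0, continuous (bump q)}.
Proof.
have [C C0 hC] := bump_le q; apply/cvgrPdist_lt => e e0.
exists (e / (C + 1)) => /=; first by rewrite divr_gt0 // ltr_wpDl.
move=> t /=; rewrite sub0r normrN => ht.
rewrite {1}/bump ltxx sub0r normrN; apply: le_lt_trans (hC t) _.
apply: (@le_lt_trans _ _ ((C + 1) * `|t|)); first by rewrite ler_wpM2r // lerDl.
by rewrite mulrC -ltr_pdivlMr // ltr_wpDl.
Qed.

Definition dbump q := 'X^2 * (q - q^`()).

Lemma is_derive_bump q t : is_derive t (1 : R) (bump q) (bump (dbump q) t).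
Proof.
have [t0|t0|->] := ltgtP t 0.
- rewrite {2}/bump ltNge (ltW t0) /=.
  apply: (@near_eq_is_derive _ _ _ (fun=> 0)).
  have : \forall s \near t, s < 0 by exact: lt_nbhsl.
  by apply: filterS => s s0; rewrite /bump ltNge (ltW s0).
- apply: (@near_eq_is_derive _ _ _ (fun s : R => q.[s^-1] * expR (- s^-1))).
    have : \forall s \near t, 0 < s by exact: lt_nbhsr.
    by apply: filterS => s s0; rewrite /bump s0.
  have t1 : t != 0 by rewrite gt_eqF.
  have hi := is_derive_inv t1.
  have h1 := is_derive1_comp (is_derive_poly q t^-1) hi.
  have h2 := @is_derive1_comp _ expR (fun s => - s^-1) t _ _ (is_derive_expR _) (is_deriveN hi).
  apply: is_derive_eq (is_derive1M h1 h2) _.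
  rewrite /bump t0 /dbump !hornerE /=.
  by ring.
- rewrite {2}/bump ltxx; apply/is_derive1_caratheodory.
  (* The difference quotient of [bump q] at [0] is again a bump, hence continuous with value [0]. *)
  exists (bump ('X * q)); split; last by rewrite /bump ltxx.
    move=> z; rewrite {2}/bump ltxx !subr0 /bump; case: ifP => z0; last by rewrite mul0r.
    by rewrite hornerM hornerX; field; rewrite gt_eqF.
  exact: bump_cont0.
Qed.

Lemma continuous_bump q : continuous (bump q).
Proof.
by move=> t; have [+ _] := is_derive_bump q t; move=> /derivable1_diffP/differentiable_continuous.
Qed.

Definition f0 : R -> R := bump 1.
Definition df0 : R -> R := bump 'X^2.

Lemma is_derive_f0 t : is_derive t (1 : R) f0 (df0 t).
Proof.
have := is_derive_bump 1 t; rewrite /dbump -polyC1 derivC subr0 mulr1.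
by rewrite polyC1.
Qed.

Lemma f0_le0 t : t <= 0 -> f0 t = 0.
Proof. by move=> t0; rewrite /f0 /bump ltNge t0. Qed.

Lemma df0_le0 t : t <= 0 -> df0 t = 0.
Proof. by move=> t0; rewrite /df0 /bump ltNge t0. Qed.

Lemma f0_gt0 t : 0 < t -> 0 < f0 t.
Proof. by move=> t0; rewrite /f0 /bump t0 hornerC mul1r expR_gt0. Qed.

Lemma f0_ge0 t : 0 <= f0 t.
Proof. by case: (ltP 0 t) => [/f0_gt0/ltW //|/f0_le0 ->]. Qed.

Lemma df0_ge0 t : 0 <= df0 t.
Proof.
case: (ltP 0 t) => [t0|/df0_le0 -> //]; rewrite /df0 /bump t0 hornerXn.
by rewrite mulr_ge0 ?expR_ge0 // exprn_ge0 // invr_ge0 ltW.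
Qed.

Lemma f0_le1 t : f0 t <= 1.
Proof.
case: (ltP 0 t) => [t0|/f0_le0 -> //]; rewrite /f0 /bump t0 hornerC mul1r.
by rewrite -expR0 ler_expR oppr_le0 invr_ge0 ltW.
Qed.

Lemma df0_le2 t : df0 t <= 2.
Proof.
case: (ltP 0 t) => [t0|/df0_le0 -> //]; rewrite /df0 /bump t0 hornerXn.
rewrite expRN ler_pdivrMr ?expR_gt0 //.
have it : 0 <= t^-1 by rewrite invr_ge0 ltW.
by have := expR_ge1Dxn 1 it; rewrite (_ : 2`! = 2)%N //; lra.
Qed.

Lemma f0_homo : {homo f0 : s t / s <= t}.
Proof.
move=> s t st; case: (ltP 0 s) => [s0|/f0_le0 ->]; last exact: f0_ge0.
have t0 : 0 < t by exact: lt_le_trans st.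
rewrite /f0 /bump s0 t0 !hornerC !mul1r ler_expR lerN2.
by rewrite lef_pV2.
Qed.

End Bump.

(** * The orthogonal logarithmic variables *)

Section LogVariables.
Variables (R : realType) (m : nat) (alpha : nat -> R).
Local Notation n := m.+1.
Local Notation spow := (spow alpha).
Implicit Types (y z : nat -> R) (g : nat -> R -> R) (h : R -> R).

(* With the conventions [rho m.+1 = 1] and [1 / rho m.+1 = 0], the logarithmic
   variables [lv k = ln (rho k / rho k.+1)] have orthogonal gradients. *)
Definition rx k y : R := if (k <= m)%N then ri k y else 0.
Definition lnr k y : R := if (k <= m)%N then ln (rho k y) else 0.
Definition dlnr i k y : R := (i <= k)%:R * (2 * y i * rx k y).
Definition ddlnr i k y : R := (i <= k)%:R * (2 * (rx k y - 2 * y i ^+ 2 * rx k y ^+ 2)).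
Definition lv k y := lnr k y - lnr k.+1 y.
Definition dlv i k y := dlnr i k y - dlnr i k.+1 y.
Definition ddlv i k y := ddlnr i k y - ddlnr i k.+1 y.

Lemma pdB i (F G : (nat -> R) -> R) y dF dG : pd i F y dF -> pd i G y dG ->
  pd i (fun z => F z - G z) y (dF - dG).
Proof. by move=> hF hG; exact: is_deriveB. Qed.

Lemma pd_lnr i k y : 0 < y 0%N -> pd i (lnr k) y (dlnr i k y).
Proof.
move=> y0; rewrite /lnr /dlnr /rx; case: (leqP k m) => km.
  have h := pd_comp (pd_rho i k y) (is_derive1_ln (rho_gt0 k y0)).
  by apply: pd_eq h _; rewrite /ri; ring.
by rewrite !mulr0; exact: pd_cst.
Qed.

Lemma pd_lv i k y : 0 < y 0%N -> pd i (lv k) y (dlv i k y).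
Proof. by move=> y0; apply: pdB; exact: pd_lnr. Qed.

Lemma pd_rx i k y : 0 < y 0%N ->
  pd i (rx k) y (- (i <= k)%:R * (2 * y i * rx k y ^+ 2)).
Proof.
move=> y0; rewrite /rx; case: (leqP k m) => km; first exact: pd_ri.
by rewrite expr0n /= !mulr0; exact: pd_cst.
Qed.

Lemma pd_dlnr i k y : 0 < y 0%N -> pd i (dlnr i k) y (ddlnr i k y).
Proof.
move=> y0; have h := pdM (pdZ 2 (pd_coord i i y)) (pd_rx i k y0).
apply: pd_eq (pdZ (i <= k)%:R h) _; rewrite /ddlnr eqxx.
by case: (i <= k)%N => /=; ring.
Qed.

Lemma pd_dlv i k y : 0 < y 0%N -> pd i (dlv i k) y (ddlv i k y).
Proof. by move=> y0; apply: pdB; exact: pd_dlnr. Qed.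

Lemma rho_rx k y : (k <= m)%N -> 0 < y 0%N -> rho k y * rx k y = 1.
Proof. by move=> km y0; rewrite /rx km rho_ri. Qed.

Lemma sum_le_sqr k y : (k <= m)%N -> \sum_(i < n) (i <= k)%:R * y i ^+ 2 = rho k y.
Proof.
move=> km; rewrite /rho (big_nat_widen _ _ n) // big_mkord [RHS]big_mkcond /=.
by apply: eq_bigr => i _; rewrite ltnS; case: (i <= k)%N; rewrite ?mul1r ?mul0r.
Qed.

(** The scalar product of the two gradients depends on the larger index alone; this is why
    consecutive differences are orthogonal. *)
Lemma sum_dlnr k l y : (k <= l)%N -> 0 < y 0%N ->
  \sum_(i < n) dlnr i k y * dlnr i l y = 4 * rx l y.
Proof.
move=> kl y0; case: (leqP l m) => lm; last first.
  rewrite [in RHS]/rx leqNgt lm mulr0 big1 // => i _.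
  by rewrite /dlnr /rx [(l <= m)%N]leqNgt lm !mulr0.
have km : (k <= m)%N by exact: leq_trans lm.
rewrite (eq_bigr (fun i : 'I_n => 4 * rx k y * rx l y * ((i <= k)%:R * y i ^+ 2))).
  rewrite -mulr_sumr sum_le_sqr // -[RHS]mulr1 -(rho_rx km y0); ring.
move=> i _; rewrite /dlnr; case: (leqP i k) => ik; last by rewrite !mul0r !mulr0.
by rewrite (leq_trans ik kl) !mul1r; ring.
Qed.

(** The Laplacian of the logarithm of the squared norm in [k.+1] dimensions; [k - 1] is the
    dimension minus two. *)
Lemma sum_ddlnr k y : 0 < y 0%N ->
  \sum_(i < n) ddlnr i k y = 2 * (k%:R - 1) * rx k y.
Proof.
move=> y0; case: (leqP k m) => km; last first.
  rewrite [in RHS]/rx leqNgt km mulr0 big1 // => i _.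
  by rewrite /ddlnr /rx (leqNgt k) km expr0n /= !mulr0 subrr !mulr0.
rewrite (eq_bigr (fun i : 'I_n => 2 * rx k y * (i <= k)%:R -
    4 * rx k y ^+ 2 * ((i <= k)%:R * y i ^+ 2))); last first.
  by move=> i _; rewrite /ddlnr; ring.
rewrite sumrB -!mulr_sumr sum_le_sqr //.
have -> : \sum_(i < n) (i <= k)%:R = k.+1%:R :> R.
  have -> : k.+1%:R = \sum_(0 <= i < k.+1) 1 :> R by rewrite sumr_const_nat subn0.
  rewrite (big_nat_widen _ _ n) // big_mkord [RHS]big_mkcond /=.
  by apply: eq_bigr => i _; rewrite ltnS; case: (i <= k)%N.
have -> : 4 * rx k y ^+ 2 * rho k y = 4 * rx k y.
  by rewrite -[RHS]mulr1 -(rho_rx km y0); ring.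
by rewrite -natr1; ring.
Qed.

Lemma sum_dlv_orth k l y : (k < l)%N -> 0 < y 0%N ->
  \sum_(i < n) dlv i k y * dlv i l y = 0.
Proof.
move=> kl y0; have h := @sum_dlnr _ _ y _ y0.
rewrite (eq_bigr (fun i : 'I_n => dlnr i k y * dlnr i l y - dlnr i k y * dlnr i l.+1 y -
   (dlnr i k.+1 y * dlnr i l y - dlnr i k.+1 y * dlnr i l.+1 y))); last first.
  by move=> i _; rewrite /dlv; ring.
rewrite !sumrB !h //; first by rewrite subrr.
- exact: leq_trans kl _.
- exact: leq_trans (ltnW kl) _.
- exact: ltnW.
Qed.

Lemma sum_dlv_sqr k y : 0 < y 0%N ->
  \sum_(i < n) dlv i k y * dlv i k y = 4 * (rx k y - rx k.+1 y).
Proof.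
move=> y0; have h := @sum_dlnr _ _ y _ y0.
rewrite (eq_bigr (fun i : 'I_n => dlnr i k y * dlnr i k y + dlnr i k.+1 y * dlnr i k.+1 y -
   2 * (dlnr i k y * dlnr i k.+1 y))); last first.
  by move=> i _; rewrite /dlv; ring.
by rewrite sumrB big_split /= -mulr_sumr !h //; ring.
Qed.

Lemma sum_dlv k l y : 0 < y 0%N -> \sum_(i < n) dlv i k y * dlv i l y =
  (if k == l then 4 * (rx k y - rx k.+1 y) else 0).
Proof.
move=> y0; case: (ltngtP k l) => kl.
- exact: sum_dlv_orth.
- by rewrite -[RHS](sum_dlv_orth kl y0); apply: eq_bigr => i _; rewrite mulrC.
- by rewrite -kl sum_dlv_sqr.
Qed.

Lemma sum_ddlv k y : 0 < y 0%N ->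
  \sum_(i < n) ddlv i k y = 2 * (k%:R - 1) * rx k y - 2 * k%:R * rx k.+1 y.
Proof. by move=> y0; rewrite sumrB !sum_ddlnr // -[k.+1%:R]natr1 addrK. Qed.

(** Summation by parts between the exponents [spow] of the quotients and [apow] of the single
    [rho k]. The boundary term at [N = n] vanishes by the convention [rx n = 0]. *)
Lemma sum_spow_dlv i y : (i < n)%N ->
  \sum_(0 <= k < n) spow k.+1 / 2 * dlv i k y = adrift m alpha i y.
Proof.
move=> in_; suff main N : (N <= n)%N ->
    \sum_(0 <= k < N) spow k.+1 / 2 * dlv i k y =
    y i * tpow alpha N i y - spow N / 2 * dlnr i N y.
  by rewrite main // /dlnr /rx ltnn !mulr0 subr0.
elim: N => [|N IH] Nn; first by rewrite big_geq // /tpow big_geq //= !mul0r mulr0 subr0.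
have dN : dlnr i N y = (i <= N)%:R * (2 * y i * ri N y).
  by rewrite /dlnr /rx -(ltnS N m) Nn.
rewrite big_nat_recr // IH ?(ltnW Nn) // tpowS /apow /dlv dN.
by move: (spow N) (spow N.+1) (dlnr i N.+1 y) => a b c /=; field.
Qed.

Lemma rx_expR k y : (k < m)%N -> 0 < y 0%N -> rx k y * expR (lv k y) = rx k.+1 y.
Proof.
move=> km y0; rewrite /rx /lv /lnr km (ltnW km) expRB !lnK ?posrE ?rho_gt0 //.
by rewrite /ri mulrA mulVf ?mul1r // gt_eqF // rho_gt0.
Qed.

Lemma expR_lvm y : 0 < y 0%N -> rx m y = expR (- lv m y).
Proof.
move=> y0; rewrite /lv /lnr /rx leqnn ltnn subr0 expRN lnK ?posrE ?rho_gt0 //.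
Qed.

Lemma lv_le0 k y : (k < m)%N -> 0 < y 0%N -> lv k y <= 0.
Proof.
move=> km y0; rewrite /lv /lnr km (ltnW km) subr_le0 ler_ln ?posrE ?rho_gt0 //.
exact: rho_le.
Qed.

Lemma rx_ge0 k y : 0 < y 0%N -> 0 <= rx k y.
Proof. by move=> y0; rewrite /rx; case: ifP => // _; rewrite ltW // ri_gt0. Qed.

Lemma rx_decr k y : 0 < y 0%N -> rx k.+1 y <= rx k y.
Proof.
move=> y0; rewrite /rx; case: (ltnP k m) => km.
  by rewrite (ltnW km) ri_le.
by case: ifP => // _; rewrite ltW // ri_gt0.
Qed.

Lemma contn_rx k y : 0 < y 0%N -> contn n (rx k) y.
Proof.
move=> y0; rewrite /rx; case: (leqP k m) => km; last exact: contn_cst.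
exact: contn_ri.
Qed.

Lemma contn_lnr k y : 0 < y 0%N -> contn n (lnr k) y.
Proof.
move=> y0; rewrite /lnr; case: (leqP k m) => km; last exact: contn_cst.
apply: (@contn_comp _ _ (@ln R)); first exact: contn_rho.
have [+ _] := is_derive1_ln (rho_gt0 k y0).
by move=> /derivable1_diffP/differentiable_continuous.
Qed.

Lemma contn_lv k y : 0 < y 0%N -> contn n (lv k) y.
Proof. by move=> y0; apply: contnB; exact: contn_lnr. Qed.

Lemma contn_dlnr i k y : (i < n)%N -> 0 < y 0%N -> contn n (dlnr i k) y.
Proof.
move=> in_ y0; apply: contnM; first exact: contn_cst.
apply: contnM; last exact: contn_rx.
by apply: contnM; [exact: contn_cst|exact: contn_coord].
Qed.

Lemma contn_dlv i k y : (i < n)%N -> 0 < y 0%N -> contn n (dlv i k) y.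
Proof. by move=> in_ y0; apply: contnB; exact: contn_dlnr. Qed.

Lemma contn_ddlv i k y : (i < n)%N -> 0 < y 0%N -> contn n (ddlv i k) y.
Proof.
have h j : (i < n)%N -> 0 < y 0%N -> contn n (ddlnr i j) y.
  move=> in_ y0; have cr : contn n (rx j) y := contn_rx y0.
  apply: contnM; first exact: contn_cst.
  apply: contnM; first exact: contn_cst.
  apply: contnB => //; apply: contnM; last exact: contnX.
  by apply: contnM; [exact: contn_cst|apply: contnX; exact: contn_coord].
by move=> in_ y0; apply: contnB; exact: h.
Qed.

Definition upf g k h : nat -> R -> R := fun l => if l == k then h else g l.

Definition lprod g y : R := \prod_(0 <= k < n) g k (lv k y).

Lemma lprod_upf g k h y : (k < n)%N ->
  lprod (upf g k h) y = h (lv k y) * lprod (upf g k (fun=> 1)) y.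
Proof.
move=> kn; rewrite /lprod !big_mkord (bigD1 (Ordinal kn)) //=.
rewrite [X in _ = _ * X](bigD1 (Ordinal kn)) //= /upf eqxx mul1r.
congr (_ * _); apply: eq_bigr => l lk.
by move: lk; rewrite -val_eqE /= => /negbTE ->.
Qed.

Lemma lprod_split g k y : (k < n)%N ->
  lprod g y = g k (lv k y) * lprod (upf g k (fun=> 1)) y.
Proof.
move=> kn; rewrite -(lprod_upf g (g k) _ kn); congr lprod.
by apply/funext => l; rewrite /upf; case: eqP => [->|].
Qed.

Lemma pd_lprod i g dg y : 0 < y 0%N ->
  (forall k t, (k < n)%N -> is_derive t (1 : R) (g k) (dg k t)) ->
  pd i (lprod g) y (\sum_(0 <= k < n) dlv i k y * lprod (upf g k (dg k)) y).
Proof.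
move=> y0 hg.
suff main N : (N <= n)%N -> pd i (fun z => \prod_(0 <= k < N) g k (lv k z)) y
   (\sum_(0 <= k < N) dlv i k y * \prod_(0 <= l < N) upf g k (dg k) l (lv l y)).
  exact: main.
elim: N => [|N IH] Nn.
  rewrite (_ : (fun z => _) = fun=> 1).
    by rewrite big_geq //; exact: pd_cst.
  by apply/funext => z; rewrite big_geq.
have h := pd_comp (pd_lv i N y0) (hg N (lv N y) Nn).
rewrite (_ : (fun z => _) = fun z => (\prod_(0 <= k < N) g k (lv k z)) * g N (lv N z)).
  apply: pd_eq (pdM (IH (ltnW Nn)) h) _.
  rewrite [RHS]big_nat_recr //= mulr_suml; congr (_ + _).
    apply: eq_big_nat => k /andP[_ kN].
    by rewrite big_nat_recr //= {3}/upf (gtn_eqF kN) mulrA.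
  rewrite big_nat_recr //= {2}/upf eqxx mulrCA mulrC -mulrA mulrCA; congr (_ * (_ * _)).
  by apply: eq_big_nat => k /andP[_ kN]; rewrite /upf (ltn_eqF kN).
by apply/funext => z; rewrite big_nat_recr.
Qed.

(** For [k < m] the variable [lv k] is at most [0], so only the last factor needs a cutoff on the
    right. *)
Definition vanish (L : R) k h := forall t, (t <= - L \/ (k = m /\ L <= t)) -> h t = 0.
Definition cvan k h := continuous h /\ exists L, vanish L k h.
Definition adm g := forall k, (k < n)%N -> cvan k (g k).

Lemma adm_upf g k h : adm g -> cvan k h -> adm (upf g k h).
Proof. by move=> hg hh l ln; rewrite /upf; case: eqP => [-> //|_]; exact: hg. Qed.

Lemma vanish_le (L L' : R) k h : L <= L' -> vanish L k h -> vanish L' k h.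
Proof. by move=> LL hL t [a|[km a]]; apply: hL; [left|right; split => //]; lra. Qed.

Lemma adm_vanish g : adm g -> exists2 L : R, 0 < L &
  forall k, (k < n)%N -> vanish L k (g k).
Proof.
move=> hg; suff main N : (N <= n)%N -> exists2 L : R, 0 < L &
    forall k, (k < N)%N -> vanish L k (g k) by exact: main.
elim: N => [|N IH] Nn; first by exists 1.
have [L L0 hL] := IH (ltnW Nn); have [_ [L' hL']] := hg N Nn.
exists (Num.max L L'); first by rewrite lt_max L0.
move=> k; rewrite ltnS leq_eqVlt => /predU1P[->|kN].
  by apply: vanish_le hL'; rewrite le_max lexx orbT.
by apply: vanish_le (hL k kN); rewrite le_max lexx.
Qed.

Lemma lprod_neq0 g y k : (k < n)%N -> lprod g y <> 0 -> g k (lv k y) <> 0.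
Proof. by move=> kn h gk; apply: h; rewrite (lprod_split _ _ kn) gk mul0r. Qed.

Lemma norm_le_lvm (L : R) y j : (j < n)%N -> 0 < y 0%N -> lv m y <= L ->
  `|y j| <= expR L + 1.
Proof.
move=> jn y0; rewrite /lv /lnr leqnn ltnn subr0 => h.
have hr : rho m y <= expR L by rewrite -ler_expR lnK ?posrE ?rho_gt0 in h.
have := le_trans (sqr_le_rho y (ltnSE jn)) hr; rewrite -(real_normK (num_real (y j))).
have := expR_gt0 L; have := normr_ge0 (y j); nra.
Qed.

(** On the support [lv m] is bounded above, which bounds every coordinate. All [lv k] are bounded
    below, and they sum to [ln (rho 0)], twice the logarithm of [y 0], which keeps away from the
    boundary. *)
Lemma cch_lprod g : adm g -> cch m (lprod g).
Proof.
move=> hg; have [L L0 hL] := adm_vanish hg; split.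
  move=> y y0; rewrite (_ : lprod g = fun z => \prod_(k < n) g k (lv k z)).
    apply: (@contn_prod _ _ _ _ _ (fun (k : 'I_n) z => g k (lv k z))) => k _.
    apply: (@contn_comp _ _ (g k)); first exact: contn_lv.
    exact: (hg k (ltn_ord k)).1.
  by apply/funext => z; rewrite /lprod big_mkord.
exists (Num.min 1 (expR (- (n%:R * L)))), (expR L + 1); split.
- by rewrite lt_min ltr01 expR_gt0.
- by rewrite ltr_wpDl ?expR_ge0.
move=> y y0 gy; split; last first.
  move=> j jn; apply: norm_le_lvm => //; rewrite leNgt; apply/negP => h.
  by apply: (lprod_neq0 (ltnSn m) gy); apply: hL => //; right; rewrite ltW.
have h : - (n%:R * L) <= lnr 0 y.
  have -> : lnr 0 y = \sum_(0 <= k < n) lv k y.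
    rewrite (@telescope_sumr_eq _ 0 n (fun k => - lnr k y)) // => [|k _].
      by rewrite opprK [X in - X + _]/lnr ltnn oppr0 add0r.
    by rewrite /lv opprK addrC.
  have -> : - (n%:R * L) = \sum_(0 <= k < n) - L.
    by rewrite sumr_const_nat subn0 mulNrn mulr_natl.
  rewrite big_nat [leRHS]big_nat; apply: ler_sum => k /andP[_ kn].
  rewrite leNgt; apply/negP => hk.
  by apply: (lprod_neq0 kn gy); apply: hL => //; left; rewrite ltW.
have h2 : expR (- (n%:R * L)) <= y 0%N ^+ 2.
  move: h; rewrite -[_ <= lnr 0 y]ler_expR /lnr leq0n lnK ?posrE ?rho_gt0 //.
  by rewrite /rho big_nat1.
rewrite ge_min; case: (leP 1 (y 0%N)) => //= y1.
by apply: le_trans h2 _; nra.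
Qed.

Lemma cch_rx_lprod k g : adm g -> cch m (fun y => rx k y * lprod g y).
Proof. by move=> hg; apply: (cchM (cch_lprod hg)) => y y0; exact: contn_rx. Qed.

End LogVariables.

(** * Test functions, integration by parts along [lv] and uniform mass bounds *)

Section TestFunctions.
Variables (R : realType) (m : nat) (alpha : nat -> R).
Hypothesis alpha_le0 : forall i, (i < m.+1)%N -> alpha i <= 0.
Local Notation n := m.+1.
Local Notation spow := (spow alpha).
Local Notation inth := (inth m).
Local Notation cch := (cch m).
Local Notation lprod := (lprod m).
Local Notation adm := (adm m).
Local Notation cvan := (cvan m).
Local Notation rx := (rx m).
Local Notation lv := (lv m).
Local Notation dlv := (dlv m).
Implicit Types (y : nat -> R) (f df g : nat -> R -> R) (h : R -> R).

Lemma is_derive_expZ (c t : R) : is_derive t (1 : R) (fun s => expR (c * s)) (c * expR (c * t)).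
Proof.
have h : is_derive t (1 : R) (fun s => c * s) (0 * t + c * 1).
  exact: is_derive1M (is_derive_cst c t 1) (is_derive_id t 1).
have := @is_derive1_comp _ expR (fun s => c * s) t _ _ (is_derive_expR (c * t)) h.
by move/is_derive_eq; apply; ring.
Qed.

Lemma continuous_expZ (c : R) : continuous (fun t => expR (c * t)).
Proof.
move=> t; have [+ _] := is_derive_expZ c t.
by move=> /derivable1_diffP/differentiable_continuous.
Qed.

Lemma cvanM k h h' : cvan k h -> continuous h' -> cvan k (fun t => h' t * h t).
Proof.
move=> [ch [L hL]] ch'; split; last by exists L => t /hL ->; rewrite mulr0.
by move=> t; apply: cvgM; [exact: ch'|exact: ch].
Qed.

Lemma cvanD k h h' : cvan k h -> cvan k h' -> cvan k (fun t => h t + h' t).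
Proof.
move=> [ch [L hL]] [ch' [L' hL']]; split.
  by move=> t; apply: cvgD; [exact: ch|exact: ch'].
exists (Num.max L L') => t ht.
have LL : L <= Num.max L L' by rewrite le_max lexx.
have LL' : L' <= Num.max L L' by rewrite le_max lexx orbT.
by rewrite (vanish_le LL hL ht) (vanish_le LL' hL' ht) addr0.
Qed.

Lemma cvanZ k (c : R) h : cvan k h -> cvan k (fun t => c * h t).
Proof. by move=> hh; apply: cvanM => // t; exact: cvg_cst. Qed.

(** In the variable [lv k] a power of [rho k / rho k.+1] is an exponential. Both the ground state
    and a change of weight are therefore twists. *)
Definition twist (a : nat -> R) f : nat -> R -> R := fun k t => expR (a k * t) * f k t.

Lemma adm_twist a f : adm f -> adm (twist a f).
Proof. by move=> hf k kn; apply: cvanM (hf k kn) _; exact: continuous_expZ. Qed.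

Definition dtwist (a : nat -> R) f df : nat -> R -> R :=
  fun k t => expR (a k * t) * (a k * f k t + df k t).

Definition der f df := forall k t, (k < n)%N -> is_derive t (1 : R) (f k) (df k t).

Lemma der_twist a f df : der f df -> der (twist a f) (dtwist a f df).
Proof.
move=> hf k t kn; have := is_derive1M (is_derive_expZ (a k) t) (hf k t kn).
by move/is_derive_eq; apply; rewrite /dtwist; ring.
Qed.

Lemma adm_dtwist a f df : adm f -> adm df -> adm (dtwist a f df).
Proof.
move=> hf hdf k kn; apply: cvanM; last exact: continuous_expZ.
by apply: cvanD; [apply: cvanZ; exact: hf|exact: hdf].
Qed.

Lemma twistD a b f : twist a (twist b f) = twist (fun k => a k + b k) f.
Proof.
apply/funext => k; apply/funext => t.
by rewrite /twist mulrDl expRD mulrA.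
Qed.

Lemma upf_twist a f k h :
  twist a (upf f k h) = upf (twist a f) k (fun t => expR (a k * t) * h t).
Proof.
apply/funext => l; apply/funext => t; rewrite /twist /upf.
by case: eqP => // ->.
Qed.

(* The integrals over the test functions are written with the squared ground
   state [expR (\sum_k spow k.+1 * lv k)] absorbed in the factors. *)
Definition gs f := twist (fun k => spow k.+1) f.

Lemma lprod_ge0 g y : (forall k t, (k < n)%N -> 0 <= g k t) -> 0 <= lprod g y.
Proof.
move=> h; rewrite /lprod big_nat_cond; apply: prodr_ge0 => k /andP[/andP[_ kn] _].
exact: h.
Qed.

(** Divergence theorem for the product [lprod (gs f)] times the gradient of [lv p]. Orthogonality
    leaves the derivative of factor [p] alone, and the exponent [spow p.+1] cancels the Laplacian of
    [lv p] up to the [alpha p] term and [- 2 * rx p.+1]. *)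
Lemma log_identity f df p : (p < n)%N -> der f df -> adm f -> adm df ->
  inth (fun y => (rx p y - rx p.+1 y) *
    lprod (gs (upf f p (fun t => 4 * (df p t - alpha p * f p t)))) y) =
  2 * inth (fun y => rx p.+1 y * lprod (gs f) y).
Proof.
move=> pn hd af adf.
pose g := gs f; pose dg := dtwist (fun k => spow k.+1) f df.
have ag : adm g := adm_twist _ af.
have adg : adm dg := adm_dtwist _ af adf.
have hg : der g dg := der_twist _ hd.
pose h t := 4 * (df p t - alpha p * f p t).
have ah : adm (upf f p h).
  apply: adm_upf => //; apply: cvanZ; under eq_fun do rewrite -mulNr.
  by apply: cvanD; [exact: adf|apply: cvanZ; exact: af].
have cP := cch_lprod ag.
pose F i y := lprod g y * dlv i p y.
pose D i y := (\sum_(0 <= k < n) dlv i k y * lprod (upf g k (dg k)) y) * dlv i p y +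
  lprod g y * ddlv m i p y.
have cF i : (i < n)%N -> cch (F i).
  move=> in_; rewrite (_ : F i = fun y => dlv i p y * lprod g y); last first.
    by apply/funext => y; rewrite /F mulrC.
  by apply: (cchM cP) => y y0; exact: contn_dlv.
have cu k : (k < n)%N -> cch (lprod (upf g k (dg k))).
  by move=> kn; apply/cch_lprod/adm_upf => //; exact: adg.
have cD i : (i < n)%N -> cch (D i).
  move=> in_; apply: cchD; last first.
    rewrite (_ : (fun y => _) = fun y => ddlv m i p y * lprod g y); last first.
      by apply/funext => y; rewrite mulrC.
    by apply: (cchM cP) => y y0; exact: contn_ddlv.
  rewrite (_ : (fun y => _) = fun y => dlv i p y *
      \sum_(k < n) dlv i k y * lprod (upf g k (dg k)) y); last first.
    by apply/funext => y; rewrite mulrC big_mkord.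
  apply: cchM; last by move=> y y0; exact: contn_dlv.
  apply: (@cch_sum _ _ _ _ _ (fun (k : 'I_n) y => dlv i k y * lprod (upf g k (dg k)) y)).
  by move=> k _; apply: cchM; [exact: cu|move=> y y0; exact: contn_dlv].
have D0 i : (i < n)%N -> inth (D i) = 0.
  move=> in_; apply: (inth_pd in_ (cF i in_) (cD i in_)) => y y0.
  by apply: pdM; [exact: pd_lprod|exact: pd_dlv].
have Ds : inth (fun y => \sum_(i < n) D i y) = 0.
  rewrite (@inth_sum _ _ _ _ _ (fun (i : 'I_n) => D i)); last by move=> i _; exact: cD.
  by rewrite big1 // => i _; exact: D0.
have c1 : cch (fun y => (rx p y - rx p.+1 y) * lprod (gs (upf f p h)) y).
  apply: cchM; first exact/cch_lprod/adm_twist.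
  by move=> y y0; apply: contnB; exact: contn_rx.
have c2 : cch (fun y => rx p.+1 y * lprod (gs f) y) := cch_rx_lprod p.+1 ag.
apply/eqP; rewrite -subr_eq0 -inthZ // -inthB //; last exact: cchZ.
rewrite -Ds; apply/eqP/eq_inth => y y0.
have -> : \sum_(i < n) D i y =
   lprod (upf g p (dg p)) y * (4 * (rx p y - rx p.+1 y)) +
   lprod g y * (2 * (p%:R - 1) * rx p y - 2 * p%:R * rx p.+1 y).
  rewrite big_split /= -mulr_sumr sum_ddlv //; congr (_ + _).
  under eq_bigr do rewrite mulr_suml big_mkord.
  rewrite exchange_big /= (bigD1 (Ordinal pn)) //= [X in _ + X]big1 ?addr0.
    under eq_bigr do rewrite mulrAC.
    by rewrite -mulr_suml sum_dlv // eqxx mulrC.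
  move=> k kp; under eq_bigr do rewrite mulrAC.
  rewrite -mulr_suml sum_dlv //.
  by move: kp; rewrite -val_eqE /= => /negbTE ->; rewrite mul0r.
rewrite /gs upf_twist -/(gs f) -/g.
rewrite (lprod_upf g (dg p) _ pn) (lprod_split g y pn).
rewrite (lprod_upf g (fun t => expR (spow p.+1 * t) * h t) _ pn).
rewrite /dg /dtwist /g /gs /twist /h.
set X := lprod _ y; set E := expR _; set a := rx p y; set b := rx p.+1 y.
have -> : spow p.+1 = - alpha p - (p%:R - 1) / 2 by [].
by field.
Qed.

(** Half the exponents of [gs]: the ground state itself times the factors. *)
Definition hgs f := twist (fun k => spow k.+1 / 2) f.

Definition dhgs f df i y := \sum_(0 <= k < n)
  dlv i k y * lprod (upf (hgs f) k (dtwist (fun k => spow k.+1 / 2) f df k)) y.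

Lemma c1h_hgs f df : der f df -> adm f -> adm df -> c1h m (lprod (hgs f)) (dhgs f df).
Proof.
move=> hd af adf; split.
- exact/cch_lprod/adm_twist.
- move=> i in_; rewrite (_ : dhgs f df i = fun y => \sum_(k < n) dlv i k y *
    lprod (upf (hgs f) k (dtwist (fun k => spow k.+1 / 2) f df k)) y); last first.
    by apply/funext => y; rewrite /dhgs big_mkord.
  apply: (@cch_sum _ _ _ _ _ (fun (k : 'I_n) y => dlv i k y *
    lprod (upf (hgs f) k (dtwist (fun k => spow k.+1 / 2) f df k)) y)) => k _.
  apply: cchM; last by move=> y y0; exact: contn_dlv.
  apply/cch_lprod/adm_upf; first exact: adm_twist.
  exact: adm_dtwist.
- move=> i y in_ y0.
  exact: (pd_lprod i y0 (der_twist (fun k => spow k.+1 / 2) hd)).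
Qed.

Definition sqf f : nat -> R -> R := fun k t => f k t ^+ 2.

Lemma lprod_hgs_sqr f y : lprod (hgs f) y ^+ 2 = lprod (gs (sqf f)) y.
Proof.
rewrite /lprod -prodrXl; apply: eq_bigr => k _.
rewrite /hgs /gs /twist /sqf exprMn -expRM_natl; congr (expR _ * _).
by field.
Qed.

(* The cross terms vanish because the [lv k] have orthogonal gradients. *)
Lemma sum_defect_sqr f df y : 0 < y 0%N ->
  \sum_(i < n) defect m alpha (lprod (hgs f)) (dhgs f df) i y ^+ 2 =
  \sum_(k < n) 4 * (rx k y - rx k.+1 y) * lprod (gs (sqf (upf f k (df k)))) y.
Proof.
move=> y0; pose w (k : nat) := lprod (hgs (upf f k (df k))) y.
have dE (i : 'I_n) : defect m alpha (lprod (hgs f)) (dhgs f df) i y =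
    \sum_(k < n) dlv i k y * w k.
  rewrite /defect /dhgs -sum_spow_dlv // !big_mkord mulr_sumr -sumrB.
  apply: eq_bigr => k _; have kn := ltn_ord k.
  rewrite /w /hgs upf_twist -/(hgs f) (lprod_upf _ (dtwist _ _ _ _) _ kn).
  rewrite (lprod_split (hgs f) y kn).
  rewrite (lprod_upf (hgs f) (fun t => expR (spow k.+1 / 2 * t) * df k t) _ kn).
  by rewrite /dtwist /hgs /twist; ring.
under eq_bigr do rewrite dE expr2 mulr_suml.
rewrite exchange_big /=; apply: eq_bigr => k _.
under eq_bigr do rewrite mulr_sumr.
rewrite exchange_big /= (bigD1 k) //= [X in _ + X]big1 ?addr0.
  rewrite -lprod_hgs_sqr -/(w k) -sum_dlv_sqr // mulr_suml.
  by apply: eq_bigr => i _; ring.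
move=> l lk; rewrite (eq_bigr (fun i : 'I_n => w k * w l * (dlv i k y * dlv i l y))).
  rewrite -mulr_sumr sum_dlv //.
  by move: lk; rewrite -val_eqE /= eq_sym => /negbTE ->; rewrite mulr0.
by move=> i _; ring.
Qed.

Lemma lprod_gs_upf f k h y : (k < n)%N ->
  lprod (gs (upf f k h)) y =
  h (lv k y) * (expR (spow k.+1 * lv k y) * lprod (upf (gs f) k (fun=> 1)) y).
Proof. by move=> kn; rewrite /gs upf_twist lprod_upf //; ring. Qed.

Lemma upf_id f k : upf f k (f k) = f.
Proof. by apply/funext => l; rewrite /upf; case: eqP => [->|]. Qed.

Lemma cofactor_ge0 f k y : (k < n)%N -> (forall j t, (j < n)%N -> 0 <= f j t) ->
  0 <= expR (spow k.+1 * lv k y) * lprod (upf (gs f) k (fun=> 1)) y.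
Proof.
move=> kn f0; rewrite mulr_ge0 ?expR_ge0 // lprod_ge0 // => j t jn; rewrite /upf.
by case: eqP => // _; rewrite mulr_ge0 ?expR_ge0 // f0.
Qed.

Lemma le_lprod_gs_upf f k h h' y : (k < n)%N ->
  (forall j t, (j < n)%N -> 0 <= f j t) -> (forall t, h t <= h' t) ->
  lprod (gs (upf f k h)) y <= lprod (gs (upf f k h')) y.
Proof.
by move=> kn f0 hh; rewrite !lprod_gs_upf // ler_wpM2r // cofactor_ge0.
Qed.

(* Transfers mass from the weight [1 / rho k] to the smaller [1 / rho k.+1]. *)
Lemma mass_shift f df k : (k < m)%N -> der f df -> adm f -> adm df ->
  (forall j t, (j < n)%N -> 0 <= f j t) -> (forall t, f k t <= df k t) ->
  inth (fun y => rx k y * lprod (gs f) y) <=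
  3 / 2 * inth (fun y => rx k.+1 y * lprod (gs f) y).
Proof.
move=> km hd af adf f0 fdf; have kn : (k < n)%N := ltnW km.
have ag : adm (gs f) := adm_twist _ af.
have := log_identity kn hd af adf.
pose h t := 4 * (df k t - alpha k * f k t); rewrite -/h => id.
have ah : adm (upf f k h).
  apply: adm_upf => //; apply: cvanZ; under eq_fun do rewrite -mulNr.
  by apply: cvanD; [exact: adf|apply: cvanZ; exact: af].
have c1 := cch_rx_lprod k ag; have c2 := cch_rx_lprod k.+1 ag.
(* As [f k <= df k] and [- alpha k * f k] is nonnegative, the left side of the identity is at least
   four times the difference of the two masses; hence the factor [3 / 2]. *)
have : 4 * (inth (fun y => rx k y * lprod (gs f) y) -
            inth (fun y => rx k.+1 y * lprod (gs f) y)) <=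
       2 * inth (fun y => rx k.+1 y * lprod (gs f) y).
  rewrite -id -inthB // -inthZ; last exact: cchB.
  apply: le_inth.
  - by apply: cchZ; exact: cchB.
  - apply: cchM; first exact/cch_lprod/adm_twist.
    by move=> y y0; apply: contnB; exact: contn_rx.
  move=> y y0.
  have -> : 4 * (rx k y * lprod (gs f) y - rx k.+1 y * lprod (gs f) y) =
     (rx k y - rx k.+1 y) * (4 * lprod (gs f) y) by ring.
  rewrite ler_wpM2l ?subr_ge0 ?rx_decr // lprod_gs_upf //.
  rewrite -{1}(upf_id f k) lprod_gs_upf // mulrA ler_wpM2r ?cofactor_ge0 //.
  rewrite /h ler_wpM2l //; apply: (le_trans (fdf _)); rewrite lerDl oppr_ge0.
  by rewrite mulr_le0_ge0 ?alpha_le0 ?f0.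
by lra.
Qed.

(** [1 / rho m] is [1 / rho k] times the exponential of the sum of the [lv l] with [k <= l < m], so
    a change of weight adds one to these exponents. *)
Lemma rx_twist f a k y : (k <= m)%N -> 0 < y 0%N ->
  rx m y * lprod (gs (twist a f)) y =
  rx k y * lprod (gs (twist (fun l => a l + (k <= l < m)%N%:R) f)) y.
Proof.
move=> km y0; move: a; have [j jE] : exists j, (m - k = j)%N by exists (m - k)%N.
elim: j k km jE => [|j IH] k km jE a.
  have -> : k = m by apply/eqP; rewrite eqn_leq km -subn_eq0 jE.
  congr (_ * lprod (gs (twist _ _)) _); apply/funext => l.
  by rewrite leqNgt andNb addr0.
have km' : (k < m)%N by rewrite -subn_gt0 jE.
rewrite (IH k.+1 km' _) ?subnS ?jE // -rx_expR // -mulrA; congr (_ * _).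
have kn : (k < n)%N := ltnW km'.
rewrite /gs !twistD !(lprod_split (twist _ f) y kn) /twist mulrA mulrA -expRD.
rewrite ltnn leqnn km' /=; congr (expR _ * _ * _); first by ring.
rewrite /lprod; apply: eq_big_nat => l _; rewrite /upf; case: eqP => // /eqP lk.
by rewrite [in RHS]leq_eqVlt eq_sym (negbTE lk).
Qed.

Definition mass f := inth (fun y => rx m y * lprod (gs f) y).

(** Written with the weight [rx k], factor [k] carries an exponent at least one and is bounded by
    its own derivative, as [mass_shift] requires. Going back from [rx k.+1] to [rx m] leaves exactly
    one more power at [k]. *)
Lemma mass_step f df (a : nat -> R) k : (k < m)%N -> der f df -> adm f -> adm df ->
  (forall j t, (j < n)%N -> 0 <= f j t) -> (forall t, 0 <= df k t) -> 0 <= a k ->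
  mass (twist a f) <= 3 / 2 * mass (twist (fun l => a l + (l == k)%:R) f).
Proof.
move=> km hd af adf f0 df0 ak.
pose b l := a l + (k <= l < m)%N%:R.
have -> : mass (twist a f) = inth (fun y => rx k y * lprod (gs (twist b f)) y).
  by apply: eq_inth => y y0; exact: rx_twist (ltnW km) y0.
have -> : mass (twist (fun l => a l + (l == k)%:R) f) =
    inth (fun y => rx k.+1 y * lprod (gs (twist b f)) y).
  rewrite (_ : b = fun l => a l + (l == k)%:R + (k.+1 <= l < m)%N%:R).
    by apply: eq_inth => y y0; exact: rx_twist km y0.
  apply/funext => l; rewrite /b -addrA; congr (_ + _).
  case: (ltngtP k l) => kl /=; rewrite ?add0r ?addr0 //.
  by rewrite -kl km.
apply: (mass_shift (df := dtwist b f df)) => //.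
- exact: der_twist.
- exact: adm_twist.
- exact: adm_dtwist.
- by move=> j t jn; rewrite /twist mulr_ge0 ?expR_ge0 // f0.
move=> t; rewrite /twist /dtwist ler_wpM2l ?expR_ge0 //.
rewrite /b leqnn km mulrDl mul1r.
by have := df0 t; have := mulr_ge0 ak (f0 k t (ltnW km)); lra.
Qed.

(** Each of the [m] exponents before the last is raised [N] times, at the price [3 / 2] each
    time. *)
Lemma mass_iter f df N : der f df -> adm f -> adm df ->
  (forall j t, (j < n)%N -> 0 <= f j t) -> (forall k t, (k < m)%N -> 0 <= df k t) ->
  mass f <= (3 / 2) ^+ (N * m) * mass (twist (fun l => if (l < m)%N then N%:R else 0) f).
Proof.
move=> hd af adf f0 df0.
have step (a : nat -> R) k j : (k < m)%N -> 0 <= a k ->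
    mass (twist a f) <= (3 / 2) ^+ j * mass (twist (fun l => a l + j%:R * (l == k)%:R) f).
  move=> km ak; elim: j => [|j IH].
    by rewrite expr0 mul1r; under [X in _ <= mass (twist X _)]eq_fun do rewrite mul0r addr0.
  apply: (le_trans IH); clear IH; rewrite exprSr -mulrA.
  apply: ler_wpM2l; first by rewrite exprn_ge0.
  have -> : (fun l => a l + j.+1%:R * (l == k)%:R) =
      fun l => a l + j%:R * (l == k)%:R + (l == k)%:R.
    by apply/funext => l; rewrite -natr1; ring.
  apply: (mass_step km hd af adf f0); first by move=> t; exact: df0.
  by rewrite addr_ge0 // mulr_ge0.
suff main k : (k <= m)%N ->
    mass f <= (3 / 2) ^+ (N * k) * mass (twist (fun l => if (l < k)%N then N%:R else 0) f).
  exact: main.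
elim: k => [|k IH] km.
  rewrite muln0 expr0 mul1r (_ : twist _ _ = f) //.
  by apply/funext => l; apply/funext => t; rewrite /twist mul0r expR0 mul1r.
apply: (le_trans (IH (ltnW km))); clear IH; rewrite mulnS addnC exprD -mulrA.
apply: ler_wpM2l; first by rewrite exprn_ge0.
have -> : (fun l => if (l < k.+1)%N then N%:R else 0) =
    fun l => (if (l < k)%N then N%:R else 0) + N%:R * (l == k)%:R :> R.
  apply/funext => l; rewrite ltnS [(l <= k)%N]leq_eqVlt.
  by case: (ltngtP l k) => lk /=; rewrite ?mulr0 ?addr0 ?mulr1 ?add0r.
by apply: step => //; rewrite ltnn.
Qed.

(* The bound depends only on the last factor, not on the cutoffs [f k], [k < m]. *)
Lemma mass_bound h : cvan m h -> (forall t, 0 <= h t) ->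
  exists2 B : R, 0 <= B & forall f df, f m = h -> der f df -> adm f -> adm df ->
    (forall k t, (k < m)%N -> 0 <= f k t <= 1) -> (forall k t, (k < m)%N -> 0 <= df k t) ->
    mass f <= B.
Proof.
move=> [ch [L hL]] h0.
(* The [- 1] is the weight: [rx m y = expR (- lv m y)]. *)
have cb : cbs (fun t => expR ((spow n - 1) * t) * h t).
  split; first by move=> t; apply: cvgM; [exact: continuous_expZ|exact: ch].
  exists L => t; rewrite ler_normr => /orP[] Lt; rewrite hL ?mulr0 //.
    by right.
  by left; lra.
have [B [_ [B0 _ _ hB]]] := cbs_bounded cb.
exists ((3 / 2) ^+ (m * m) * (B * (2 * (expR L + 1 + 1)) ^+ n)).
  by rewrite mulr_ge0 ?exprn_ge0 // mulr_ge0 // exprn_ge0 // mulr_ge0 // !addr_ge0 // expR_ge0.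
move=> f df fm hd af adf f01 df0.
have f0 j t : (j < n)%N -> 0 <= f j t.
  rewrite ltnS leq_eqVlt => /predU1P[->|jm]; first by rewrite fm.
  by have /andP[] := f01 j t jm.
(* Raising by [m] makes the exponents [spow k.+1 + m] with [k < m] nonnegative; since [lv k <= 0]
   there, these exponentials are at most one. *)
apply: (le_trans (mass_iter m hd af adf f0 df0)).
apply: ler_wpM2l; first by rewrite exprn_ge0.
pose a l : R := if (l < m)%N then m%:R else 0; rewrite -/a.
apply: inth_bound.
- exact/cch_rx_lprod/adm_twist/adm_twist.
- by have := expR_gt0 L; lra.
- move=> y y0 Fy j jn; apply: (norm_le_lvm jn y0); rewrite leNgt; apply/negP => Ly.
  apply: Fy; rewrite (lprod_split _ _ (ltnSn m)) /gs /twist fm hL ?mulr0 ?mul0r ?mulr0 //.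
  by right; split => //; exact: ltW.
- move=> y y0.
  have -> : rx m y * lprod (gs (twist a f)) y =
     (\prod_(0 <= k < m) (expR ((spow k.+1 + a k) * lv k y) * f k (lv k y))) *
     (expR ((spow n - 1) * lv m y) * h (lv m y)).
    rewrite expR_lvm // /lprod big_nat_recr //= mulrCA; congr (_ * _).
      by apply: eq_bigr => k _; rewrite /gs /twist mulrA -expRD -mulrDl.
    rewrite /gs /twist /a ltnn mul0r expR0 mul1r fm mulrA -expRD; congr (expR _ * _).
    by rewrite /=; ring.
  rewrite normrM -[leRHS]mul1r ler_pM //.
  apply: (@le_trans _ _ (\prod_(0 <= k < m) 1)); last by rewrite big1_eq.
  rewrite normr_prod big_nat [leRHS]big_nat.
  apply: ler_prod => k /andP[_ km]; rewrite normr_ge0 /=.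
  have /andP[fk0 fk1] := f01 k (lv k y) km.
  rewrite normrM (gtr0_norm (expR_gt0 _)) (ger0_norm fk0) mulr_ile1 ?expR_ge0 //.
  rewrite -[leRHS]expR0 ler_expR mulr_ge0_le0 ?lv_le0 // /a km /=.
  have := alpha_le0 (ltnW km); have : k%:R <= m%:R :> R by rewrite ler_nat ltnW.
  have : 0 <= k%:R :> R by [].
  by lra.
- exact: B0.
Qed.

End TestFunctions.

(** * Smoothness of the test functions *)

Section Smoothness.
Variables (R : realType) (m : nat).
Local Notation n := m.+1.
Implicit Types (f g : (nat -> R) -> R) (y : nat -> R).

(* A ring of functions on the half-space stable under partial derivatives. *)
Inductive logalg : ((nat -> R) -> R) -> Prop :=
| logalg_cst (c : R) : logalg (fun=> c)
| logalg_coord i : (i < n)%N -> logalg (fun y => y i)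
| logalg_rx k : logalg (rx m k)
| logalg_comp k (F : nat -> R -> R) j :
    (forall j t, is_derive t (1 : R) (F j) (F j.+1 t)) ->
    logalg (fun y => F j (lv m k y))
| logalg_add f g : logalg f -> logalg g -> logalg (fun y => f y + g y)
| logalg_mul f g : logalg f -> logalg g -> logalg (fun y => f y * g y).

Lemma logalg_contn f y : logalg f -> 0 < y 0%N -> contn n f y.
Proof.
move=> hf y0; elim: hf => {f}.
- by move=> c; exact: contn_cst.
- by move=> i in_; exact: contn_coord.
- by move=> k; exact: contn_rx.
- move=> k F j hF; apply: (@contn_comp _ _ (F j)); first exact: contn_lv.
  have [+ _] := hF j (lv m k y).
  by move=> /derivable1_diffP/differentiable_continuous.
- by move=> f g _ hf _ hg; exact: contnD.
- by move=> f g _ hf _ hg; exact: contnM.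
Qed.

Lemma logalg_dlnr i k : (i < n)%N -> logalg (dlnr m i k).
Proof.
move=> in_; rewrite /dlnr; apply: logalg_mul; first exact: logalg_cst.
apply: logalg_mul; last exact: logalg_rx.
by apply: logalg_mul; [exact: logalg_cst|exact: logalg_coord].
Qed.

Lemma logalg_dlv i k : (i < n)%N -> logalg (dlv m i k).
Proof.
move=> in_; rewrite (_ : dlv m i k = fun y => dlnr m i k y + (-1) * dlnr m i k.+1 y).
  apply: logalg_add; first exact: logalg_dlnr.
  by apply: logalg_mul; [exact: logalg_cst|exact: logalg_dlnr].
by apply/funext => y; rewrite mulN1r.
Qed.

Lemma logalg_pd f i : logalg f -> (i < n)%N ->
  exists2 g, logalg g & forall y, 0 < y 0%N -> pd i f y (g y).
Proof.
move=> hf in_; elim: hf => {f}.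
- by move=> c; exists (fun=> 0); [exact: logalg_cst|move=> y _; exact: pd_cst].
- move=> j jn; exists (fun=> (i == j)%:R); first exact: logalg_cst.
  by move=> y _; exact: pd_coord.
- move=> k; exists (fun y => - (i <= k)%:R * (2 * y i * rx m k y ^+ 2)).
    apply: logalg_mul; first exact: logalg_cst.
    apply: logalg_mul; first by apply: logalg_mul; [exact: logalg_cst|exact: logalg_coord].
    by under eq_fun do rewrite expr2; apply: logalg_mul; exact: logalg_rx.
  by move=> y y0; exact: pd_rx.
- move=> k F j hF; exists (fun y => F j.+1 (lv m k y) * dlv m i k y).
    by apply: logalg_mul; [exact: logalg_comp|exact: logalg_dlv].
  by move=> y y0; exact: (pd_comp (pd_lv m i k y0) (hF j (lv m k y))).
- move=> f g _ [df hdf pf] _ [dg hdg pg]; exists (fun y => df y + dg y).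
    exact: logalg_add.
  by move=> y y0; apply: pdD; [exact: pf|exact: pg].
- move=> f g hf [df hdf pf] hg [dg hdg pg].
  exists (fun y => df y * g y + f y * dg y).
    by apply: logalg_add; exact: logalg_mul.
  by move=> y y0; apply: pdM; [exact: pf|exact: pg].
Qed.

Lemma logalg_prod (s : seq nat) (F : nat -> (nat -> R) -> R) :
  (forall k, logalg (F k)) -> logalg (fun y => \prod_(k <- s) F k y).
Proof.
move=> hF; elim: s => [|k s IH].
  by rewrite (_ : (fun y => _) = fun=> 1); [exact: logalg_cst|apply/funext => y; rewrite big_nil].
rewrite (_ : (fun y => _) = fun y => F k y * \prod_(k <- s) F k y).
  exact: logalg_mul.
by apply/funext => y; rewrite big_cons.
Qed.

Variables (d M : R).
Hypotheses (d0 : 0 < d) (M0 : 0 < M).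

Definition boxed f := forall y, 0 < y 0%N -> f y <> 0 -> in_box m d M y.

Lemma boxed_cch f : logalg f -> boxed f -> cch m f.
Proof.
move=> hf bf; split; first by move=> y; exact: logalg_contn.
by exists d, M.
Qed.

Lemma pd_unique i f y (a b : R) : pd i f y a -> pd i f y b -> a = b.
Proof. by move=> [_ <-] [_ <-]. Qed.

(** The box is closed, so near a point outside it [f] is zero along the coordinate line and the
    derivative vanishes. *)
Lemma boxed_pd i f g : (i < n)%N -> boxed f -> (forall y, 0 < y 0%N -> pd i f y (g y)) -> boxed g.
Proof.
move=> in_ bf pf y y0 gy; apply: contrapT => nb; apply: gy.
have near_upd (e : R) : 0 < e -> \forall t \near y i,
    0 < upd y i t 0%N /\ forall j, `|y j - upd y i t j| < e.
  move=> e0; pose e' := Num.min e (y 0%N).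
  have e'0 : 0 < e' by rewrite lt_min e0.
  have : \forall t \near y i, `|y i - t| < e' by exists e'.
  apply: filterS => t; rewrite lt_min => /andP[h1 h2].
  split=> [|j]; rewrite /upd; case: eqP => // ij; rewrite ?ij ?subrr ?normr0 //.
  by rewrite -ij in h2; move: h2; rewrite ltr_norml => /andP[]; lra.
have [e e0 he] : exists2 e : R, 0 < e &
    forall z, (forall j, `|y j - z j| < e) -> ~ in_box m d M z.
  have [yd|yd] := ltP (y 0%N) d.
    exists (d - y 0%N); first by rewrite subr_gt0.
    move=> z /(_ 0%N) yz [dz _]; move: yz; rewrite ltr_norml => /andP[]; lra.
  have [j [jn hj]] : exists j, (j < n)%N /\ M < `|y j|.
    apply: contrapT => h; apply: nb; split => // j jn; rewrite leNgt; apply/negP => hj.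
    by apply: h; exists j.
  exists (`|y j| - M); first by rewrite subr_gt0.
  move=> z /(_ j) yz [_ /(_ j jn) zM].
  by have := ler_normD (y j - z j) (z j); rewrite subrK; lra.
apply: (pd_unique (pf y y0)).
apply: (@near_eq_is_derive _ _ _ (fun=> 0)).
apply: filterS (near_upd e e0) => t [t0 yt].
by apply/esym; apply: contrapT => /(bf _ t0); exact: he.
Qed.

Definition lift f (x : 'rV[R]_n) : R := ext0 f (unvec x).

Lemma lift_vec f y : logalg f -> boxed f -> lift f (vec n y) = ext0 f y.
Proof.
move=> hf bf; apply: (cc_indep (cch_cc (boxed_cch hf bf))) => j jn.
exact: vecK.
Qed.

Lemma is_derive_lift f g (i : 'I_n) x : logalg f -> boxed f ->
  (forall y, 0 < y 0%N -> pd i f y (g y)) ->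
  is_derive x (basis_vec R i) (lift f) (lift g x).
Proof.
move=> hf bf pf; rewrite -{1}(unvecK x); apply/is_derive_vec.
rewrite (_ : (fun z => _) = ext0 f).
  exact: (pd_ext0 (ltn_ord i) (boxed_cch hf bf) pf).
by apply/funext => y; exact: lift_vec.
Qed.

Lemma continuous_lift f : logalg f -> boxed f -> continuous (lift f).
Proof.
move=> hf bf x; apply: (@continuous_unvec _ _ (ext0 f)).
have [h _] := cch_cc (boxed_cch hf bf).
by apply/contnP => e /h[d' d'0 hd']; exists d' => // z; exact: hd'.
Qed.

(** Both [logalg] and [boxed] survive differentiation, so every iterated derivative is again a
    lift. *)
Lemma iter_partial_lift f l : logalg f -> boxed f ->
  exists g, [/\ logalg g, boxed g & iter_partial l (lift f) = lift g].
Proof.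
move=> hf bf; elim: l => [|i l [g [hg bg gE]]]; first by exists f.
have [dg hdg pg] := logalg_pd hg (ltn_ord i).
exists dg; split => //; first exact: boxed_pd pg.
rewrite /= gE; apply/funext => x; rewrite /partial.
by have [_ ->] := is_derive_lift x hg bg pg.
Qed.

(** The support is a closure and the box is closed, so the support stays in it: [M] makes it compact
    and [d > 0] keeps it inside the half-space. *)
Lemma Cc_infty_lift f : logalg f -> boxed f -> Cc_infty_halfspace (lift f).
Proof.
move=> hf bf; have sub : Defs.support (lift f) `<=` [set x | in_box m d M (unvec x)].
  move=> x sx; have key (e : R) : 0 < e ->
      exists2 x' : 'rV[R]_n, in_box m d M (unvec x') & forall j, (j < n)%N ->
      `|unvec x j - unvec x' j| < e.
    move=> e0; have [x' [/= /eqP fx' [_ xx']]] := sx _ (nbhsx_ballx x e e0).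
    exists x'; first by move: fx'; rewrite /lift /ext0; case: ifP => // y0 /(bf _ y0).
    by move=> j jn; rewrite !(unvecE _ (Ordinal jn)); exact: xx'.
  split=> [|j jn]; rewrite leNgt; apply/negP => h.
    have h' : 0 < d - unvec x 0%N by rewrite subr_gt0.
    have [x' [dx' _] /(_ 0%N isT)] := key _ h'.
    by rewrite ltr_norml => /andP[]; lra.
  have h' : 0 < `|unvec x j| - M by rewrite subr_gt0.
  have [x' [_ /(_ j jn) Mx'] /(_ j jn)] := key _ h'.
  by have := ler_normD (unvec x j - unvec x' j) (unvec x' j); rewrite subrK; lra.
split; [split=> [l i x|l]|split].
- have [g [hg bg ->]] := iter_partial_lift l hf bf.
  have [dg hdg pg] := logalg_pd hg (ltn_ord i).
  by have [] := is_derive_lift x hg bg pg.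
- have [g [hg bg ->]] := iter_partial_lift l hf bf.
  exact: continuous_lift.
- have cK : compact [set x : 'rV[R]_n | forall i, `[- M, M]%classic (x ord0 i)].
    apply: (@rV_compact R n (fun=> `[- M, M]%classic)) => i.
    exact: segment_compact.
  apply: subclosed_compact cK _; first exact: closed_closure.
  move=> x /sub [_ hx] i /=; rewrite in_itv /= -ler_norml.
  by have := hx i (ltn_ord i); rewrite unvecE.
- move=> x /sub [dx _]; rewrite /halfspace /=.
  by apply: lt_le_trans d0 _; move: dx; rewrite (unvecE x ord0).
Qed.

End Smoothness.

(** * One-variable cutoffs *)

Section Cutoffs.
Variables (R : realType) (m : nat).
Local Notation n := m.+1.
Implicit Types (c t : R).

Definition cut c t : R := f0 (1 + c * t).
Definition dcut c t : R := c * df0 (1 + c * t).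

Lemma is_derive1D (f g : R -> R) t df dg : is_derive t (1 : R) f df ->
  is_derive t (1 : R) g dg -> is_derive t (1 : R) (fun s => f s + g s) (df + dg).
Proof. by move=> hf hg; exact: is_deriveD. Qed.

Lemma is_derive_affine (F : R -> R) c t d : is_derive (1 + c * t) (1 : R) F d ->
  is_derive t (1 : R) (fun s => F (1 + c * s)) (c * d).
Proof.
move=> hF; have h : is_derive t (1 : R) (fun s => 1 + c * s) (0 + (0 * t + c * 1)).
  have h := is_derive1M (is_derive_cst c t 1) (is_derive_id t 1).
  have h1 : is_derive t (1 : R) (fun=> 1 : R) 0 by exact: is_derive_cst.
  exact: (is_derive1D h1 h).
have := @is_derive1_comp _ F (fun s => 1 + c * s) t _ _ hF h.
by move/is_derive_eq; apply; ring.
Qed.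

Lemma is_derive_cut c t : is_derive t (1 : R) (cut c) (dcut c t).
Proof. by apply: is_derive_affine; exact: is_derive_f0. Qed.

Lemma continuous_cut c : continuous (cut c).
Proof.
move=> t; have [+ _] := is_derive_cut c t.
by move=> /derivable1_diffP/differentiable_continuous.
Qed.

Lemma continuous_dcut c : continuous (dcut c).
Proof.
move=> t; apply: cvgM; first exact: cvg_cst.
have [+ _] := is_derive_affine (is_derive_bump 'X^2 (1 + c * t)).
by move=> /derivable1_diffP/differentiable_continuous.
Qed.

Lemma cut_ge0 c t : 0 <= cut c t.
Proof. exact: f0_ge0. Qed.

Lemma cut_le1 c t : cut c t <= 1.
Proof. exact: f0_le1. Qed.

Lemma cut_eq0 c t : 1 + c * t <= 0 -> cut c t = 0.
Proof. exact: f0_le0. Qed.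

Lemma dcut_eq0 c t : 1 + c * t <= 0 -> dcut c t = 0.
Proof. by move=> h; rewrite /dcut df0_le0 // mulr0. Qed.

Lemma dcut_ge0 c t : 0 <= c -> 0 <= dcut c t.
Proof. by move=> c0; rewrite mulr_ge0 // df0_ge0. Qed.

(** Makes the square of the derivative linear in the derivative, to which [log_identity] applies,
    and gains a factor [c]. *)
Lemma dcut_sqr_le c t : 0 <= c -> dcut c t ^+ 2 <= 2 * c * dcut c t.
Proof.
move=> c0; have h := dcut_ge0 t c0; rewrite expr2 ler_wpM2r // /dcut mulrC.
by rewrite ler_wpM2r // df0_le2.
Qed.

Lemma cut_left c t : 0 < c -> t <= - c^-1 -> 1 + c * t <= 0.
Proof.
move=> c0; rewrite -(ler_pM2l c0) mulrN mulfV ?gt_eqF // => h.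
by rewrite addrC -lerBrDr sub0r.
Qed.

Lemma cut_right c t : 0 < c -> c^-1 <= t -> 1 + - c * t <= 0.
Proof.
move=> c0; rewrite -(ler_pM2l c0) mulfV ?gt_eqF // => h.
by rewrite mulNr subr_le0.
Qed.

Lemma cvan_cut k c : (k < m)%N -> 0 < c -> cvan m k (cut c).
Proof.
move=> km c0; split; first exact: continuous_cut.
exists c^-1 => t [tc|[kE]]; last by rewrite kE ltnn in km.
by apply: cut_eq0; exact: cut_left.
Qed.

Lemma cvan_dcut k c : (k < m)%N -> 0 < c -> cvan m k (dcut c).
Proof.
move=> km c0; split; first exact: continuous_dcut.
exists c^-1 => t [tc|[kE]]; last by rewrite kE ltnn in km.
by apply: dcut_eq0; exact: cut_left.
Qed.

Definition bell c t : R := cut c t * cut (- c) t.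
Definition dbell c t : R := dcut c t * cut (- c) t + cut c t * dcut (- c) t.

Lemma is_derive_bell c t : is_derive t (1 : R) (bell c) (dbell c t).
Proof. exact: is_derive1M (is_derive_cut c t) (is_derive_cut (- c) t). Qed.

Lemma bell_ge0 c t : 0 <= bell c t.
Proof. by rewrite mulr_ge0 // cut_ge0. Qed.

Lemma bell_le1 c t : bell c t <= 1.
Proof. by rewrite mulr_ile1 ?cut_ge0 ?cut_le1. Qed.

Lemma cvan_bell k c : 0 < c -> cvan m k (bell c).
Proof.
move=> c0; split; first by move=> t; apply: cvgM; exact: continuous_cut.
exists c^-1 => t [tc|[_ ct]]; rewrite /bell.
  by rewrite (cut_eq0 (cut_left c0 tc)) mul0r.
by rewrite (cut_eq0 (cut_right c0 ct)) mulr0.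
Qed.

Lemma cvan_dbell k c : 0 < c -> cvan m k (dbell c).
Proof.
move=> c0; split.
  by move=> t; apply: cvgD; apply: cvgM; (exact: continuous_cut || exact: continuous_dcut).
exists c^-1 => t [tc|[_ ct]]; rewrite /dbell.
  by rewrite (cut_eq0 (cut_left c0 tc)) (dcut_eq0 (cut_left c0 tc)) !mul0r addr0.
by rewrite (cut_eq0 (cut_right c0 ct)) (dcut_eq0 (cut_right c0 ct)) !mulr0 addr0.
Qed.

(** A smooth passage from [0] before [-1] to [1] after [1]. The difference of two rescaled copies
    has bounded support although [step] itself has not. *)
Definition step t : R := cut 1 t / (cut 1 t + cut (-1) t).
Definition dstep t : R :=
  (dcut 1 t * cut (-1) t - cut 1 t * dcut (-1) t) / (cut 1 t + cut (-1) t) ^+ 2.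

Lemma step_den t : f0 1 <= cut 1 t + cut (-1) t.
Proof.
case: (leP 0 t) => t0; rewrite /cut.
  by apply: (@le_trans _ _ (f0 (1 + 1 * t))); [apply: f0_homo; lra|rewrite lerDl f0_ge0].
by apply: (@le_trans _ _ (f0 (1 + -1 * t))); [apply: f0_homo; lra|rewrite lerDr f0_ge0].
Qed.

Lemma step_den_gt0 t : 0 < cut 1 t + cut (-1) t.
Proof. by apply: lt_le_trans (step_den t); apply: f0_gt0; exact: ltr01. Qed.

Lemma is_derive_step t : is_derive t (1 : R) step (dstep t).
Proof.
have D0 := step_den_gt0 t; have D1 : cut 1 t + cut (-1) t != 0 by rewrite gt_eqF.
have hD : is_derive t (1 : R) (fun s => cut 1 s + cut (-1) s) (dcut 1 t + dcut (-1) t).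
  exact: is_derive1D (is_derive_cut 1 t) (is_derive_cut (-1) t).
have hV := @is_derive1_comp _ (fun s => s^-1) _ t _ _ (is_derive_inv D1) hD.
have := is_derive1M (is_derive_cut 1 t) hV.
by move/is_derive_eq; apply; rewrite /dstep /=; field.
Qed.

Lemma continuous_dstep : continuous dstep.
Proof.
move=> t; have D0 := step_den_gt0 t; have D1 : cut 1 t + cut (-1) t != 0 by rewrite gt_eqF.
apply: cvgM.
  by apply: cvgB; apply: cvgM; (exact: continuous_cut || exact: continuous_dcut).
have hD : (fun s => (cut 1 s + cut (-1) s) ^+ 2) @ t --> (cut 1 t + cut (-1) t) ^+ 2.
  have h : (fun s => cut 1 s + cut (-1) s) @ t --> cut 1 t + cut (-1) t.
    by apply: cvgD; exact: continuous_cut.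
  exact: (cvg_comp _ _ h (@exprn_continuous R 2 _)).
by apply: cvgV => //; rewrite expf_neq0.
Qed.

Lemma dstep_num_ge0 t : 0 <= dcut 1 t * cut (-1) t - cut 1 t * dcut (-1) t.
Proof.
rewrite /dcut !mul1r mulN1r mulrN opprK addr_ge0 // mulr_ge0 //;
  by rewrite ?df0_ge0 ?cut_ge0.
Qed.

Lemma dstep_num_le t : dcut 1 t * cut (-1) t - cut 1 t * dcut (-1) t <= 4.
Proof.
have h (a b : R) : 0 <= a <= 2 -> 0 <= b <= 1 -> a * b <= 2.
  by move=> /andP[a0 a2] /andP[b0 b1]; nra.
have h1 : dcut 1 t * cut (-1) t <= 2.
  by apply: h; rewrite ?cut_ge0 ?cut_le1 // /dcut mul1r df0_ge0 df0_le2.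
have h2 : - dcut (-1) t * cut 1 t <= 2.
  by apply: h; rewrite ?cut_ge0 ?cut_le1 // /dcut mulN1r opprK df0_ge0 df0_le2.
lra.
Qed.

(** [dbell 1] is the sum of two terms of opposite signs and the numerator [N] of [dstep] is their
    difference, so [|dbell 1| <= N]. The constant is [4 * 4], from [N <= 4] and a squared
    denominator at most [4]. *)
Lemma dbell1_sqr_le t : dbell 1 t ^+ 2 <= 16 * dstep t.
Proof.
set N := dcut 1 t * cut (-1) t - cut 1 t * dcut (-1) t.
have N0 : 0 <= N := dstep_num_ge0 t.
have N4 : N <= 4 := dstep_num_le t.
have D0 := step_den_gt0 t.
have D2 : cut 1 t + cut (-1) t <= 2.
  by have := cut_le1 1 t; have := cut_le1 (-1) t; lra.
have h : dbell 1 t ^+ 2 <= N ^+ 2.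
  have a0 : 0 <= dcut 1 t * cut (-1) t.
    by rewrite mulr_ge0 ?cut_ge0 // dcut_ge0.
  have b0 : cut 1 t * dcut (-1) t <= 0.
    by rewrite mulr_ge0_le0 ?cut_ge0 // /dcut mulN1r oppr_le0 df0_ge0.
  by rewrite /dbell /N; move: a0 b0; nra.
apply: (le_trans h); apply: (@le_trans _ _ (4 * N)); first by rewrite expr2 ler_wpM2r.
rewrite /dstep -/N mulrA ler_pdivlMr ?exprn_gt0 //.
have : (cut 1 t + cut (-1) t) ^+ 2 <= 4 by nra.
by move: (_ ^+ 2) => x x4; nra.
Qed.

Lemma dbellE c t : dbell c t = c * dbell 1 (c * t).
Proof. by rewrite /dbell /dcut /cut mul1r !mulN1r !mulNr mul1r; ring. Qed.

Lemma step_le t : t <= -1 -> step t = 0.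
Proof. by move=> t1; rewrite /step cut_eq0 ?mul0r //; lra. Qed.

Lemma step_ge t : 1 <= t -> step t = 1.
Proof.
move=> t1; have := step_den_gt0 t; rewrite /step (@cut_eq0 (-1)) ?addr0; last by lra.
by move=> c0; rewrite mulfV // gt_eqF.
Qed.

Lemma dstep_out t : 1 <= `|t| -> dstep t = 0.
Proof.
rewrite ler_normr /dstep => /orP[] h.
  by rewrite (@cut_eq0 (-1)) ?(@dcut_eq0 (-1)) ?(mulr0, subr0, mul0r) //; lra.
by rewrite (@dcut_eq0 1) ?(@cut_eq0 1) ?(mul0r, subr0) //; lra.
Qed.

(* Majorises [dstep], which is not differentiated here, by a function to which
   [mass_bound] applies. *)
Lemma dstep_le_bell : exists2 C : R, 0 <= C & forall t, dstep t <= C * bell 2^-1 t.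
Proof.
have z0 : 0 < f0 (2^-1 : R) by apply: f0_gt0; rewrite invr_gt0.
have w0 : 0 < f0 (1 : R) by apply: f0_gt0; exact: ltr01.
have C0 : 0 <= 4 / f0 (1 : R) ^+ 2 / f0 (2^-1 : R) ^+ 2.
  by rewrite !divr_ge0 // exprn_ge0 // ltW.
exists (4 / f0 1 ^+ 2 / f0 2^-1 ^+ 2) => // t.
case: (leP 1 `|t|) => ht; first by rewrite dstep_out // mulr_ge0 // bell_ge0.
move: ht; rewrite ltr_norml => /andP[t1 t2].
have hb : f0 2^-1 ^+ 2 <= bell 2^-1 t.
  by rewrite expr2 /bell /cut ler_pM ?f0_ge0 //; apply: f0_homo; lra.
apply: (@le_trans _ _ (4 / f0 1 ^+ 2)).
  rewrite /dstep ler_pM ?dstep_num_ge0 ?dstep_num_le //.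
    by rewrite invr_ge0 exprn_ge0 // ltW // step_den_gt0.
  have D := step_den t.
  by rewrite lef_pV2 ?posrE ?exprn_gt0 ?step_den_gt0 // ler_pXn2r // nnegrE ltW // step_den_gt0.
rewrite -[leLHS]mulr1 -[_ / _ / _ * _]mulrA; apply: ler_wpM2l.
  by rewrite divr_ge0 // exprn_ge0 // ltW.
by rewrite mulrC ler_pdivlMr ?exprn_gt0 // mul1r.
Qed.

End Cutoffs.

(** * Smallness of the terms of the defect when the last [alpha] is zero *)

Section Optimality.
Variables (R : realType) (m : nat) (alpha : nat -> R).
Hypothesis alpha_le0 : forall i, (i < m.+1)%N -> alpha i <= 0.
Hypothesis alpha_m0 : alpha m = 0.
Local Notation n := m.+1.
Local Notation spow := (spow alpha).
Local Notation inth := (inth m).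
Local Notation cch := (cch m).
Local Notation lprod := (lprod m).
Local Notation adm := (adm m).
Local Notation cvan := (cvan m).
Local Notation rx := (rx m).
Local Notation lv := (lv m).
Local Notation der := (der m).
Local Notation mass := (mass m alpha).
Local Notation gs := (gs alpha).
Local Notation hgs := (hgs alpha).
Implicit Types (y : nat -> R) (e : nat -> R) (f df : nat -> R -> R) (h : R -> R).

Definition chi e k : R -> R := if (k < m)%N then cut (e k) else bell (e k).
Definition dchi e k : R -> R := if (k < m)%N then dcut (e k) else dbell (e k).

Definition scales e := forall k, (k < n)%N -> 0 < e k <= 1.

Lemma der_chi e : der (chi e) (dchi e).
Proof.
move=> k t kn; rewrite /chi /dchi; case: ifP => _.
  exact: is_derive_cut.
exact: is_derive_bell.
Qed.

Lemma adm_chi e : scales e -> adm (chi e).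
Proof.
move=> he k kn; have /andP[e0 _] := he k kn; rewrite /chi; case: ifP => km.
  exact: cvan_cut.
exact: cvan_bell.
Qed.

Lemma adm_dchi e : scales e -> adm (dchi e).
Proof.
move=> he k kn; have /andP[e0 _] := he k kn; rewrite /dchi; case: ifP => km.
  exact: cvan_dcut.
exact: cvan_dbell.
Qed.

Lemma chi_ge0 e k t : 0 <= chi e k t.
Proof. by rewrite /chi; case: ifP => _; [exact: cut_ge0|exact: bell_ge0]. Qed.

Lemma chi_le1 e k t : chi e k t <= 1.
Proof. by rewrite /chi; case: ifP => _; [exact: cut_le1|exact: bell_le1]. Qed.

Definition dsqf f df : nat -> R -> R := fun k t => 2 * (f k t * df k t).

Lemma der_sqf f df : der f df -> der (sqf f) (dsqf f df).
Proof.
move=> hd k t kn; have h := is_derive1M (hd k t kn) (hd k t kn).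
rewrite (_ : sqf f k = fun s => f k s * f k s).
  by apply: is_derive_eq h _; rewrite /dsqf; ring.
by apply/funext => s; rewrite /sqf expr2.
Qed.

Lemma adm_sqf f : adm f -> adm (sqf f).
Proof.
move=> hf k kn; rewrite (_ : sqf f k = fun s => f k s * f k s).
  by apply: cvanM; [exact: hf|exact: (hf k kn).1].
by apply/funext => s; rewrite /sqf expr2.
Qed.

Lemma adm_dsqf f df : adm f -> adm df -> adm (dsqf f df).
Proof.
move=> hf hdf k kn; apply: cvanZ; apply: cvanM; first exact: hdf.
exact: (hf k kn).1.
Qed.

Lemma der_upf f df k h dh : der f df -> (forall t, is_derive t (1 : R) h (dh t)) ->
  der (upf f k h) (upf df k dh).
Proof. by move=> hd hh j t jn; rewrite /upf; case: eqP => _; [exact: hh|exact: hd]. Qed.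

Lemma upf_at f k h : upf f k h k = h.
Proof. by rewrite /upf eqxx. Qed.

Lemma upf_other f k h j : j != k -> upf f k h j = f j.
Proof. by rewrite /upf => /negbTE ->. Qed.

Lemma sqf_upf f k h : sqf (upf f k h) = upf (sqf f) k (fun t => h t ^+ 2).
Proof. by apply/funext => j; apply/funext => t; rewrite /sqf /upf; case: eqP. Qed.

Lemma le_mass_upf f k h h' : (k < n)%N -> adm f -> cvan k h -> cvan k h' ->
  (forall j t, (j < n)%N -> 0 <= f j t) -> (forall t, h t <= h' t) ->
  mass (upf f k h) <= mass (upf f k h').
Proof.
move=> kn af ch ch' f0 hh; apply: le_inth.
- exact/cch_rx_lprod/adm_twist/adm_upf.
- exact/cch_rx_lprod/adm_twist/adm_upf.
- move=> y y0; rewrite ler_wpM2l ?rx_ge0 //.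
  exact: le_lprod_gs_upf.
Qed.

Lemma massZ f k h (c : R) : (k < n)%N -> adm f -> cvan k h ->
  mass (upf f k (fun t => c * h t)) = c * mass (upf f k h).
Proof.
move=> kn af ch; rewrite -inthZ; last exact/cch_rx_lprod/adm_twist/adm_upf.
apply: eq_inth => y y0; rewrite !lprod_gs_upf //; ring.
Qed.

(* The identity in the last variable, for [step (c * t) - step t]: the mass of
   [dstep (c * t)] is inversely proportional to [c]. *)
Lemma mass_dstep f df (c : R) : 0 < c <= 1 -> der f df -> adm f -> adm df ->
  c * mass (upf f m (fun t => dstep (c * t))) = mass (upf f m (@dstep R)).
Proof.
move=> /andP[c0 c1] hd af adf; have mn := ltnSn m.
have gen (a b : R) : 4 * (a - b) = 0 -> a = b by lra.
have cc : continuous (fun t => dstep (c * t)).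
  move=> t; have h : (fun s : R => c * s) @ t --> c * t.
    by apply: cvgM; [exact: cvg_cst|exact: cvg_id].
  exact: (cvg_comp _ _ h (@continuous_dstep R _)).
have scale (t : R) : t <= - c^-1 \/ m = m /\ c^-1 <= t -> 1 <= `|c * t| /\ 1 <= `|t|.
  have i1 : 1 <= c^-1 by rewrite -invr1 lef_pV2 ?posrE.
  have key (s : R) : c^-1 <= s -> 1 <= c * s /\ 1 <= s.
    by move=> h; split; [rewrite -ler_pdivrMl // mulr1|lra].
  rewrite !ler_normr; case=> [h|[_ /key [-> ->]] //].
  by have := key (- t); rewrite lerNr mulrN => /(_ h) [-> ->]; rewrite !orbT.
have v1 : cvan m (fun t => dstep (c * t)).
  by split => //; exists c^-1 => t /scale [h _]; exact: dstep_out.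
have v2 : cvan m (@dstep R).
  split; first exact: continuous_dstep.
  by exists c^-1 => t /scale [_ h]; exact: dstep_out.
pose h t := step (c * t) - step t.
pose dh t := c * dstep (c * t) + - 1 * dstep t.
have dhE t : is_derive t (1 : R) h (dh t).
  have hc : is_derive t (1 : R) (fun s => c * s) c.
    have := is_derive1M (is_derive_cst c t 1) (is_derive_id t 1).
    by move/is_derive_eq; apply; rewrite /=; ring.
  have h1 := @is_derive1_comp _ _ (fun s => c * s) t _ _ (is_derive_step (c * t)) hc.
  have h2 := is_derive1M (is_derive_cst (-1 : R) t 1) (is_derive_step t).
  have := is_derive1D h1 h2.
  rewrite (_ : (fun s => _) = h); last by apply/funext => s; rewrite /h /= mulN1r.
  by move/is_derive_eq; apply; rewrite /dh /=; ring.
have ch : continuous h.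
  by move=> t; have [+ _] := dhE t; move=> /derivable1_diffP/differentiable_continuous.
have vh : cvan m h.
  split => //; exists c^-1 => t ht; have i1 : 1 <= c^-1 by rewrite -invr1 lef_pV2 ?posrE.
  rewrite /h; case: ht => [ht|[_ ht]].
    rewrite !step_le ?subrr //; first by lra.
    by rewrite -(ler_pM2l c0) mulrN mulfV ?gt_eqF // in ht.
  rewrite !step_ge ?subrr //; first by lra.
  by rewrite -ler_pdivrMl // mulr1.
have vdh : cvan m dh by apply: cvanD; exact: cvanZ.
have := log_identity alpha mn (der_upf m hd dhE) (adm_upf af vh) (adm_upf adf vdh).
(* Here [alpha m = 0] enters: the undifferentiated term drops out, and the right side of the
   identity vanishes with [rx m.+1]. *)
rewrite !upf_at alpha_m0.
have -> : inth (fun y => rx m.+1 y * lprod (gs (upf f m h)) y) = 0.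
  by rewrite -[RHS](inth0 R m); apply: eq_inth => y y0; rewrite {1}/rx ltnn mul0r.
rewrite mulr0.
have -> : inth (fun y => (rx m y - rx m.+1 y) * lprod (gs (upf (upf f m h) m
    (fun t => 4 * (dh t - 0 * h t)))) y) =
  4 * (c * mass (upf f m (fun t => dstep (c * t))) - mass (upf f m (@dstep R))).
  have i1 := cch_rx_lprod m (adm_twist (fun k => spow k.+1) (adm_upf af (cvanZ c v1))).
  have i2 := cch_rx_lprod m (adm_twist (fun k => spow k.+1) (adm_upf af v2)).
  rewrite -massZ // -inthB // -inthZ; last exact: cchB.
  apply: eq_inth => y y0; rewrite (_ : rx m.+1 y = 0); last by rewrite /rx ltnn.
  have -> : upf (upf f m h) m (fun t => 4 * (dh t - 0 * h t)) =
      upf f m (fun t => 4 * (dh t - 0 * h t)).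
    by apply/funext => j; rewrite /upf; case: eqP.
  rewrite (lprod_gs_upf alpha f (fun t => 4 * (dh t - 0 * h t)) y mn).
  rewrite (lprod_gs_upf alpha f (fun t => c * dstep (c * t)) y mn).
  rewrite (lprod_gs_upf alpha f (@dstep R) y mn).
  by move: (expR _ * _) => Z; rewrite /dh; ring.
exact: gen.
Qed.

Definition chi_term e k := inth (fun y => 4 * (rx k y - rx k.+1 y) *
  lprod (gs (upf (sqf (chi e)) k (fun t => dchi e k t ^+ 2))) y).

Lemma cvan_dchi_sqr e k : (k < n)%N -> scales e -> cvan k (fun t => dchi e k t ^+ 2).
Proof. by move=> kn he; exact: (adm_sqf (adm_dchi he) kn). Qed.

Lemma cch_chi_term e k : (k < n)%N -> scales e -> cch (fun y => 4 * (rx k y - rx k.+1 y) *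
  lprod (gs (upf (sqf (chi e)) k (fun t => dchi e k t ^+ 2))) y).
Proof.
move=> kn he; apply: cchM; last first.
  by move=> y y0; apply: contnM; [exact: contn_cst|apply: contnB; exact: contn_rx].
apply/cch_lprod/adm_twist/adm_upf; last exact: cvan_dchi_sqr.
exact/adm_sqf/adm_chi.
Qed.

Lemma defect_int_chi e : scales e ->
  defect_int m alpha (lprod (hgs (chi e))) (dhgs m alpha (chi e) (dchi e)) =
  \sum_(k < n) chi_term e k.
Proof.
move=> he; rewrite -(@inth_sum _ _ _ _ _ (fun (k : 'I_n) y => 4 * (rx k y - rx k.+1 y) *
  lprod (gs (upf (sqf (chi e)) k (fun t => dchi e k t ^+ 2))) y)).
  apply: eq_inth => y y0; rewrite sum_defect_sqr //.
  by apply: eq_bigr => k _; rewrite sqf_upf.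
by move=> k _; exact: cch_chi_term.
Qed.

Lemma sqf_chi_ge0 e j t : 0 <= sqf (chi e) j t.
Proof. exact: sqr_ge0. Qed.

(** The square of [dbell] at scale [c] brings [c ^ 2], while by [mass_dstep] the mass of
    [dstep (c * t)] is proportional to [1 / c]; one factor [c] survives. The 64 is the 4 of
    [chi_term] times the 16 of [dbell1_sqr_le]. *)
Lemma last_term_bound : exists2 B : R, 0 <= B & forall e, scales e -> chi_term e m <= e m * B.
Proof.
have mn := ltnSn m; have h0 : 0 < (2^-1 : R) by rewrite invr_gt0.
have [C C0 hC] := @dstep_le_bell R.
have [B B0 hB] := mass_bound alpha_le0 (@cvan_bell R m m 2^-1 h0) (bell_ge0 _).
exists (64 * (C * B)); first by rewrite !mulr_ge0.
move=> e he; have /andP[c0 c1] := he m mn; set c := e m in c0 c1 *.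
have gen (a b : R) : a <= 16 * c ^+ 2 * b -> 4 * a <= 64 * c * (c * b) by rewrite expr2; lra.
have af := adm_sqf (adm_chi he).
have adf := adm_dsqf (adm_chi he) (adm_dchi he).
have hd := der_sqf (der_chi e).
have cc : continuous (fun t => dstep (c * t)).
  move=> t; have h : (fun s : R => c * s) @ t --> c * t.
    by apply: cvgM; [exact: cvg_cst|exact: cvg_id].
  exact: (cvg_comp _ _ h (@continuous_dstep R _)).
have v1 : cvan m (fun t => dstep (c * t)).
  split => //; exists c^-1 => t ht; apply: dstep_out; rewrite ler_normr.
  case: ht => [ht|[_ ht]].
    apply/orP; right; rewrite -mulrN -ler_pdivrMl // mulr1; lra.
  by apply/orP; left; rewrite -ler_pdivrMl // mulr1.
have v2 : cvan m (@dstep R).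
  split; first exact: continuous_dstep.
  exists 1 => t ht; apply: dstep_out; rewrite ler_normr.
  by case: ht => [ht|[_ ->] //]; apply/orP; right; lra.
have vb := @cvan_bell R m m 2^-1 h0.
have -> : chi_term e m = 4 * mass (upf (sqf (chi e)) m (fun t => dchi e m t ^+ 2)).
  rewrite -inthZ; last exact/cch_rx_lprod/adm_twist/adm_upf/cvan_dchi_sqr.
  by apply: eq_inth => y y0; rewrite {2}/rx ltnn subr0 mulrA.
have h1 : mass (upf (sqf (chi e)) m (fun t => dchi e m t ^+ 2)) <=
   mass (upf (sqf (chi e)) m (fun t => 16 * c ^+ 2 * dstep (c * t))).
  apply: le_mass_upf => //.
  - exact: cvan_dchi_sqr.
  - exact: cvanZ.
  - by move=> j t _; exact: sqf_chi_ge0.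
  move=> t; rewrite /dchi ltnn dbellE exprMn.
  have -> : 16 * c ^+ 2 * dstep (c * t) = c ^+ 2 * (16 * dstep (c * t)) by ring.
  by rewrite ler_wpM2l ?sqr_ge0 // dbell1_sqr_le.
rewrite massZ // in h1.
have h2 := mass_dstep (he m mn) hd af adf; rewrite -/c in h2.
have h3 : mass (upf (sqf (chi e)) m (@dstep R)) <=
   mass (upf (sqf (chi e)) m (fun t => C * bell 2^-1 t)).
  apply: le_mass_upf => //; first exact: cvanZ.
  by move=> j t _; exact: sqf_chi_ge0.
rewrite massZ // in h3.
have h4 : mass (upf (sqf (chi e)) m (bell 2^-1)) <= B.
  apply: (hB _ (upf (dsqf (chi e) (dchi e)) m (dbell 2^-1))).
  - by rewrite upf_at.
  - by apply: der_upf => // t; exact: is_derive_bell.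
  - exact: adm_upf.
  - by apply: adm_upf => //; exact: cvan_dbell.
  - move=> k t km; rewrite upf_other ?ltn_eqF // sqf_chi_ge0 /=.
    by rewrite /sqf expr_le1 // ?chi_le1 ?chi_ge0.
  - move=> k t km; rewrite upf_other ?ltn_eqF // /dsqf mulr_ge0 // mulr_ge0 ?chi_ge0 //.
    by rewrite /dchi km dcut_ge0 // ltW //; have /andP[] := he k (ltnW km).
have h5 : mass (upf (sqf (chi e)) m (@dstep R)) <= C * B.
  by apply: (le_trans h3); rewrite ler_wpM2l.
have : 4 * mass (upf (sqf (chi e)) m (fun t => dchi e m t ^+ 2)) <=
   64 * c * (c * mass (upf (sqf (chi e)) m (fun t => dstep (c * t)))).
  exact: gen h1.
rewrite h2 => /le_trans; apply.
have -> : c * (64 * (C * B)) = 64 * c * (C * B) by ring.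
by rewrite ler_wpM2l // mulr_ge0 // ltW.
Qed.

Lemma rx_sum_lv k y : (k <= m)%N -> 0 < y 0%N ->
  rx m y = rx k y * expR (\sum_(k <= l < m) lv l y).
Proof.
move=> km y0; have [j jE] : exists j, (m - k = j)%N by exists (m - k)%N.
elim: j k km jE => [|j IH] k km jE.
  have -> : k = m by apply/eqP; rewrite eqn_leq km -subn_eq0 jE.
  by rewrite big_geq // expR0 mulr1.
have km' : (k < m)%N by rewrite -subn_gt0 jE.
rewrite (IH k.+1 km' _) ?subnS ?jE // -rx_expR // -mulrA -expRD.
by rewrite [in RHS]big_ltn.
Qed.

(** [log_identity] turns the derivative of the cutoff into mass with the weight [rx k.+1]. Passing
    to [rx m] costs the exponential, because [lv l >= - 1 / e l] on the support, and [mass_bound]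
    then gives a [B] that depends on the last scale alone. *)
Lemma term_bound (c : R) : 0 < c <= 1 -> exists2 B : R, 0 <= B &
  forall e k, scales e -> e m = c -> (k < m)%N ->
  chi_term e k <= 4 * e k * expR (\sum_(k.+1 <= l < m) (e l)^-1) * B.
Proof.
move=> /andP[c0 c1]; have mn := ltnSn m.
have vb : cvan m (fun t => bell c t ^+ 2).
  rewrite (_ : (fun t => _) = fun t => bell c t * bell c t).
    by apply: cvanM; [exact: cvan_bell|exact: (@cvan_bell R m m c c0).1].
  by apply/funext => t; rewrite expr2.
have [B B0 hB] := mass_bound alpha_le0 vb (fun t => sqr_ge0 (bell c t)).
have gen (a x w z : R) : 0 <= a * (- w * z) -> x ^+ 2 <= 2 * a * x ->
    4 * x ^+ 2 <= 2 * a * (4 * (x - w * z)) by lra.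
exists B => // e k he ec km; have kn : (k < n)%N := ltnW km.
have /andP[e0 e1] := he k kn.
have af := adm_sqf (adm_chi he).
have adf := adm_dsqf (adm_chi he) (adm_dchi he).
have hd := der_sqf (der_chi e).
have vc := cvan_cut km e0; have vdc := cvan_dcut km e0.
(* [chi_term] overwrites factor [k] anyway, so [cut (e k)] may stand there: by [dcut_sqr_le] its
   derivative times [2 * e k] dominates [dchi e k ^ 2]. *)
pose f := upf (sqf (chi e)) k (cut (e k)).
pose df := upf (dsqf (chi e) (dchi e)) k (dcut (e k)).
have aF : adm f := adm_upf af vc.
have aDF : adm df := adm_upf adf vdc.
have hF : der f df := der_upf k hd (is_derive_cut (e k)).
have f01 j t : 0 <= f j t <= 1.
  rewrite /f /upf; case: eqP => _; first by rewrite cut_ge0 cut_le1.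
  by rewrite sqf_chi_ge0 /= /sqf expr_le1 // ?chi_le1 ?chi_ge0.
have fge0 j t : (j < n)%N -> 0 <= f j t by move=> _; have /andP[] := f01 j t.
have id := log_identity alpha kn hF aF aDF.
have fE h : upf f k h = upf (sqf (chi e)) k h.
  by apply/funext => j; rewrite /f /upf; case: eqP.
pose h t := 4 * (df k t - alpha k * f k t).
have vh : cvan k h.
  apply: cvanZ; under eq_fun do rewrite -mulNr.
  by apply: cvanD; [exact: aDF|apply: cvanZ; exact: aF].
have c2 := cch_rx_lprod k.+1 (adm_twist (fun k => spow k.+1) aF).
have h1 : chi_term e k <= 2 * e k * (2 * inth (fun y => rx k.+1 y * lprod (gs f) y)).
  rewrite -id -inthZ; last first.
    apply: cchM; first exact/cch_lprod/adm_twist/adm_upf.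
    by move=> y y0; apply: contnB; exact: contn_rx.
  apply: le_inth.
  - exact: cch_chi_term.
  - apply: cchZ; apply: cchM; first exact/cch_lprod/adm_twist/adm_upf.
    by move=> y y0; apply: contnB; exact: contn_rx.
  move=> y y0; rewrite -fE !lprod_gs_upf // -/h.
  set Z := expR _ * _; have Z0 : 0 <= Z by exact: cofactor_ge0.
  set r := rx k y - _; have r0 : 0 <= r by rewrite subr_ge0 rx_decr.
  have -> : 2 * e k * (r * (h (lv k y) * Z)) = r * ((2 * e k * h (lv k y)) * Z) by ring.
  have -> : 4 * r * (dchi e k (lv k y) ^+ 2 * Z) = r * ((4 * dchi e k (lv k y) ^+ 2) * Z) by ring.
  rewrite ler_wpM2l // ler_wpM2r // /h /df upf_at /dchi km.
  have hs := dcut_sqr_le (lv k y) (ltW e0).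
  have hc : 0 <= - alpha k * f k (lv k y).
    by rewrite mulr_ge0 ?fge0 // oppr_ge0 alpha_le0.
  exact: gen (mulr_ge0 (ltW e0) hc) hs.
have h2 : inth (fun y => rx k.+1 y * lprod (gs f) y) <=
   expR (\sum_(k.+1 <= l < m) (e l)^-1) * mass f.
  rewrite -inthZ; last exact/cch_rx_lprod/adm_twist.
  apply: le_inth => //; first by apply: cchZ; exact/cch_rx_lprod/adm_twist.
  move=> y y0; have [p0|p0] := eqVneq (lprod (gs f) y) 0; first by rewrite p0 !mulr0.
  rewrite mulrA ler_wpM2r //.
    by apply: lprod_ge0 => j t jn; rewrite mulr_ge0 ?expR_ge0 ?fge0.
  rewrite (rx_sum_lv km y0) mulrCA -expRD ler_peMr ?rx_ge0 //.
  rewrite -[leLHS]expR0 ler_expR -big_split /= big_nat; apply: sumr_ge0 => l /andP[kl lm].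
  have ln : (l < n)%N := ltnW lm.
  have /andP[el0 _] := he l ln.
  have : gs f l (lv l y) <> 0 by apply: lprod_neq0 => //; exact/eqP.
  rewrite -[(e l)^-1]opprK addrC subr_ge0 leNgt => nz; apply/negP => lt; apply: nz.
  rewrite /gs /twist /f upf_other ?gtn_eqF // /sqf /chi lm cut_eq0 ?expr0n ?mulr0 //.
  by apply: cut_left => //; exact: ltW.
have h3 : mass f <= B.
  apply: (hB f df) => //.
  - rewrite /f upf_other ?gtn_eqF //; apply/funext => t.
    by rewrite /sqf /chi ltnn ec.
  - move=> j t jm; rewrite /df /upf; case: eqP => _; first exact: dcut_ge0 (ltW e0).
    rewrite /dsqf mulr_ge0 // mulr_ge0 ?chi_ge0 //.
    by rewrite /dchi jm dcut_ge0 // ltW //; have /andP[] := he j (ltnW jm).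
apply: (le_trans h1).
have h4 : inth (fun y => rx k.+1 y * lprod (gs f) y) <=
    expR (\sum_(k.+1 <= l < m) (e l)^-1) * B.
  by apply: (le_trans h2); rewrite ler_wpM2l ?expR_ge0.
have -> : 4 * e k * expR (\sum_(k.+1 <= l < m) (e l)^-1) * B =
   2 * e k * (2 * (expR (\sum_(k.+1 <= l < m) (e l)^-1) * B)) by ring.
by rewrite ler_wpM2l ?ler_wpM2l // mulr_ge0 // ltW.
Qed.

End Optimality.

(** * Choice of the scales and the contradiction *)

Section Counterexample.
Variables (R : realType) (m : nat) (alpha : nat -> R).
Hypothesis m2 : (2 <= m)%N.
Hypothesis alpha_le0 : forall i, (i < m.+1)%N -> alpha i <= 0.
Hypothesis alpha_m0 : alpha m = 0.
Local Notation n := m.+1.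
Local Notation scales := (@scales R m).
Local Notation chi := (@chi R m).
Local Notation dchi := (@dchi R m).
Local Notation lprod := (lprod m).
Local Notation hgs := (hgs alpha).
Implicit Types (y : nat -> R) (e : nat -> R).

(** The condition on [e k] otherwise involves only scales of larger index, so they are chosen
    downwards from [e m = c]; [j] counts those already fixed below [m]. *)
Lemma choose_scales (B s c : R) : 0 <= B -> 0 < s -> 0 < c <= 1 ->
  exists e, [/\ scales e, e m = c & forall k, (k < m)%N ->
    4 * e k * expR (\sum_(k.+1 <= l < m) (e l)^-1) * B <= s].
Proof.
move=> B0 s0 hc.
suff main j : (j <= m)%N -> exists e, e m = c /\ forall k, (m - j <= k < m)%N ->
    0 < e k <= 1 /\ 4 * e k * expR (\sum_(k.+1 <= l < m) (e l)^-1) * B <= s.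
  have [e [em he]] := main m (leqnn m); exists e; split => //.
    move=> k; rewrite ltnS leq_eqVlt => /predU1P[->|km]; first by rewrite em.
    by have [] := he k; rewrite ?subnn.
  by move=> k km; have [] := he k; rewrite ?subnn.
elim: j => [|j IH] jm.
  exists (fun=> c); split => // k; rewrite subn0 => /andP[mk km].
  by have := leq_trans km mk; rewrite ltnn.
have [e [em he]] := IH (ltnW jm); pose k0 := (m - j.+1)%N.
have k0m : (k0 < m)%N by rewrite /k0 ltn_subrL /= (leq_trans _ jm).
(* The [+ 1] keeps [D] positive when [B] is zero. *)
pose D : R := 4 * expR (\sum_(k0.+1 <= l < m) (e l)^-1) * B + 1.
have D1 : 1 <= D by rewrite lerDr !mulr_ge0 // expR_ge0.
have D0 : 0 < D by lra.
pose x := Num.min 1 (s / D).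
have x0 : 0 < x by rewrite lt_min ltr01 divr_gt0.
exists (fun l => if l == k0 then x else e l).
split; first by rewrite gtn_eqF.
have sumE k : (k0 <= k)%N -> \sum_(k.+1 <= l < m) (if l == k0 then x else e l)^-1 =
    \sum_(k.+1 <= l < m) (e l)^-1.
  by move=> k0k; apply: eq_big_nat => l /andP[kl _]; rewrite gtn_eqF // (leq_ltn_trans k0k).
move=> k; rewrite -/k0 leq_eqVlt => /andP[/predU1P[<-|k0k] km].
  rewrite eqxx sumE //; split; first by rewrite x0 /x ge_min lexx.
  have xD : x * D <= s by rewrite -ler_pdivlMr // /x ge_min lexx orbT.
  apply: le_trans xD; rewrite /D mulrDr mulr1.
  have -> : 4 * x * expR (\sum_(k0.+1 <= l < m) (e l)^-1) * B =
    x * (4 * expR (\sum_(k0.+1 <= l < m) (e l)^-1) * B) by ring.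
  by rewrite lerDl ltW.
rewrite gtn_eqF // sumE ?(ltnW k0k) //; apply: he; rewrite km andbT.
by move: k0k; rewrite /k0 -subSn // subSS.
Qed.

(** A minorant of every [chi e] at the values of [lv k]: for [k < m] because [lv k <= 0] and
    [e k <= 1], for [k = m] because [|e m * t| <= |t|]. It keeps the critical integral away from
    zero while the scales shrink. *)
Definition low k : R -> R := if (k < m)%N then cut 1 else fun t => f0 (1 - `|t|) ^+ 2.

Lemma adm_low : adm m low.
Proof.
move=> k kn; rewrite /low; case: ifP => km; first exact: (cvan_cut km ltr01).
have cf : continuous (fun t : R => f0 (1 - `|t|)).
  move=> t; have h : (fun s : R => 1 - `|s|) @ t --> 1 - `|t|.
    by apply: cvgB; [exact: cvg_cst|exact: norm_continuous].
  exact: (cvg_comp _ _ h (@continuous_bump R 1 _)).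
split.
  move=> t; exact: (cvg_comp _ _ (cf t) (@exprn_continuous R 2 _)).
exists 1 => t ht; have : 1 <= `|t|.
  by rewrite ler_normr; case: ht => [ht|[_ ->] //]; apply/orP; right; lra.
by move=> h; rewrite f0_le0 ?expr0n // subr_le0.
Qed.

Lemma low_ge0 k t : 0 <= low k t.
Proof. by rewrite /low; case: ifP => _; [exact: cut_ge0|exact: sqr_ge0]. Qed.

Lemma low_le_chi e k y : scales e -> (k < n)%N -> 0 < y 0%N ->
  low k (lv m k y) <= chi e k (lv m k y).
Proof.
move=> he kn y0; have /andP[e0 e1] := he k kn; rewrite /low /chi; case: ifP => km.
  by apply: f0_homo; have := lv_le0 km y0; nra.
move: (lv m k y) => t.
have key : - `|t| <= e k * t <= `|t|.
  by rewrite -ler_norml normrM (gtr0_norm e0) ler_piMl.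
rewrite expr2 /bell /cut; move/andP: key => [k1 k2].
by apply: ler_pM; rewrite ?f0_ge0 //; apply: f0_homo; lra.
Qed.

Lemma lprod_hgs_ge0 g y : (forall k t, 0 <= g k t) -> 0 <= lprod (hgs g) y.
Proof. by move=> g0; apply: lprod_ge0 => k t _; rewrite mulr_ge0 ?expR_ge0. Qed.

Lemma crit_int_low_gt0 : 0 < crit_int m (lprod (hgs low)).
Proof.
(* At the first unit vector all [rho k] equal one and all [lv k] vanish, so every factor is
   positive. *)
pose y (j : nat) : R := (j == 0%N)%:R.
have y0 : 0 < y 0%N by rewrite /y ltr01.
have hr k : rho k y = 1.
  elim: k => [|k IH]; first by rewrite /rho big_nat1 /y expr1n.
  by rewrite rhoS IH /y /= expr0n addr0.
have hl k : lv m k y = 0 by rewrite /lv /lnr !hr ln1 !if_same subrr.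
apply: (@inth_gt0 _ _ _ y) => //.
- by apply: cch_npow; [exact: crit_gt0|apply/cch_lprod/adm_twist; exact: adm_low].
- by move=> z _; exact: npow_ge0.
apply: powR_gt0; rewrite normr_gt0 gt_eqF // /lprod big_nat.
apply: prodr_gt0 => k /andP[_ kn]; rewrite hl /hgs /twist mulr_gt0 ?expR_gt0 //.
have f1 : 0 < f0 (1 : R) by apply: f0_gt0; exact: ltr01.
rewrite /low; case: ifP => _; first by rewrite /cut mulr0 addr0.
by rewrite normr0 subr0 exprn_gt0.
Qed.

Lemma crit_int_low_le e : scales e ->
  crit_int m (lprod (hgs low)) <= crit_int m (lprod (hgs (chi e))).
Proof.
move=> he; apply: le_inth.
- by apply: cch_npow; [exact: crit_gt0|apply/cch_lprod/adm_twist; exact: adm_low].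
- by apply: cch_npow; [exact: crit_gt0|apply/cch_lprod/adm_twist; exact: adm_chi].
move=> y y0; apply: ge0_ler_powR; rewrite ?nnegrE ?normr_ge0 //.
  by rewrite ltW // crit_gt0.
rewrite !ger0_norm ?lprod_hgs_ge0 //; [|exact: chi_ge0|exact: low_ge0].
rewrite /lprod big_nat [leRHS]big_nat; apply: ler_prod => k /andP[_ kn].
rewrite /hgs /twist mulr_ge0 ?expR_ge0 ?low_ge0 //= ler_wpM2l ?expR_ge0 //.
exact: low_le_chi.
Qed.

(** [logalg_comp] takes the whole sequence of derivatives: each one applies [dbump] once more and
    brings a factor [c]. *)
Lemma logalg_cut k c : logalg m (fun y => cut c (lv m k y)).
Proof.
have := @logalg_comp R m k (fun j t => c ^+ j * bump (iter j (@dbump R) 1) (1 + c * t)) 0.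
rewrite (_ : (fun y => _) = fun y => cut c (lv m k y)).
  apply=> j t; rewrite exprSr -mulrA.
  have h := is_derive_affine (is_derive_bump (iter j (@dbump R) 1) (1 + c * t)).
  have := is_derive1M (is_derive_cst (c ^+ j) t 1) h.
  by move/is_derive_eq; apply; rewrite /=; ring.
by apply/funext => y; rewrite expr0 mul1r.
Qed.

Lemma logalg_chi e : logalg m (lprod (hgs (chi e))).
Proof.
apply: (@logalg_prod _ _ _ (fun k y => hgs (chi e) k (lv m k y))) => k.
rewrite /hgs /twist; apply: logalg_mul.
  have := @logalg_comp R m k (fun j t => (spow alpha k.+1 / 2) ^+ j *
    expR (spow alpha k.+1 / 2 * t)) 0.
  rewrite (_ : (fun y => _) = fun y => expR (spow alpha k.+1 / 2 * lv m k y)).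
    apply=> j t; rewrite exprSr -mulrA.
    have h := is_derive_expZ (spow alpha k.+1 / 2) t.
    have := is_derive1M (is_derive_cst ((spow alpha k.+1 / 2) ^+ j) t 1) h.
    by move/is_derive_eq; apply; rewrite /= mul0r add0r.
  by apply/funext => y; rewrite expr0 mul1r.
rewrite /chi; case: ifP => _; first exact: logalg_cut.
by apply: logalg_mul; exact: logalg_cut.
Qed.

(** On the half-space the lift coincides with the test function, and uniqueness of derivatives
    carries this over to the gradients, hence to both integrals. *)
Lemma lift_chi e : scales e -> exists u : 'rV[R]_n -> R,
  [/\ Cc_infty_halfspace u,
      crit_int m (fun y => u (vec n y)) = crit_int m (lprod (hgs (chi e))) &
      defect_int m alpha (fun y => u (vec n y)) (vpartial u) =
      defect_int m alpha (lprod (hgs (chi e))) (dhgs m alpha (chi e) (dchi e))].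
Proof.
move=> he; set f := lprod _.
have cf : c1h m f (dhgs m alpha (chi e) (dchi e)).
  by apply: c1h_hgs; [exact: der_chi|exact: adm_chi|exact: adm_dchi].
have [_ [d [M [d0 M0 box]]]] := c1h_cch cf.
have lf : logalg m f := logalg_chi e.
have bf : boxed m d M f := box.
have hu := Cc_infty_lift d0 M0 lf bf.
have uE : (fun y => lift f (vec n y)) = ext0 f.
  by apply/funext => y; exact: (lift_vec d0 M0 y lf bf).
exists (lift f); split; first exact: hu.
  by rewrite uE; apply: eq_inth => y y0; rewrite ext0T.
apply: eq_inth => y y0; apply: eq_bigr => i _; rewrite /defect.
have := c1h_pd (c1h_vec hu) (ltn_ord i) y0; rewrite uE => h1.
have := pd_ext0 (ltn_ord i) (c1h_cch cf) (fun z z0 => c1h_pd cf (ltn_ord i) z0) y => h2.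
by rewrite (pd_unique h1 h2) (lift_vec d0 M0 y lf bf) !ext0T.
Qed.

Theorem no_sobolev_constant : ~ exists C : R, 0 < C /\
  forall u : 'rV[R]_n -> R, Cc_infty_halfspace u -> HSM_ineq alpha C u.
Proof.
move=> [C [C0 hC]].
have gen (t : R) : 0 < t -> ~ t <= t / 2 by lra.
have P0 := crit_int_low_gt0; set P := crit_int _ _ in P0.
pose T := C * powR P (2 / crit_exp R n).
have T0 : 0 < T by rewrite mulr_gt0 // powR_gt0.
(* Each of the [n] terms of the defect will be at most [s], hence their sum at most [T / 2], against
   a lower bound [T]. *)
pose s := T / (2 * n%:R).
have n0 : 0 < n%:R :> R by rewrite ltr0n.
have s0 : 0 < s by rewrite divr_gt0 // mulr_gt0.
have [B B0 hB] := last_term_bound alpha_le0 alpha_m0.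
(* The last scale is fixed first, since the constant of [term_bound] depends on it. *)
pose c := Num.min 1 (s / (B + 1)).
have B1 : 0 < B + 1 by lra.
have hc : 0 < c <= 1 by rewrite lt_min ltr01 divr_gt0 // /c ge_min lexx.
have cB : c * B <= s.
  have h : c * (B + 1) <= s by rewrite -ler_pdivlMr // /c ge_min lexx orbT.
  by have /andP[c0 _] := hc; lra.
have [B' B'0 hB'] := term_bound alpha_le0 hc.
have [e [he em hk]] := choose_scales B'0 s0 hc.
have [u [hu uP uQ]] := lift_chi he.
have le3 := (HSM_ineqP alpha C hu).1 (hC u hu).
rewrite uP uQ (defect_int_chi alpha he) in le3.
have le1 : T <= C * powR (crit_int m (lprod (hgs (chi e)))) (2 / crit_exp R n).
  apply: ler_wpM2l; first exact: ltW.
  apply: ge0_ler_powR.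
  - by apply: divr_ge0; [by []|apply: ltW; exact: crit_gt0].
  - by rewrite nnegrE; exact: ltW.
  - by rewrite nnegrE; exact: crit_int_ge0.
  - exact: crit_int_low_le.
have le2 : \sum_(k < n) chi_term m alpha e k <= \sum_(k < n) s.
  apply: ler_sum => k _; have := ltn_ord k; rewrite ltnS leq_eqVlt => /predU1P[->|km].
    by apply: (le_trans (hB e he)); rewrite em.
  by apply: (le_trans (hB' e k he em km)); exact: hk.
have := le_trans le1 (le_trans le3 le2).
rewrite sumr_const card_ord -mulr_natr /s.
have -> : T / (2 * n%:R) * n%:R = T / 2 by field; rewrite gt_eqF.
exact: gen.
Qed.

End Counterexample.

(* Dimension n = n'.+1 with 3 <= n; alpha i (i < n) stands for alpha_{i+1}. *)
Theorem theoremB (R : realType) (n' : nat) (hn : (3 <= n'.+1)%N)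
    (alpha : nat -> R) (halpha : forall i, (i < n'.+1)%N -> alpha i <= 0) :
  (alpha n' < 0 ->
     exists C : R, 0 < C /\
       forall u : 'rV[R]_n'.+1 -> R, Cc_infty_halfspace u -> HSM_ineq alpha C u)
  /\
  (alpha n' = 0 ->
     ~ exists C : R, 0 < C /\
       forall u : 'rV[R]_n'.+1 -> R, Cc_infty_halfspace u -> HSM_ineq alpha C u).
Proof.
split=> [lt0|eq0]; last exact: no_sobolev_constant.
have [C C0 hC] := sobolev_defect (hn : (2 <= n')%N) halpha lt0.
exists C; split => // u hu; apply/(HSM_ineqP alpha C hu).
exact: hC (c1h_vec hu).
Qed.
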